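(* Let $x_0\in\mathbb R$, let $r>0$, and let $\Gamma$ be a simple circular arc that starts at $x_0$, has all its other points in $\mathbb H=\{z\in\mathbb C:\operatorname{Im} z>0\}$, and lies on the circle of radius $r$ centered at $x_0+ir$ (so $\Gamma$ is tangent to $\mathbb R$ at $x_0$; it is a proper sub-arc and does not close up to the whole circle). Parametrize the growing initial sub-arcs $\gamma(t)$, $0\le t\le T$, of $\Gamma$ (with $\gamma(T)=\Gamma$) so that the conformal map $h(\cdot,t)$ of $\mathbb H\setminus\gamma(t)$ onto $\mathbb H$ normalized at infinity satisfies $h(z,t)=z+\frac{2t}{z}+O(|z|^{-2})$ as $z\to\infty$, and let $\lambda:[0,T]\to\mathbb R$ be the continuous driving term for which $$\frac{dh}{dt}=\frac{2}{h-\lambda(t)},\qquad h(z,0)\equiv z .$$ Then $\lambda\in\mathrm{Lip}(1/3)$; more precisely, $\lambda$ is $\mathrm{Lip}(1/3)$ about the point $t=0$ and is analytic at every $t\in(0,T)$.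
   Context: $\mathrm{Lip}(a)$, $0<a\le 1$, denotes the class of real-valued functions that are Hölder continuous with exponent $a$, i.e. $|\lambda(t)-\lambda(s)|\le C|t-s|^{a}$ for some constant $C$ and all $s,t$ in the interval considered. For a simple arc growing in $\mathbb H$ from a point of $\mathbb R$ and parametrized as in the statement, the driving term $\lambda$ is uniquely determined, and $\lambda(t)$ is the boundary value of $h(\cdot,t)$ at the tip of $\gamma(t)$. *)

(* Defs.v *)
From Stdlib Require Import Reals.
From Coquelicot Require Import Coquelicot.

Open Scope R_scope.

Definition segment (a b : R) : R -> Prop := fun t => a <= t <= b.

Definition upper_half_plane (z : C) : Prop := 0 < Im z.

Definition holomorphic_on (D : C -> Prop) (f : C -> C) : Prop :=
  forall z, D z -> ex_derive (K := C_AbsRing) (V := C_NormedModule) f z.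

(* Conformal map of [D] onto [E]: a biholomorphic bijection ([D], [E] open).
   Only the values of [f] on [D] matter. *)
Definition conformal_onto (D E : C -> Prop) (f : C -> C) : Prop :=
  holomorphic_on D f /\
  exists k : C -> C,
    holomorphic_on E k /\
    (forall z, D z -> E (f z) /\ k (f z) = z) /\
    (forall w, E w -> D (k w) /\ f (k w) = w).

(* A simple arc starting at [x0], otherwise contained in the upper half-plane,
   on the circle of radius [r] centered at [x0 + i r].  Both orientations are
   allowed; continuity and injectivity on the compact interval exclude the full
   circle. *)
Definition tangent_circular_arc (x0 r T : R) (g : R -> C) : Prop :=
  g 0 = RtoC x0 /\
  continuous_on (segment 0 T) g /\
  (forall s t, segment 0 T s -> segment 0 T t -> g s = g t -> s = t) /\
  (forall t, 0 < t <= T -> upper_half_plane (g t)) /\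
  (forall t, segment 0 T t -> Cmod (g t - (RtoC x0 + Ci * RtoC r)) = r).

Definition initial_arc (g : R -> C) (t : R) : C -> Prop :=
  fun z => exists s, segment 0 t s /\ g s = z.

Definition slit_half_plane (g : R -> C) (t : R) : C -> Prop :=
  fun z => upper_half_plane z /\ ~ initial_arc g t z.

(* f(z) = z + 2t/z + O(|z|^-2) as z tends to infinity in [D]. *)
Definition hydrodynamic_at_infinity (D : C -> Prop) (t : R) (f : C -> C) : Prop :=
  exists M K : R, 0 < M /\
    forall z, D z -> M <= Cmod z ->
      Cmod (f z - (z + RtoC (2 * t) / z)) <= K / (Cmod z) ^ 2.

(* Derivative in a real variable relative to [D]: one-sided at the endpoints
   when [D] is a segment. *)
Definition is_derive_within (D : R -> Prop) (f : R -> C) (t : R) (l : C) : Prop :=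
  filterdiff (U := R_NormedModule) (V := C_R_NormedModule)
    f (within D (locally t)) (fun y : R => scal y (l : C_R_NormedModule)).

(* The case [s = t] is excluded because [Rpower 0 a = 1]. *)
Definition Lip (a : R) (I : R -> Prop) (f : R -> R) : Prop :=
  exists K : R, forall s t, I s -> I t -> s <> t ->
    Rabs (f t - f s) <= K * Rpower (Rabs (t - s)) a.

Definition analytic_at (f : R -> R) (t0 : R) : Prop :=
  exists (a : nat -> R) (rho : R), 0 < rho /\
    forall t, Rabs (t - t0) < rho -> is_pseries a (t - t0) (f t).

(* Main.v *)
(** After normalising x0 = 0, the inversion z |-> - 1 / z turns the arc into a
    horizontal half-line, and the conformal map of the slit half-plane becomes an
    explicit Schwarz-Christoffel map built from u + log u.  With
    b = 1 / (2 pi r) and a real parameter 0 < v < 1 / b for the tip, expanding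
    the map at infinity gives

      24 t = b v^3 (4 - 3 b v),     lambda = x0 +/- (v - (3/2) b v^2).

    So v is the inverse of a quartic polynomial with a triple zero at t = 0 and
    positive derivative on (0, 1 / b): it is Lip(1/3) at 0 and analytic
    elsewhere.

    The map h is identified with the explicit one by uniqueness: a holomorphic
    automorphism of the upper half-plane asymptotic to the identity at infinity
    is the identity, by the maximum principle (mean value property, from
    Goursat's argument on rectangles) applied to it and to its inverse.  Finally,
    differentiating the implicit equation W(h, v) = - 1 / z in time and comparing
    with the Loewner equation gives lambda. *)

Require Import Defs.
From Stdlib Require Import Reals Lra Lia Classical ClassicalEpsilon.
From Coquelicot Require Import Coquelicot.

Open Scope R_scope.

(** * Differentiation relative to a set *)

(** The arc comes with a parametrization of which only continuity and injectivity are known, so the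
    tip position [xi t] has no formula. But every tip position is realized by some parameter [v],
    which can therefore be picked for each time separately; the coefficient of 1/z then forces
    [slit_time b (v t) = t], and the continuity, differentiability and analyticity of [v] are all
    drawn from this one equation. The driving term is not computed as a boundary value at the tip.
    It is read off from the trajectory of a single interior point that no slit ever meets. The
    number [v - (3/2) b v^2] that comes out is the critical point of the explicit map, that is, the
    preimage of the tip. The explicit map has three free constants besides [b] and [v]. They are
    fixed by its behaviour at infinity: infinity goes to infinity, the derivative there is 1, and
    there is no constant term. *)

Definition continuous_in (S : C -> Prop) (f : C -> C) (z : C) : Prop :=
  forall eps, 0 < eps -> exists d, 0 < d /\
    forall w, S w -> Cmod (w - z) < d -> Cmod (f w - f z) < eps.

(* Caratheodory's form of differentiability relative to [S].  With [S] a set of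
   real numbers it also covers derivatives of curves [R -> C]. *)
Definition cderiv_in (S : C -> Prop) (f : C -> C) (z l : C) : Prop :=
  exists q : C -> C, continuous_in S q z /\ q z = l /\
    forall w, S w -> (f w - f z = q w * (w - z))%C.

Definition everywhere : C -> Prop := fun _ => True.

Definition real_in (D : R -> Prop) : C -> Prop := fun w => Im w = 0 /\ D (Re w).

Lemma Cmod_sub_sym (a b : C) : Cmod (a - b) = Cmod (b - a).
Proof. rewrite <- (Cmod_opp (b - a)). f_equal. ring. Qed.

Lemma Cmod_sub_ge (a b : C) : Cmod a - Cmod b <= Cmod (a - b).
Proof.
  generalize (Cmod_triangle (a - b) b).
  replace (a - b + b)%C with a by ring. lra.
Qed.

Lemma Cmod_le_Re_Im (z : C) : Cmod z <= Rabs (Re z) + Rabs (Im z).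
Proof.
  destruct z as [x y]; unfold Re, Im; simpl.
  replace (x, y) with (RtoC x + Ci * RtoC y)%C
    by (unfold RtoC, Ci, Cplus, Cmult; simpl; f_equal; ring).
  eapply Rle_trans; [apply Cmod_triangle|].
  rewrite Cmod_mult, Cmod_Ci, !Cmod_R. lra.
Qed.

Lemma im_le_Cmod (z : C) : Rabs (Im z) <= Cmod z.
Proof.
  generalize (Rmax_Cmod z) (Rmax_r (Rabs (fst z)) (Rabs (snd z))).
  unfold Im. lra.
Qed.

Lemma Cmod_sub_ne (z w : C) : w <> z -> 0 < Cmod (w - z).
Proof.
  intros H. apply Cmod_gt_0. intros E. apply H.
  replace w with ((w - z) + z)%C by ring. rewrite E. ring.
Qed.

Lemma ball_R (x y : R) (e : posreal) : ball x e y <-> Rabs (y - x) < e.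
Proof. reflexivity. Qed.

Lemma pos_min3 (a b c : R) : 0 < a -> 0 < b -> 0 < c ->
  exists d, 0 < d /\ d <= a /\ d <= b /\ d <= c.
Proof.
  intros Ha Hb Hc. exists (Rmin a (Rmin b c)).
  split; [repeat apply Rmin_glb_lt; assumption|split; [apply Rmin_l|split]].
  - eapply Rle_trans; [apply Rmin_r|apply Rmin_l].
  - eapply Rle_trans; [apply Rmin_r|apply Rmin_r].
Qed.

Lemma RtoC_ne_0 (x : R) : x <> 0 -> RtoC x <> 0.
Proof. intros H E. apply H, RtoC_inj, E. Qed.

Section Continuity.

Variable S : C -> Prop.

Lemma continuous_in_const (c z : C) : continuous_in S (fun _ => c) z.
Proof.
  intros e He. exists 1. split; [lra|]. intros w _ _.
  replace (c - c)%C with (RtoC 0) by ring. rewrite Cmod_0. exact He.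
Qed.

Lemma continuous_in_id (z : C) : continuous_in S (fun w => w) z.
Proof. intros e He. exists e. split; auto. Qed.

Lemma continuous_in_plus (f g : C -> C) (z : C) :
  continuous_in S f z -> continuous_in S g z ->
  continuous_in S (fun w => (f w + g w)%C) z.
Proof.
  intros Hf Hg e He.
  destruct (Hf (e / 2)) as [d1 [Hd1 H1]]; [lra|].
  destruct (Hg (e / 2)) as [d2 [Hd2 H2]]; [lra|].
  exists (Rmin d1 d2). split; [apply Rmin_glb_lt; auto|].
  intros w Hw Hd.
  specialize (H1 w Hw (Rlt_le_trans _ _ _ Hd (Rmin_l _ _))).
  specialize (H2 w Hw (Rlt_le_trans _ _ _ Hd (Rmin_r _ _))).
  replace (f w + g w - (f z + g z))%C with ((f w - f z) + (g w - g z))%C by ring.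
  eapply Rle_lt_trans; [apply Cmod_triangle|]. lra.
Qed.

Lemma continuous_in_bound (f : C -> C) (z : C) :
  continuous_in S f z -> exists d, 0 < d /\
    forall w, S w -> Cmod (w - z) < d -> Cmod (f w) < Cmod (f z) + 1.
Proof.
  intros Hf. destruct (Hf 1) as [d [Hd H]]; [lra|].
  exists d. split; auto. intros w Hw Hd'. specialize (H w Hw Hd').
  generalize (Cmod_sub_ge (f w) (f z)). lra.
Qed.

Lemma continuous_in_mult (f g : C -> C) (z : C) :
  continuous_in S f z -> continuous_in S g z ->
  continuous_in S (fun w => (f w * g w)%C) z.
Proof.
  intros Hf Hg e He.
  destruct (continuous_in_bound g z Hg) as [d0 [Hd0 H0]].
  pose proof (Cmod_ge_0 (f z)) as Pf. pose proof (Cmod_ge_0 (g z)) as Pg.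
  destruct (Hf (e / 2 / (Cmod (g z) + 1))) as [d1 [Hd1 H1]];
    [repeat apply Rdiv_lt_0_compat; lra|].
  destruct (Hg (e / 2 / (Cmod (f z) + 1))) as [d2 [Hd2 H2]];
    [repeat apply Rdiv_lt_0_compat; lra|].
  exists (Rmin d0 (Rmin d1 d2)). split; [repeat apply Rmin_glb_lt; auto|].
  intros w Hw Hd.
  assert (Cmod (w - z) < d0 /\ Cmod (w - z) < d1 /\ Cmod (w - z) < d2) as [A0 [A1 A2]].
  { generalize (Rmin_l d0 (Rmin d1 d2)) (Rmin_r d0 (Rmin d1 d2))
      (Rmin_l d1 d2) (Rmin_r d1 d2). lra. }
  specialize (H0 w Hw A0). specialize (H1 w Hw A1). specialize (H2 w Hw A2).
  replace (f w * g w - f z * g z)%C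
    with ((f w - f z) * g w + f z * (g w - g z))%C by ring.
  eapply Rle_lt_trans; [apply Cmod_triangle|]. rewrite !Cmod_mult.
  assert (Cmod (f w - f z) * Cmod (g w) <= e / 2).
  { replace (e / 2) with (e / 2 / (Cmod (g z) + 1) * (Cmod (g z) + 1)) by (field; lra).
    apply Rmult_le_compat; try apply Cmod_ge_0; lra. }
  assert (Cmod (f z) * Cmod (g w - g z) < e / 2).
  { replace (e / 2) with ((Cmod (f z) + 1) * (e / 2 / (Cmod (f z) + 1))) by (field; lra).
    assert (0 < e / 2 / (Cmod (f z) + 1)) by (repeat apply Rdiv_lt_0_compat; lra).
    pose proof (Cmod_ge_0 (g w - g z)). nra. }
  lra.
Qed.

Lemma continuous_in_inv (f : C -> C) (z : C) :
  f z <> 0 -> continuous_in S f z -> continuous_in S (fun w => (/ f w)%C) z.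
Proof.
  intros Hz Hf e He.
  apply Cmod_gt_0 in Hz. set (m := Cmod (f z)) in *.
  destruct (Hf (Rmin (m / 2) (e * m * m / 2))) as [d [Hd H]].
  { apply Rmin_glb_lt; [lra|].
    assert (0 < e * m * m) by (repeat apply Rmult_lt_0_compat; auto). lra. }
  exists d. split; auto. intros w Hw Hd'. specialize (H w Hw Hd').
  generalize (Rmin_l (m / 2) (e * m * m / 2)) (Rmin_r (m / 2) (e * m * m / 2)).
  intros L1 L2.
  assert (Hm : m / 2 < Cmod (f w)).
  { generalize (Cmod_sub_ge (f z) (f w)). rewrite Cmod_sub_sym. fold m. lra. }
  assert (N1 : f w <> 0) by (apply Cmod_gt_0; lra).
  assert (N2 : f z <> 0) by (apply Cmod_gt_0; fold m; lra).
  replace (/ f w - / f z)%C with ((f z - f w) / (f w * f z))%C by (field; auto).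
  rewrite Cmod_div by (apply Cmult_neq_0; auto). rewrite Cmod_mult, Cmod_sub_sym.
  fold m. apply Rmult_lt_reg_r with (Cmod (f w) * m); [nra|].
  unfold Rdiv. rewrite Rmult_assoc, Rinv_l, Rmult_1_r by nra.
  assert (e * m * m / 2 < e * (Cmod (f w) * m)).
  { replace (e * m * m / 2) with (e * (m / 2 * m)) by field.
    apply Rmult_lt_compat_l; [exact He|]. apply Rmult_lt_compat_r; [exact Hz|exact Hm]. }
  lra.
Qed.

Lemma continuous_in_comp (S' : C -> Prop) (f g : C -> C) (z : C) :
  (forall w, S w -> S' (g w)) ->
  continuous_in S' f (g z) -> continuous_in S g z ->
  continuous_in S (fun w => f (g w)) z.
Proof.
  intros HS Hf Hg e He. destruct (Hf e He) as [d1 [Hd1 H1]].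
  destruct (Hg d1 Hd1) as [d2 [Hd2 H2]]. exists d2. split; auto.
Qed.

Lemma continuous_in_ext_loc (f g : C -> C) (z : C) (d : R) :
  0 < d -> f z = g z -> (forall w, S w -> Cmod (w - z) < d -> f w = g w) ->
  continuous_in S f z -> continuous_in S g z.
Proof.
  intros Hd Hz HE Hf e He. destruct (Hf e He) as [d1 [Hd1 H1]].
  exists (Rmin d d1). split; [apply Rmin_glb_lt; auto|].
  intros w Hw Hlt.
  rewrite <- Hz, <- HE; auto.
  - apply H1; auto. eapply Rlt_le_trans; [exact Hlt|apply Rmin_r].
  - eapply Rlt_le_trans; [exact Hlt|apply Rmin_l].
Qed.

Lemma cderiv_in_continuous (f : C -> C) (z l : C) :
  cderiv_in S f z l -> continuous_in S f z.
Proof.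
  intros [q [Hq [Hl H]]].
  assert (K : continuous_in S (fun w => (f z + q w * (w - z))%C) z).
  { apply continuous_in_plus; [apply continuous_in_const|].
    apply continuous_in_mult; auto.
    apply (continuous_in_plus (fun w => w) (fun _ => (- z)%C));
      [apply continuous_in_id|apply continuous_in_const]. }
  refine (continuous_in_ext_loc _ _ z 1 _ _ _ K); [lra|ring|].
  intros w Hw _. rewrite <- H by auto. ring.
Qed.

Lemma cderiv_in_const (c z : C) : cderiv_in S (fun _ => c) z 0.
Proof.
  exists (fun _ => RtoC 0). split; [apply continuous_in_const|].
  split; auto. intros; ring.
Qed.

Lemma cderiv_in_id (z : C) : cderiv_in S (fun w => w) z 1.
Proof.
  exists (fun _ => RtoC 1). split; [apply continuous_in_const|].
  split; auto. intros; ring.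
Qed.

Lemma cderiv_in_eq (f : C -> C) (z l l' : C) :
  cderiv_in S f z l -> l = l' -> cderiv_in S f z l'.
Proof. intros H <-. exact H. Qed.

Lemma cderiv_in_plus (f g : C -> C) (z l m : C) :
  cderiv_in S f z l -> cderiv_in S g z m ->
  cderiv_in S (fun w => (f w + g w)%C) z (l + m)%C.
Proof.
  intros [q [Hq [<- H]]] [p [Hp [<- K]]].
  exists (fun w => (q w + p w)%C). split; [apply continuous_in_plus; auto|].
  split; auto. intros w Hw.
  replace (f w + g w - (f z + g z))%C with ((f w - f z) + (g w - g z))%C by ring.
  rewrite H, K; auto. ring.
Qed.

Lemma cderiv_in_mult (f g : C -> C) (z l m : C) :
  cderiv_in S f z l -> cderiv_in S g z m ->
  cderiv_in S (fun w => (f w * g w)%C) z (l * g z + f z * m)%C.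
Proof.
  intros Hf Hg. pose proof (cderiv_in_continuous g z m Hg) as Cg.
  destruct Hf as [q [Hq [<- H]]]. destruct Hg as [p [Hp [<- K]]].
  exists (fun w => (q w * g w + f z * p w)%C). split.
  { apply continuous_in_plus; apply continuous_in_mult; auto using continuous_in_const. }
  split; auto. intros w Hw.
  replace (f w * g w - f z * g z)%C
    with ((f w - f z) * g w + f z * (g w - g z))%C by ring.
  rewrite H, K; auto. ring.
Qed.

Lemma cderiv_in_inv (f : C -> C) (z l : C) :
  f z <> 0 -> (forall w, S w -> f w <> 0) -> cderiv_in S f z l ->
  cderiv_in S (fun w => (/ f w)%C) z (- l / (f z * f z))%C.
Proof.
  intros Hz Hw Hf. pose proof (cderiv_in_continuous f z l Hf) as Cf.
  destruct Hf as [q [Hq [<- H]]].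
  exists (fun w => (- q w * (/ f w * / f z))%C). split.
  { apply (continuous_in_mult (fun w => - q w)%C).
    - refine (continuous_in_ext_loc (fun w => -(1) * q w)%C _ z 1 _ _ _ _);
        try (intros; ring); [lra|].
      apply continuous_in_mult; auto using continuous_in_const.
    - apply continuous_in_mult; auto using continuous_in_const.
      apply continuous_in_inv; auto. }
  split; [field; auto|]. intros w Sw.
  replace (- q w * (/ f w * / f z) * (w - z))%C
    with (- (q w * (w - z)) * (/ f w * / f z))%C by ring.
  rewrite <- H by auto. field. auto.
Qed.

Lemma cderiv_in_comp (S' : C -> Prop) (f g : C -> C) (z l m : C) :
  (forall w, S w -> S' (g w)) ->
  cderiv_in S' f (g z) l -> cderiv_in S g z m ->
  cderiv_in S (fun w => f (g w)) z (l * m)%C.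
Proof.
  intros HS Hf Hg. pose proof (cderiv_in_continuous g z m Hg) as Cg.
  destruct Hf as [q [Hq [<- H]]]. destruct Hg as [p [Hp [<- K]]].
  exists (fun w => (q (g w) * p w)%C). split.
  { apply continuous_in_mult; auto. apply continuous_in_comp with S'; auto. }
  split; auto. intros w Sw. rewrite H, K; auto. ring.
Qed.

Lemma cderiv_in_scal (c : C) (f : C -> C) (z l : C) :
  cderiv_in S f z l -> cderiv_in S (fun w => (c * f w)%C) z (c * l)%C.
Proof.
  intros H. eapply cderiv_in_eq.
  - apply (cderiv_in_mult (fun _ => c) f z 0 l); auto using cderiv_in_const.
  - ring.
Qed.

Lemma cderiv_in_opp (f : C -> C) (z l : C) :
  cderiv_in S f z l -> cderiv_in S (fun w => (- f w)%C) z (- l)%C.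
Proof.
  intros [q [Hq [<- H]]]. exists (fun w => (- q w)%C). split; [|split; auto].
  - intros e He. destruct (Hq e He) as [d [Hd K]]. exists d. split; auto.
    intros w Hw Hd'. replace (- q w - - q z)%C with (q z - q w)%C by ring.
    rewrite Cmod_sub_sym. auto.
  - intros w Hw. replace (- f w - - f z)%C with (- (f w - f z))%C by ring.
    rewrite H by auto. ring.
Qed.

Lemma cderiv_in_minus (f g : C -> C) (z l m : C) :
  cderiv_in S f z l -> cderiv_in S g z m ->
  cderiv_in S (fun w => (f w - g w)%C) z (l - m)%C.
Proof. intros H K. apply cderiv_in_plus; auto. apply cderiv_in_opp; auto. Qed.

End Continuity.

Lemma continuous_in_sub (S S' : C -> Prop) (f : C -> C) (z : C) :
  (forall w, S w -> S' w) -> continuous_in S' f z -> continuous_in S f z.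
Proof.
  intros HS Hf e He. destruct (Hf e He) as [d [Hd H]]. exists d. split; auto.
Qed.

Lemma cderiv_in_sub (S S' : C -> Prop) (f : C -> C) (z l : C) :
  (forall w, S w -> S' w) -> cderiv_in S' f z l -> cderiv_in S f z l.
Proof.
  intros HS [q [Hq [Hl H]]]. exists q. split; [eapply continuous_in_sub; eauto|auto].
Qed.

(** For the converse, the difference quotient completed by the value [l] at [z] serves as the slope
    function; deciding whether a point equals [z] is where classical logic enters. *)
Lemma cderiv_in_eps (S : C -> Prop) (f : C -> C) (z l : C) :
  cderiv_in S f z l <->
  forall eps, 0 < eps -> exists d, 0 < d /\ forall w, S w -> Cmod (w - z) < d ->
    Cmod (f w - f z - l * (w - z)) <= eps * Cmod (w - z).
Proof.
  split.
  - intros [q [Hq [<- H]]] e He. destruct (Hq e He) as [d [Hd K]].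
    exists d. split; auto. intros w Sw Hw. rewrite H by auto.
    replace (q w * (w - z) - q z * (w - z))%C with ((q w - q z) * (w - z))%C by ring.
    rewrite Cmod_mult. apply Rmult_le_compat_r; [apply Cmod_ge_0|].
    apply Rlt_le, K; auto.
  - intros H.
    exists (fun w => if excluded_middle_informative (w = z) then l
                     else ((f w - f z) / (w - z))%C).
    split; [|split].
    + intros e He. destruct (H (e / 2)) as [d [Hd K]]; [lra|].
      exists d. split; auto. intros w Sw Hw.
      destruct (excluded_middle_informative (z = z)) as [_|N]; [|congruence].
      destruct (excluded_middle_informative (w = z)) as [_|N].
      { replace (l - l)%C with (RtoC 0) by ring. rewrite Cmod_0. exact He. }
      pose proof (Cmod_sub_ne _ _ N) as P.
      assert (w - z <> 0)%C by (apply Cmod_gt_0; auto).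
      specialize (K w Sw Hw).
      replace ((f w - f z) / (w - z) - l)%C
        with ((f w - f z - l * (w - z)) / (w - z))%C by (field; auto).
      rewrite Cmod_div by auto. apply Rmult_lt_reg_r with (Cmod (w - z)); auto.
      unfold Rdiv. rewrite Rmult_assoc, Rinv_l, Rmult_1_r by lra. nra.
    + destruct excluded_middle_informative; congruence.
    + intros w Sw. destruct excluded_middle_informative as [->|N]; [ring|].
      field. apply Cmod_gt_0, Cmod_sub_ne; auto.
Qed.

Lemma cderiv_in_ext_loc (S : C -> Prop) (f g : C -> C) (z l : C) (d : R) :
  0 < d -> f z = g z -> (forall w, S w -> Cmod (w - z) < d -> f w = g w) ->
  cderiv_in S f z l -> cderiv_in S g z l.
Proof.
  rewrite !cderiv_in_eps. intros Hd Hz HE H e He. destruct (H e He) as [d' [Hd' K]].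
  exists (Rmin d d'). split; [apply Rmin_glb_lt; auto|]. intros w Sw Hw.
  generalize (Rmin_l d d') (Rmin_r d d'). intros.
  rewrite <- Hz, <- HE by (auto; lra). apply K; auto; lra.
Qed.

Lemma cderiv_in_loc (S : C -> Prop) (f : C -> C) (z l : C) (d : R) :
  0 < d -> (forall w, Cmod (w - z) < d -> S w) ->
  cderiv_in S f z l -> cderiv_in everywhere f z l.
Proof.
  rewrite !cderiv_in_eps. intros Hd HS H e He. destruct (H e He) as [d' [Hd' K]].
  exists (Rmin d d'). split; [apply Rmin_glb_lt; auto|]. intros w _ Hw.
  generalize (Rmin_l d d') (Rmin_r d d'). intros. apply K; [apply HS|]; lra.
Qed.

Lemma ex_derive_cderiv (f : C -> C) (z : C) :
  ex_derive (K := C_AbsRing) (V := C_NormedModule) f z <->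
  exists l, cderiv_in everywhere f z l.
Proof.
  split.
  - intros [l [_ H]]. exists l. apply cderiv_in_eps. intros e He.
    destruct (H z (fun P HP => HP) (mkposreal e He)) as [d K].
    exists d. split; [apply cond_pos|]. intros w _ Hw.
    specialize (K w).
    assert (B : ball (M := AbsRing_UniformSpace C_AbsRing) z d w) by exact Hw.
    specialize (K B).
    change (Cmod (f w - f z - (w - z) * l) <= e * Cmod (w - z)) in K.
    rewrite (Cmult_comm l). exact K.
  - intros [l Hl]. exists l. split; [exact (@is_linear_scal_l C_AbsRing C_NormedModule l)|].
    intros x Hx. assert (x = z) as ->.
    { symmetry. exact (@is_filter_lim_locally_unique C_AbsRing (AbsRing_NormedModule C_AbsRing) z x Hx). }
    intros e. destruct (proj1 (cderiv_in_eps _ _ _ _) Hl e (cond_pos e)) as [d [Hd K]].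
    exists (mkposreal d Hd). intros w B.
    specialize (K w I B).
    change (Cmod (f w - f z - (w - z) * l) <= e * Cmod (w - z)).
    rewrite (Cmult_comm (w - z) l). exact K.
Qed.

Lemma norm_C_R (z : C) : norm (V := C_R_NormedModule) z = Cmod z.
Proof.
  unfold norm; simpl. unfold prod_norm, Cmod; simpl. unfold norm; simpl. unfold abs; simpl.
  f_equal. rewrite !Rmult_1_r, <- !Rabs_mult, !Rabs_right; auto; nra.
Qed.

(** Writing a curve as [w |-> f (Re w)] on a set of real points lets the chain rule mix time
    derivatives, one-sided ones included, with complex derivatives. *)
Lemma is_derive_within_cderiv (D : R -> Prop) (f : R -> C) (t : R) (l : C) :
  D t -> is_derive_within D f t l ->
  cderiv_in (real_in D) (fun w => f (Re w)) (RtoC t) l.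
Proof.
  intros Dt [_ H]. apply cderiv_in_eps. intros e He.
  assert (Hl : is_filter_lim (within D (locally t)) t).
  { intros P HP. unfold within. apply filter_imp with P; auto. }
  destruct (H t Hl (mkposreal e He)) as [d K].
  exists d. split; [apply cond_pos|]. intros [w w'] [Hi HD] Hw.
  unfold Im in Hi; simpl in Hi. subst w'. change (Re (w, 0)) with w in *.
  change (Re (RtoC t)) with t.
  replace ((w, 0) - RtoC t)%C with (RtoC (w - t)) in * by
    (unfold RtoC, Cminus, Cplus, Copp; simpl; f_equal; ring).
  rewrite Cmod_R in *.
  specialize (K w Hw HD). rewrite norm_C_R in K. simpl in K.
  replace (f w - f t - l * RtoC (w - t))%C
    with (minus (minus (f w) (f t)) (scal (minus w t) (l : C_R_NormedModule)) : C);
    [exact K|].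
  unfold minus, plus, opp, scal; simpl. unfold prod_plus, prod_opp, prod_scal; simpl.
  unfold scal; simpl. unfold mult; simpl. unfold plus, opp; simpl.
  apply injective_projections; simpl; ring.
Qed.

(** [locally t D] makes the derivative two-sided, so that real calculus, such as the mean value
    theorem, applies to each coordinate. *)
Lemma is_derive_Re_Im (F : C -> C) (t : R) (l : C) (D : R -> Prop) :
  locally t D -> cderiv_in (real_in D) F (RtoC t) l ->
  is_derive (fun s => Re (F (RtoC s))) t (Re l) /\
  is_derive (fun s => Im (F (RtoC s))) t (Im l).
Proof.
  intros [d0 HD] H. rewrite cderiv_in_eps in H.
  assert (K : forall e, 0 < e -> exists d, 0 < d /\ forall s, Rabs (s - t) < d ->
    Cmod (F (RtoC s) - F (RtoC t) - l * RtoC (s - t)) <= e * Rabs (s - t)).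
  { intros e He. destruct (H e He) as [d [Hd K]].
    exists (Rmin d d0). split; [apply Rmin_glb_lt; [auto|apply cond_pos]|].
    intros s Hs. generalize (Rmin_l d d0) (Rmin_r d d0). intros L1 L2.
    specialize (K (RtoC s)). rewrite <- RtoC_minus, Cmod_R in K. apply K; [|lra].
    split; auto. apply HD. rewrite ball_R. simpl Re. lra. }
  split; (split; [apply is_linear_scal_l|]); intros x Hx;
    (assert (x = t) as -> by (symmetry; exact (@is_filter_lim_locally_unique R_AbsRing R_NormedModule t x Hx)));
    intros e; destruct (K e (cond_pos e)) as [d [Hd L]]; exists (mkposreal d Hd);
    intros s Hs; specialize (L s Hs); unfold norm, minus, plus, opp, scal; simpl;
    unfold abs, mult; simpl; (eapply Rle_trans; [|exact L]).
  - eapply Rle_trans; [|apply re_le_Cmod]. right. f_equal.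
    destruct (F (RtoC s)), (F (RtoC t)), l; simpl; ring.
  - eapply Rle_trans; [|apply im_le_Cmod]. right. f_equal.
    destruct (F (RtoC s)), (F (RtoC t)), l; simpl; ring.
Qed.

Lemma cderiv_in_of_is_derive (D : R -> Prop) (f : R -> R) (t l : R) :
  is_derive f t l ->
  cderiv_in (real_in D) (fun w => RtoC (f (Re w))) (RtoC t) (RtoC l).
Proof.
  intros [_ H]. apply cderiv_in_eps. intros e He.
  destruct (H t (fun P HP => HP) (mkposreal e He)) as [d K].
  exists d. split; [apply cond_pos|]. intros [w w'] [Hi _] Hw.
  unfold Im in Hi; simpl in Hi. subst w'. change (Re (w, 0)) with w in *.
  change (w, 0) with (RtoC w) in *. change (Re (RtoC t)) with t.
  rewrite <- !RtoC_minus, <- RtoC_mult, <- RtoC_minus, !Cmod_R in *.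
  specialize (K w Hw). unfold norm, minus, plus, opp, scal in K; simpl in K.
  unfold abs, mult in K; simpl in K.
  replace (f w - f t - l * (w - t)) with (f w + - f t + - ((w + - t) * l)) by ring.
  exact K.
Qed.

(** * Complex exponential and logarithm *)

(** Since [f (g w) = w], a zero of the slope [q (g w)] would force [w = w0], where the slope is
    [l <> 0]. So its reciprocal is a slope function for [g], continuous at [w0] because [g] is. As
    [S] may be any set, the rule serves the logarithms, the inverse of [Omega] and a real inverse
    function alike. *)
Lemma cderiv_in_inverse (S S' : C -> Prop) (f g : C -> C) (w0 l : C) :
  (forall w, S w -> f (g w) = w) -> (forall w, S w -> S' (g w)) -> S w0 ->
  continuous_in S g w0 -> cderiv_in S' f (g w0) l -> l <> 0 ->
  cderiv_in S g w0 (/ l)%C.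
Proof.
  intros Hfg HS Hw0 Hg [q [Hq [<- H]]] Hl.
  assert (N : forall w, S w -> q (g w) <> 0).
  { intros w Sw E. assert (w - w0 = 0)%C as E'.
    { pose proof (H (g w) (HS w Sw)) as K. rewrite !Hfg, E in K by auto.
      rewrite K. ring. }
    assert (w = w0) as -> by (replace w with (w - w0 + w0)%C by ring; rewrite E'; ring).
    contradiction. }
  exists (fun w => (/ q (g w))%C). split; [|split; auto].
  - apply continuous_in_inv; auto. apply continuous_in_comp with S'; auto.
  - intros w Sw. replace (w - w0)%C with (q (g w) * (g w - g w0))%C.
    + field. auto.
    + rewrite <- H, !Hfg by auto. reflexivity.
Qed.

Definition cexp (z : C) : C := (exp (Re z) * cos (Im z), exp (Re z) * sin (Im z)).

Lemma cexp_plus (z w : C) : cexp (z + w) = (cexp z * cexp w)%C.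
Proof.
  destruct z as [a b], w as [c d]. unfold cexp, Re, Im; simpl.
  rewrite exp_plus, cos_plus, sin_plus.
  apply injective_projections; simpl; ring.
Qed.

Lemma Cmod_cexp (z : C) : Cmod (cexp z) = exp (Re z).
Proof.
  unfold cexp, Cmod; simpl.
  pose proof (sin2_cos2 (Im z)) as H. unfold Rsqr in H.
  match goal with |- sqrt ?x = _ =>
    replace x with (exp (Re z) * exp (Re z) *
      (sin (Im z) * sin (Im z) + cos (Im z) * cos (Im z))) by ring end.
  rewrite H, Rmult_1_r. apply sqrt_square. apply Rlt_le, exp_pos.
Qed.

Lemma cexp_ne_0 (z : C) : cexp z <> 0.
Proof. apply Cmod_gt_0. rewrite Cmod_cexp. apply exp_pos. Qed.

Lemma is_derive_eps (f : R -> R) (x l e : R) :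
  is_derive f x l -> 0 < e -> exists d, 0 < d /\ forall y, Rabs (y - x) < d ->
    Rabs (f y - f x - l * (y - x)) <= e * Rabs (y - x).
Proof.
  intros [_ H] He. destruct (H x (fun P HP => HP) (mkposreal e He)) as [d K].
  exists d. split; [apply cond_pos|]. intros y Hy. specialize (K y Hy).
  unfold norm, minus, plus, opp, scal in K; simpl in K. unfold abs, mult in K; simpl in K.
  replace (f y - f x - l * (y - x)) with (f y + - f x + - ((y + - x) * l)) by ring.
  exact K.
Qed.

Lemma cderiv_cexp_0 : cderiv_in everywhere cexp 0 1.
Proof.
  apply cderiv_in_eps. intros e He.
  assert (D1 : is_derive exp 0 1) by (auto_derive; [auto|rewrite exp_0; ring]).
  assert (D2 : is_derive cos 0 0) by (auto_derive; [auto|rewrite sin_0; ring]).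
  assert (D3 : is_derive sin 0 1) by (auto_derive; [auto|rewrite cos_0; ring]).
  (* The two coordinates of the remainder are at most [3 c |w|] and [5 c |w|], so [c <= e / 10]
     leaves room; [c <= 1] bounds the factors [1 + a] and [sin b]. *)
  destruct (pos_min3 1 (e / 10) 1) as (c & Hc & Hc1 & Hc2 & _); [lra..|].
  destruct (is_derive_eps _ _ _ c D1 Hc) as [d1 [P1 H1]].
  destruct (is_derive_eps _ _ _ c D2 Hc) as [d2 [P2 H2]].
  destruct (is_derive_eps _ _ _ c D3 Hc) as [d3 [P3 H3]].
  destruct (pos_min3 d1 d2 d3 P1 P2 P3) as (d & Hd & L1 & L2 & L3).
  exists (Rmin c d). split; [apply Rmin_glb_lt; assumption|].
  intros w _ Hw. replace (w - 0)%C with w in * by ring.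
  generalize (Rmin_l c d) (Rmin_r c d). intros.
  pose proof (re_le_Cmod w) as A. pose proof (im_le_Cmod w) as B.
  destruct w as [a b]. unfold Re, Im in A, B; simpl in A, B.
  set (m := Cmod (a, b)) in *.
  specialize (H1 a). specialize (H2 b). specialize (H3 b).
  rewrite Rminus_0_r in H1, H2, H3. rewrite exp_0 in H1. rewrite cos_0 in H2.
  rewrite sin_0, Rminus_0_r in H3. rewrite Rmult_1_l in H1, H3.
  rewrite Rmult_0_l, Rminus_0_r in H2.
  specialize (H1 ltac:(lra)). specialize (H2 ltac:(lra)). specialize (H3 ltac:(lra)).
  eapply Rle_trans; [apply Cmod_le_Re_Im|].
  unfold cexp, Re, Im; simpl. rewrite exp_0, cos_0, sin_0.
  replace (exp a * cos b + - (1 * 1) + - (1 * a - 0 * b))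
    with ((exp a - 1 - a) * cos b + (1 + a) * (cos b - 1)) by ring.
  replace (exp a * sin b + - (1 * 0) + - (1 * b + 0 * a))
    with ((exp a - 1) * sin b + (sin b - b)) by ring.
  assert (Ca : Rabs (cos b) <= 1) by (apply Rabs_le; apply COS_bound).
  assert (Ea : Rabs (exp a - 1) <= 2 * c).
  { replace (exp a - 1) with ((exp a - 1 - a) + a) by ring.
    eapply Rle_trans; [apply Rabs_triang|]. pose proof (Rabs_pos a). nra. }
  assert (Sa : Rabs (sin b) <= 2 * Rabs b).
  { replace (sin b) with ((sin b - b) + b) by ring.
    eapply Rle_trans; [apply Rabs_triang|]. pose proof (Rabs_pos b). nra. }
  assert (A1 : Rabs (1 + a) <= 2).
  { eapply Rle_trans; [apply Rabs_triang|]. rewrite Rabs_R1. lra. }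
  pose proof (Rabs_pos a). pose proof (Rabs_pos b).
  assert (T1 : Rabs ((exp a - 1 - a) * cos b + (1 + a) * (cos b - 1)) <= 3 * c * m).
  { eapply Rle_trans; [apply Rabs_triang|]. rewrite !Rabs_mult.
    assert (Rabs (exp a - 1 - a) * Rabs (cos b) <= c * m * 1)
      by (apply Rmult_le_compat; try apply Rabs_pos; auto; nra).
    assert (Rabs (1 + a) * Rabs (cos b - 1) <= 2 * (c * m))
      by (apply Rmult_le_compat; try apply Rabs_pos; auto; nra).
    lra. }
  assert (T2 : Rabs ((exp a - 1) * sin b + (sin b - b)) <= 5 * c * m).
  { eapply Rle_trans; [apply Rabs_triang|]. rewrite !Rabs_mult.
    assert (Rabs (exp a - 1) * Rabs (sin b) <= 2 * c * (2 * m))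
      by (apply Rmult_le_compat; try apply Rabs_pos; auto; nra).
    assert (Rabs (sin b - b) <= c * m) by nra.
    lra. }
  assert (0 <= m) by apply Cmod_ge_0. nra.
Qed.

Lemma cderiv_cexp (S : C -> Prop) (z : C) : cderiv_in S cexp z (cexp z).
Proof.
  apply cderiv_in_sub with everywhere; [intros; exact I|].
  apply (cderiv_in_ext_loc _ (fun w => cexp z * cexp (w - z))%C _ z _ 1); try lra.
  - rewrite <- cexp_plus. f_equal. ring.
  - intros w _ _. rewrite <- cexp_plus. f_equal. ring.
  - eapply cderiv_in_eq.
    + apply cderiv_in_scal.
      apply (cderiv_in_comp everywhere everywhere cexp (fun w => w - z)%C z 1 1); auto.
      * replace (z - z)%C with (RtoC 0) by ring. apply cderiv_cexp_0.
      * eapply cderiv_in_eq; [apply cderiv_in_minus;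
          [apply cderiv_in_id|apply cderiv_in_const]|ring].
    + ring.
Qed.

Lemma continuous_in_Re_Im (S : C -> Prop) (f : C -> C) (z : C) :
  continuous (fun w : C => Re (f w)) z -> continuous (fun w : C => Im (f w)) z ->
  continuous_in S f z.
Proof.
  intros H K e He.
  assert (He2 : 0 < e / 2) by lra.
  destruct (H _ (locally_ball _ (mkposreal _ He2))) as [d1 H1].
  destruct (K _ (locally_ball _ (mkposreal _ He2))) as [d2 H2].
  exists (Rmin d1 d2). split; [apply Rmin_glb_lt; apply cond_pos|].
  intros w _ Hw.
  assert (B : forall d : posreal, Cmod (w - z) < d -> ball (M := C_UniformSpace) z d w).
  { intros d Hd. pose proof (re_le_Cmod (w - z)). pose proof (im_le_Cmod (w - z)).
    destruct w as [a b], z as [a' b']. unfold Re, Im in *; simpl in *.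
    split; rewrite ball_R; simpl; unfold Rminus; lra. }
  specialize (H1 w (B d1 (Rlt_le_trans _ _ _ Hw (Rmin_l _ _)))).
  specialize (H2 w (B d2 (Rlt_le_trans _ _ _ Hw (Rmin_r _ _)))).
  rewrite ball_R in H1, H2. cbn [pos] in H1, H2.
  eapply Rle_lt_trans; [apply Cmod_le_Re_Im|].
  destruct (f w), (f z); unfold Re, Im in *; simpl in *. unfold Rminus in *. lra.
Qed.

Lemma continuous_Re (z : C) : continuous (fun w : C => Re w) z.
Proof. apply continuous_fst. Qed.

Lemma continuous_Im (z : C) : continuous (fun w : C => Im w) z.
Proof. apply continuous_snd. Qed.

Lemma continuous_ln_Cmod (z : C) : 0 < Cmod z -> continuous (fun w : C => ln (Cmod w)) z.
Proof.
  intros H. apply (continuous_comp Cmod ln).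
  - apply (filterlim_ext (fun w : C => norm (w : C_R_NormedModule))).
    + intros w. apply norm_C_R.
    + rewrite <- norm_C_R. apply (filterlim_norm (V := C_R_NormedModule)).
  - apply continuity_pt_filterlim, derivable_continuous_pt.
    exists (/ Cmod z). apply derivable_pt_lim_ln. exact H.
Qed.

(* The branch with argument in (0, pi), meaningful on the upper half-plane. *)
Definition clog (z : C) : C := (ln (Cmod z), PI / 2 - atan (Re z / Im z)).

(* The branch with argument in (- pi / 2, pi / 2), meaningful for [0 < Re z]. *)
Definition clogr (z : C) : C := (ln (Cmod z), atan (Im z / Re z)).

Lemma Cmod_pos_Im (z : C) : 0 < Im z -> 0 < Cmod z.
Proof. intros H. generalize (im_le_Cmod z). rewrite Rabs_right; lra. Qed.

Lemma Cmod_pos_Re (z : C) : 0 < Re z -> 0 < Cmod z.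
Proof. intros H. generalize (re_le_Cmod z). rewrite Rabs_right; lra. Qed.

Lemma sqrt_one_plus_ratio (x y : R) :
  0 < y -> sqrt (1 + (x / y)²) = sqrt (x * x + y * y) / y.
Proof.
  intros Hy. replace (1 + (x / y)²) with ((x * x + y * y) / (y * y)).
  - rewrite sqrt_div_alt by nra. rewrite sqrt_square; lra.
  - unfold Rsqr. field. lra.
Qed.

Lemma cexp_clog (z : C) : 0 < Im z -> cexp (clog z) = z.
Proof.
  intros H. pose proof (Cmod_pos_Im z H) as M.
  destruct z as [x y]. unfold cexp, clog, Re, Im in *; cbn [fst snd] in *.
  rewrite exp_ln by auto. rewrite cos_shift, sin_shift, sin_atan, cos_atan.
  rewrite sqrt_one_plus_ratio by auto.
  replace (sqrt (x * x + y * y)) with (Cmod (x, y)) by (unfold Cmod; simpl; f_equal; ring).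
  apply injective_projections; simpl; field; lra.
Qed.

Lemma cexp_clogr (z : C) : 0 < Re z -> cexp (clogr z) = z.
Proof.
  intros H. pose proof (Cmod_pos_Re z H) as M.
  destruct z as [x y]. unfold cexp, clogr, Re, Im in *; cbn [fst snd] in *.
  rewrite exp_ln by auto. rewrite sin_atan, cos_atan.
  rewrite sqrt_one_plus_ratio by auto.
  replace (sqrt (y * y + x * x)) with (Cmod (x, y)) by (unfold Cmod; simpl; f_equal; ring).
  apply injective_projections; simpl; field; lra.
Qed.

Lemma clog_cexp (x th : R) : 0 < th < PI -> clog (cexp (x, th)) = (x, th).
Proof.
  intros H. unfold clog. rewrite Cmod_cexp. unfold Re, Im; simpl. rewrite ln_exp.
  f_equal. assert (0 < sin th) by (apply sin_gt_0; lra).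
  replace (exp x * cos th / (exp x * sin th)) with (tan (PI / 2 - th)).
  - rewrite atan_tan by lra. ring.
  - unfold tan. rewrite sin_shift, cos_shift. field. split; [lra|].
    apply Rgt_not_eq, exp_pos.
Qed.

(** Lets estimates near 1, a boundary point of the upper half-plane, be made with a branch that is
    holomorphic around 1. *)
Lemma clog_eq_clogr (z : C) : 0 < Im z -> 0 < Re z -> clog z = clogr z.
Proof.
  intros Hi Hr. unfold clog, clogr. f_equal.
  rewrite <- atan_inv by (apply Rdiv_lt_0_compat; auto). f_equal. field. split; lra.
Qed.

Lemma Im_clog_bounds (z : C) : 0 < Im (clog z) < PI.
Proof. unfold clog, Im; simpl. generalize (atan_bound (Re z / snd z)). lra. Qed.

Lemma cderiv_clog (z : C) : 0 < Im z -> cderiv_in upper_half_plane clog z (/ z)%C.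
Proof.
  intros H. pose proof (Cmod_pos_Im z H) as M.
  rewrite <- (cexp_clog z H) at 2.
  apply (cderiv_in_inverse _ everywhere cexp); auto.
  - intros w Hw. apply cexp_clog. exact Hw.
  - intros; exact I.
  - apply continuous_in_Re_Im.
    + apply continuous_ln_Cmod. exact M.
    + unfold clog, Im at 1; simpl.
      apply (continuous_minus (V := R_NormedModule) (fun _ : C => PI / 2)
               (fun w : C => atan (Re w / Im w))); [apply continuous_const|].
      apply (continuous_comp (fun w : C => Re w / Im w) atan).
      * apply (continuous_mult (K := R_AbsRing) (fun w : C => Re w) (fun w : C => / Im w));
          [apply continuous_Re|].
        apply (continuous_comp (fun w : C => Im w) Rinv); [apply continuous_Im|].
        apply continuous_Rinv. lra.
      * apply continuity_pt_filterlim, derivable_continuous_pt, derivable_pt_atan.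
  - apply cderiv_cexp.
  - apply cexp_ne_0.
Qed.

Lemma cderiv_clogr (z : C) : 0 < Re z -> cderiv_in (fun w => 0 < Re w) clogr z (/ z)%C.
Proof.
  intros H. pose proof (Cmod_pos_Re z H) as M.
  rewrite <- (cexp_clogr z H) at 2.
  apply (cderiv_in_inverse _ everywhere cexp); auto.
  - intros w Hw. apply cexp_clogr. exact Hw.
  - intros; exact I.
  - apply continuous_in_Re_Im.
    + apply continuous_ln_Cmod. exact M.
    + unfold clogr, Im at 1; simpl.
      apply (continuous_comp (fun w : C => Im w / Re w) atan).
      * apply (continuous_mult (K := R_AbsRing) (fun w : C => Im w) (fun w : C => / Re w));
          [apply continuous_Im|].
        apply (continuous_comp (fun w : C => Re w) Rinv); [apply continuous_Re|].
        apply continuous_Rinv. lra.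
      * apply continuity_pt_filterlim, derivable_continuous_pt, derivable_pt_atan.
  - apply cderiv_cexp.
  - apply cexp_ne_0.
Qed.

(** * Goursat's argument and the maximum principle *)

Lemma half_pow_split (A : R) (n : nat) : A / 2 ^ n = A / 2 ^ S n + A / 2 ^ S n.
Proof. simpl. field. apply pow_nonzero. lra. Qed.

Lemma half_pow_pos (A : R) (n : nat) : 0 < A -> 0 < A / 2 ^ n.
Proof. intros H. apply Rdiv_lt_0_compat; [exact H|apply pow_lt; lra]. Qed.

Lemma half_pow_small (A e : R) : 0 < A -> 0 < e ->
  exists N, forall n, (N <= n)%nat -> A / 2 ^ n < e.
Proof.
  intros HA He. destruct (pow_lt_1_zero (1 / 2)) with (y := e / A) as [N H].
  { rewrite Rabs_right; lra. }
  { apply Rdiv_lt_0_compat; auto. }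
  exists N. intros n Hn. specialize (H n Hn).
  rewrite Rabs_right in H by (apply Rle_ge, pow_le; lra).
  replace (A / 2 ^ n) with (A * (1 / 2) ^ n).
  - apply Rmult_lt_reg_r with (/ A); [apply Rinv_0_lt_compat; auto|].
    replace (A * (1 / 2) ^ n * / A) with ((1 / 2) ^ n) by (field; lra). exact H.
  - unfold Rdiv. rewrite Rmult_1_l, pow_inv. reflexivity.
Qed.

(* Compactness of a rectangle in the form needed for Goursat's argument: the
   local hypothesis is only about subrectangles of the dyadic shapes that
   contain the given point. *)
Lemma quadrisection (Good : R -> R -> nat -> Prop) (A B a b : R) :
  0 < A -> 0 < B ->
  (forall x y n,
     Good x y (S n) -> Good (x + A / 2 ^ S n) y (S n) ->
     Good x (y + B / 2 ^ S n) (S n) -> Good (x + A / 2 ^ S n) (y + B / 2 ^ S n) (S n) ->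
     Good x y n) ->
  (forall p q, a <= p <= a + A -> b <= q <= b + B ->
     exists N, forall n x y, (N <= n)%nat ->
       x <= p <= x + A / 2 ^ n -> y <= q <= y + B / 2 ^ n -> Good x y n) ->
  Good a b 0%nat.
Proof.
  intros HA HB Hadd Hloc. apply NNPP. intros Hbad.
  (* A bad rectangle has a bad quarter; iterating the choice gives nested bad rectangles with sides
     [A / 2 ^ n] and [B / 2 ^ n]. *)
  assert (Hstep : forall (n : nat) (p : R * R), exists p' : R * R,
    (~ Good (fst p) (snd p) n -> ~ Good (fst p') (snd p') (S n)) /\
    fst p <= fst p' <= fst p + A / 2 ^ S n /\ snd p <= snd p' <= snd p + B / 2 ^ S n).
  { intros n [x y]. simpl fst; simpl snd.
    pose proof (half_pow_pos A (S n) HA). pose proof (half_pow_pos B (S n) HB).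
    destruct (classic (Good x y (S n))) as [G1|G1].
    2: { exists (x, y); cbn [fst snd]; intuition lra. }
    destruct (classic (Good (x + A / 2 ^ S n) y (S n))) as [G2|G2].
    2: { exists (x + A / 2 ^ S n, y); cbn [fst snd]; intuition lra. }
    destruct (classic (Good x (y + B / 2 ^ S n) (S n))) as [G3|G3].
    2: { exists (x, y + B / 2 ^ S n); cbn [fst snd]; intuition lra. }
    destruct (classic (Good (x + A / 2 ^ S n) (y + B / 2 ^ S n) (S n))) as [G4|G4].
    2: { exists (x + A / 2 ^ S n, y + B / 2 ^ S n); cbn [fst snd]; intuition lra. }
    exists (x, y); cbn [fst snd]. split; [|lra]. intros H1. exfalso. apply H1. auto. }
  set (step := fun n p => proj1_sig (constructive_indefinite_description _ (Hstep n p))).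
  set (s := fix s n := match n with O => (a, b) | S k => step k (s k) end).
  assert (Hs : forall n,
    (~ Good (fst (s n)) (snd (s n)) n -> ~ Good (fst (s (S n))) (snd (s (S n))) (S n)) /\
    fst (s n) <= fst (s (S n)) <= fst (s n) + A / 2 ^ S n /\
    snd (s n) <= snd (s (S n)) <= snd (s n) + B / 2 ^ S n).
  { intros n. simpl s. unfold step.
    exact (proj2_sig (constructive_indefinite_description _ (Hstep n (s n)))). }
  assert (Hbads : forall n, ~ Good (fst (s n)) (snd (s n)) n).
  { induction n; [exact Hbad|]. apply Hs. exact IHn. }
  assert (Hmono : forall n k, fst (s n) <= fst (s (n + k)%nat) /\
    snd (s n) <= snd (s (n + k)%nat) /\
    fst (s (n + k)%nat) + A / 2 ^ (n + k) <= fst (s n) + A / 2 ^ n /\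
    snd (s (n + k)%nat) + B / 2 ^ (n + k) <= snd (s n) + B / 2 ^ n).
  { intros n k. induction k.
    - rewrite Nat.add_0_r. lra.
    - rewrite Nat.add_succ_r. destruct (Hs (n + k)%nat) as [_ K].
      rewrite (half_pow_split A (n + k)), (half_pow_split B (n + k)) in IHk. lra. }
  assert (Hcross : forall n m, fst (s n) <= fst (s m) + A / 2 ^ m /\
                               snd (s n) <= snd (s m) + B / 2 ^ m).
  { intros n m. pose proof (half_pow_pos A (n + m) HA). pose proof (half_pow_pos B (n + m) HB).
    pose proof (Hmono n m) as K1. pose proof (Hmono m n) as K2.
    rewrite (Nat.add_comm m n) in K2. lra. }
  (* The suprema of the coordinates of the lower left corners give a point common to all the
     rectangles, where the local hypothesis contradicts badness. *)
  destruct (completeness (fun x => exists n, x = fst (s n))) as [p [Hp1 Hp2]].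
  { exists (a + A). intros x [n ->]. destruct (Hcross n 0%nat) as [K _]. simpl in K. lra. }
  { exists a. exists 0%nat. reflexivity. }
  destruct (completeness (fun x => exists n, x = snd (s n))) as [q [Hq1 Hq2]].
  { exists (b + B). intros x [n ->]. destruct (Hcross n 0%nat) as [_ K]. simpl in K. lra. }
  { exists b. exists 0%nat. reflexivity. }
  assert (Hp : forall n, fst (s n) <= p <= fst (s n) + A / 2 ^ n).
  { intros n. split; [apply Hp1; eauto|]. apply Hp2. intros x [m ->]. apply Hcross. }
  assert (Hq : forall n, snd (s n) <= q <= snd (s n) + B / 2 ^ n).
  { intros n. split; [apply Hq1; eauto|]. apply Hq2. intros x [m ->]. apply Hcross. }
  destruct (Hloc p q) as [N HN].
  { specialize (Hp 0%nat). simpl in Hp. lra. }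
  { specialize (Hq 0%nat). simpl in Hq. lra. }
  apply (Hbads N). apply HN; auto.
Qed.

(* [P] and [Q] are the real and imaginary parts of a holomorphic function, up to
   the second Cauchy-Riemann equation, which is not used. *)
Definition half_cauchy_riemann (P Q : R -> R -> R) (p q : R) : Prop :=
  exists al be ga, forall e, 0 < e -> exists d, 0 < d /\
    forall x y, Rabs (x - p) < d -> Rabs (y - q) < d ->
      Rabs (P x y - P p q - al * (x - p) - ga * (y - q))
        <= e * (Rabs (x - p) + Rabs (y - q)) /\
      Rabs (Q x y - Q p q - be * (x - p) - al * (y - q))
        <= e * (Rabs (x - p) + Rabs (y - q)).

Lemma affine_approx_continuous (f : R -> R) (p al : R) :
  (forall e, 0 < e -> exists d, 0 < d /\ forall x, Rabs (x - p) < d ->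
     Rabs (f x - f p - al * (x - p)) <= e * Rabs (x - p)) ->
  continuous f p.
Proof.
  intros H. apply (ex_derive_continuous (V := R_NormedModule)).
  exists al. split; [apply is_linear_scal_l|].
  intros x Hx.
  assert (x = p) as ->
    by (symmetry; exact (@is_filter_lim_locally_unique R_AbsRing R_NormedModule p x Hx)).
  intros e. destruct (H e (cond_pos e)) as [d [Hd K]].
  exists (mkposreal d Hd). intros y Hy. specialize (K y Hy).
  unfold norm, minus, plus, opp, scal; simpl. unfold abs, mult; simpl.
  replace (f y + - f p + - ((y + - p) * al)) with (f y - f p - al * (y - p)) by ring.
  exact K.
Qed.

Lemma half_cauchy_riemann_continuous (P Q : R -> R -> R) (p q : R) :
  half_cauchy_riemann P Q p q ->
  continuous (fun y => P p y) q /\ continuous (fun x => Q x q) p.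
Proof.
  intros (al & be & ga & H). split.
  - apply affine_approx_continuous with ga. intros e He.
    destruct (H e He) as [d [Hd K]]. exists d. split; auto. intros y Hy.
    destruct (K p y) as [K1 _]; auto.
    + rewrite Rminus_diag, Rabs_R0. exact Hd.
    + rewrite Rminus_diag, Rabs_R0, Rmult_0_r, Rplus_0_l, Rminus_0_r in K1. exact K1.
  - apply affine_approx_continuous with be. intros e He.
    destruct (H e He) as [d [Hd K]]. exists d. split; auto. intros x Hx.
    destruct (K x q) as [_ K1]; auto.
    + rewrite Rminus_diag, Rabs_R0. exact Hd.
    + rewrite (Rminus_diag q), Rabs_R0, Rmult_0_r, Rplus_0_r, Rminus_0_r in K1. exact K1.
Qed.

(** [k] is the difference between two parallel sides predicted by an affine approximation; it
    integrates to [k * (b - a)] and only the error [M] is left. *)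
Lemma RInt_diff_bound (f g : R -> R) (a b k M : R) :
  a <= b -> ex_RInt f a b -> ex_RInt g a b ->
  (forall t, a <= t <= b -> Rabs (f t - g t - k) <= M) ->
  Rabs (RInt f a b - RInt g a b - k * (b - a)) <= (b - a) * M.
Proof.
  intros Hab Hf Hg H.
  assert (Hfg : ex_RInt (fun t => f t - g t) a b)
    by exact (ex_RInt_minus (V := R_NormedModule) f g a b Hf Hg).
  assert (Hk : ex_RInt (fun _ : R => k) a b)
    by exact (ex_RInt_const (V := R_NormedModule) a b k).
  replace (RInt f a b - RInt g a b - k * (b - a))
    with (RInt (fun t => f t - g t - k) a b).
  - apply abs_RInt_le_const; auto.
    exact (ex_RInt_minus (V := R_NormedModule) _ _ a b Hfg Hk).
  - etransitivity; [exact (RInt_minus (V := R_CompleteNormedModule) _ _ a b Hfg Hk)|].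
    rewrite (RInt_const (V := R_CompleteNormedModule) a b k).
    rewrite (RInt_minus (V := R_CompleteNormedModule) f g a b Hf Hg
      : RInt (fun t => f t - g t) a b = _).
    unfold minus, plus, opp, scal; simpl. unfold mult; simpl. ring.
Qed.

(** Formally this is Green's formula with [P_x = Q_y], the shared coefficient [al]. The defect [J]
    of the identity is additive under subdivision, and near each point it is small compared with the
    area. *)
Lemma goursat_rectangle (P Q : R -> R -> R) (a b A B : R) :
  0 < A -> 0 < B ->
  (forall x y, a <= x <= a + A -> b <= y <= b + B -> half_cauchy_riemann P Q x y) ->
  RInt (P (a + A)) b (b + B) - RInt (P a) b (b + B) =
  RInt (fun x => Q x (b + B)) a (a + A) - RInt (fun x => Q x b) a (a + A).
Proof.
  intros HA HB H.
  assert (EP : forall x y1 y2, a <= x <= a + A -> b <= y1 -> y1 <= y2 -> y2 <= b + B ->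
    ex_RInt (P x) y1 y2).
  { intros x y1 y2 Hx H1 H2 H3. apply (ex_RInt_continuous (V := R_CompleteNormedModule)).
    intros y Hy. rewrite Rmin_left, Rmax_right in Hy by lra.
    apply (half_cauchy_riemann_continuous P Q x y). apply H; lra. }
  assert (EQ : forall y x1 x2, b <= y <= b + B -> a <= x1 -> x1 <= x2 -> x2 <= a + A ->
    ex_RInt (fun x => Q x y) x1 x2).
  { intros y x1 x2 Hy H1 H2 H3. apply (ex_RInt_continuous (V := R_CompleteNormedModule)).
    intros x Hx. rewrite Rmin_left, Rmax_right in Hx by lra.
    apply (half_cauchy_riemann_continuous P Q x y). apply H; lra. }
  set (J := fun x1 x2 y1 y2 => RInt (P x2) y1 y2 - RInt (P x1) y1 y2
     - (RInt (fun x => Q x y2) x1 x2 - RInt (fun x => Q x y1) x1 x2)).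
  enough (K : forall e, 0 < e -> Rabs (J a (a + A) b (b + B)) <= e * (A * B)).
  { assert (K0 : J a (a + A) b (b + B) = 0).
    { apply NNPP. intros N. apply Rabs_pos_lt in N.
      assert (0 < A * B) by nra.
      specialize (K (Rabs (J a (a + A) b (b + B)) / (2 * (A * B)))).
      rewrite <- (Rmult_1_r (Rabs (J a (a + A) b (b + B)))) in K at 2.
      assert (0 < Rabs (J a (a + A) b (b + B)) / (2 * (A * B)))
        by (apply Rdiv_lt_0_compat; lra).
      specialize (K H1).
      replace (Rabs (J a (a + A) b (b + B)) / (2 * (A * B)) * (A * B))
        with (Rabs (J a (a + A) b (b + B)) / 2) in K by (field; split; lra).
      lra. }
    unfold J in K0. lra. }
  intros e He.
  set (Good := fun x y n => a <= x -> x + A / 2 ^ n <= a + A -> b <= y ->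
    y + B / 2 ^ n <= b + B ->
    Rabs (J x (x + A / 2 ^ n) y (y + B / 2 ^ n)) <= e * (A / 2 ^ n * (B / 2 ^ n))).
  assert (G : Good a b 0%nat).
  2: { unfold Good in G. simpl in G. rewrite !Rdiv_1_r in G. apply G; lra. }
  apply (quadrisection Good A B); auto.
  - intros x y n G1 G2 G3 G4. unfold Good in *. intros Hx1 Hx2 Hy1 Hy2.
    rewrite (half_pow_split A n) in *. rewrite (half_pow_split B n) in *.
    pose proof (half_pow_pos A (S n) HA) as PA. pose proof (half_pow_pos B (S n) HB) as PB.
    set (w := A / 2 ^ S n) in *. set (k := B / 2 ^ S n) in *. clearbody w k.
    rewrite !(Rplus_assoc _ w w), !(Rplus_assoc _ k k) in *.
    specialize (G1 ltac:(lra) ltac:(lra) ltac:(lra) ltac:(lra)).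
    specialize (G2 ltac:(lra) ltac:(lra) ltac:(lra) ltac:(lra)).
    specialize (G3 ltac:(lra) ltac:(lra) ltac:(lra) ltac:(lra)).
    specialize (G4 ltac:(lra) ltac:(lra) ltac:(lra) ltac:(lra)).
    replace (J x (x + (w + w)) y (y + (k + k))) with
      ((J x (x + w) y (y + k) + J (x + w) (x + (w + w)) y (y + k)) +
       (J x (x + w) (y + k) (y + (k + k)) +
        J (x + w) (x + (w + w)) (y + k) (y + (k + k)))).
    + eapply Rle_trans; [apply Rabs_triang|].
      eapply Rle_trans; [apply Rplus_le_compat; apply Rabs_triang|].
      replace (e * ((w + w) * (k + k)))
        with ((e * (w * k) + e * (w * k)) + (e * (w * k) + e * (w * k))) by ring.
      lra.
    + unfold J.
      assert (CP : forall x', a <= x' <= a + A ->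
        RInt (P x') y (y + (k + k)) = RInt (P x') y (y + k) + RInt (P x') (y + k) (y + (k + k))).
      { intros x' Hx'. symmetry.
        apply (RInt_Chasles (V := R_CompleteNormedModule) (P x')); apply EP; lra. }
      assert (CQ : forall y', b <= y' <= b + B ->
        RInt (fun x => Q x y') x (x + (w + w)) =
        RInt (fun x => Q x y') x (x + w) + RInt (fun x => Q x y') (x + w) (x + (w + w))).
      { intros y' Hy'. symmetry.
        apply (RInt_Chasles (V := R_CompleteNormedModule) (fun x => Q x y'));
          apply EQ; lra. }
      rewrite (CP x), (CP (x + (w + w))), (CQ y), (CQ (y + (k + k))) by lra.
      ring.
  - intros p q Hp Hq. destruct (H p q Hp Hq) as (al & be & ga & Hd).
    (* The subrectangles keep the proportions of the original one, so this [c] satisfies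
       [4 c (w + k)^2 = e w k] at every dyadic level. *)
    set (c := e * (A * B) / (4 * ((A + B) * (A + B)))).
    assert (Hc : 0 < c).
    { unfold c. apply Rdiv_lt_0_compat; [apply Rmult_lt_0_compat; nra|nra]. }
    destruct (Hd c Hc) as [d [Pd Hd']].
    destruct (half_pow_small A d HA Pd) as [N1 HN1].
    destruct (half_pow_small B d HB Pd) as [N2 HN2].
    exists (Nat.max N1 N2). intros n x y Hn Hx Hy. unfold Good. intros Hx1 Hx2 Hy1 Hy2.
    specialize (HN1 n ltac:(lia)). specialize (HN2 n ltac:(lia)).
    assert (H2 : 0 < 2 ^ n) by (apply pow_lt; lra).
    pose proof (half_pow_pos A n HA) as PA. pose proof (half_pow_pos B n HB) as PB.
    assert (Ec : 4 * c * ((A / 2 ^ n + B / 2 ^ n) * (A / 2 ^ n + B / 2 ^ n)) =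
                 e * (A / 2 ^ n * (B / 2 ^ n))).
    { unfold c. field. split; nra. }
    set (w := A / 2 ^ n) in *. set (k := B / 2 ^ n) in *. clearbody w k c.
    assert (Hxb : forall x', x <= x' <= x + w -> Rabs (x' - p) <= w)
      by (intros x' Hx'; apply Rabs_le; lra).
    assert (Hyb : forall y', y <= y' <= y + k -> Rabs (y' - q) <= k)
      by (intros y' Hy'; apply Rabs_le; lra).
    assert (HPQ : forall x' y', x <= x' <= x + w -> y <= y' <= y + k ->
      Rabs (P x' y' - P p q - al * (x' - p) - ga * (y' - q)) <= c * (w + k) /\
      Rabs (Q x' y' - Q p q - be * (x' - p) - al * (y' - q)) <= c * (w + k)).
    { intros x' y' Hx' Hy'. specialize (Hxb x' Hx'). specialize (Hyb y' Hy').
      destruct (Hd' x' y') as [K1 K2]; [lra|lra|].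
      assert (c * (Rabs (x' - p) + Rabs (y' - q)) <= c * (w + k))
        by (apply Rmult_le_compat_l; lra).
      lra. }
    (* Up to the error, both differences of integrals equal [al * w * k], so this term cancels in
       [J]. *)
    assert (T1 : Rabs (RInt (P (x + w)) y (y + k) - RInt (P x) y (y + k) -
      (al * w) * ((y + k) - y)) <= ((y + k) - y) * (2 * (c * (w + k)))).
    { apply RInt_diff_bound; [lra|apply EP; lra|apply EP; lra|].
      intros y' Hy'.
      destruct (HPQ (x + w) y') as [K1 _]; [lra|lra|].
      destruct (HPQ x y') as [K2 _]; [lra|lra|].
      apply Rabs_le. apply Rabs_le_between in K1. apply Rabs_le_between in K2. lra. }
    assert (T2 : Rabs (RInt (fun x => Q x (y + k)) x (x + w) - RInt (fun x => Q x y) x (x + w) -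
      (al * k) * ((x + w) - x)) <= ((x + w) - x) * (2 * (c * (w + k)))).
    { apply (RInt_diff_bound (fun x => Q x (y + k)) (fun x => Q x y));
        [lra|apply EQ; lra|apply EQ; lra|].
      intros x' Hx'.
      destruct (HPQ x' (y + k)) as [_ K1]; [lra|lra|].
      destruct (HPQ x' y) as [_ K2]; [lra|lra|].
      apply Rabs_le. apply Rabs_le_between in K1. apply Rabs_le_between in K2. lra. }
    apply Rabs_le_between in T1. apply Rabs_le_between in T2.
    unfold J. rewrite <- Ec. apply Rabs_le.
    replace (y + k - y) with k in * by ring. replace (x + w - x) with w in * by ring.
    assert (0 <= c * ((w + k) * (w + k)))
      by (apply Rmult_le_pos; [lra|apply Rle_0_sqr]).
    assert (k * (2 * (c * (w + k))) + w * (2 * (c * (w + k))) = 2 * (c * ((w + k) * (w + k))))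
      by ring.
    split; nra.
Qed.

Definition holomorphic_H (F : C -> C) : Prop :=
  forall z, upper_half_plane z -> exists l, cderiv_in everywhere F z l.

Lemma Im_circle_pos (z0 w : C) : exp (Re w) < Im z0 -> upper_half_plane (z0 + cexp w).
Proof.
  intros H. unfold upper_half_plane.
  replace (Im (z0 + cexp w)) with (Im z0 + exp (Re w) * sin (Im w)) by reflexivity.
  pose proof (SIN_bound (Im w)). pose proof (exp_pos (Re w)). nra.
Qed.

Lemma cderiv_circle (F : C -> C) (z0 w : C) :
  holomorphic_H F -> exp (Re w) < Im z0 ->
  exists l, cderiv_in everywhere (fun w => F (z0 + cexp w)%C) w l.
Proof.
  intros HF H. destruct (HF _ (Im_circle_pos z0 w H)) as [l Hl].
  exists (l * (0 + cexp w))%C.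
  apply (cderiv_in_comp everywhere everywhere F (fun w => z0 + cexp w)%C); auto.
  apply cderiv_in_plus; [apply cderiv_in_const|apply cderiv_cexp].
Qed.

(** If [l] is the derivative of the composite, the imaginary part has partial derivatives [Im l],
    [Re l], and minus the real part has [- Re l], [Im l]; the common entry is [Im l]. *)
Lemma circle_half_cauchy_riemann (F : C -> C) (z0 : C) (x y : R) :
  holomorphic_H F -> exp x < Im z0 ->
  half_cauchy_riemann (fun x y => Im (F (z0 + cexp (x, y))%C))
    (fun x y => - Re (F (z0 + cexp (x, y))%C)) x y.
Proof.
  intros HF H. destruct (cderiv_circle F z0 (x, y) HF H) as [l Hl].
  exists (Im l), (- Re l), (Re l). intros e He.
  rewrite cderiv_in_eps in Hl. destruct (Hl e He) as [d [Hd K]].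
  exists (d / 2). split; [lra|]. intros x' y' Hx Hy.
  assert (E : Cmod ((x', y') - (x, y)) <= Rabs (x' - x) + Rabs (y' - y)).
  { eapply Rle_trans; [apply Cmod_le_Re_Im|]. unfold Re, Im; simpl. apply Rle_refl. }
  specialize (K (x', y') I ltac:(lra)).
  pose proof (re_le_Cmod (F (z0 + cexp (x', y'))%C - F (z0 + cexp (x, y))%C
    - l * ((x', y') - (x, y)))) as R1.
  pose proof (im_le_Cmod (F (z0 + cexp (x', y'))%C - F (z0 + cexp (x, y))%C
    - l * ((x', y') - (x, y)))) as R2.
  assert (e * Cmod ((x', y') - (x, y)) <= e * (Rabs (x' - x) + Rabs (y' - y)))
    by (apply Rmult_le_compat_l; lra).
  destruct (F (z0 + cexp (x', y'))%C) as [a b], (F (z0 + cexp (x, y))%C) as [a' b'],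
    l as [l1 l2].
  unfold Re, Im in *; simpl in *. split.
  - eapply Rle_trans; [|apply (Rle_trans _ _ _ R2); lra]. right. f_equal. ring.
  - eapply Rle_trans; [|apply (Rle_trans _ _ _ R1); lra]. right.
    rewrite <- Rabs_Ropp. f_equal. ring.
Qed.

(* In the logarithmic coordinate w, where z = z0 + exp w, the mean over a circle
   is an integral over a vertical segment, and the horizontal sides of Goursat's
   rectangle cancel by periodicity. *)
Lemma mean_value_Im (F : C -> C) (z0 : C) (x : R) :
  holomorphic_H F -> exp x < Im z0 ->
  RInt (fun y => Im (F (z0 + cexp (x, y))%C)) 0 (2 * PI) = 2 * PI * Im (F z0).
Proof.
  intros HF H.
  pose proof PI_RGT_0 as Hpi.
  set (P := fun x y => Im (F (z0 + cexp (x, y))%C)).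
  set (Q := fun x y => - Re (F (z0 + cexp (x, y))%C)).
  assert (Hcont : forall x' y, x' <= x -> continuous (P x') y).
  { intros x' y Hx'. apply (half_cauchy_riemann_continuous P Q).
    apply circle_half_cauchy_riemann; auto.
    eapply Rle_lt_trans; [|exact H]. destruct Hx'; [left; apply exp_increasing; auto|subst; lra]. }
  assert (Hex : forall x', x' <= x -> ex_RInt (P x') 0 (2 * PI)).
  { intros x' Hx'. apply (ex_RInt_continuous (V := R_CompleteNormedModule)). auto. }
  assert (Hconst : forall x', x' < x -> RInt (P x') 0 (2 * PI) = RInt (P x) 0 (2 * PI)).
  { intros x' Hx'.
    pose proof (goursat_rectangle P Q x' 0 (x - x') (2 * PI)) as G.
    rewrite Rplus_0_l in G. replace (x' + (x - x')) with x in G by ring.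
    assert (E : RInt (fun x0 => Q x0 (2 * PI)) x' x = RInt (fun x0 => Q x0 0) x' x).
    { apply RInt_ext. intros t _. unfold Q. do 4 f_equal. unfold cexp, Re, Im; simpl.
      rewrite cos_2PI, sin_2PI, cos_0, sin_0. reflexivity. }
    rewrite E in G. cut (RInt (P x) 0 (2 * PI) - RInt (P x') 0 (2 * PI) = 0); [lra|].
    rewrite G; try lra. intros t y Ht Hy. apply circle_half_cauchy_riemann; auto.
    eapply Rle_lt_trans; [|exact H]. destruct (proj2 Ht); [left; apply exp_increasing; auto|subst; lra]. }
  fold (P x).
  apply NNPP. intros N.
  set (D := Rabs (RInt (P x) 0 (2 * PI) - 2 * PI * Im (F z0))).
  assert (HD : 0 < D) by (apply Rabs_pos_lt; lra).
  destruct (HF z0) as [l Hl].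
  { unfold upper_half_plane. pose proof (exp_pos x). lra. }
  apply cderiv_in_continuous in Hl.
  (* On a circle so small that [Im F] stays within [D / (4 pi)] of its central value, the integral
     is off by at most [D / 2]. It does not depend on the radius, which contradicts the defect
     [D]. *)
  destruct (Hl (D / (4 * PI))) as [d [Hd K]]; [apply Rdiv_lt_0_compat; lra|].
  set (x' := Rmin (x - 1) (ln (d / 2))).
  assert (Hx' : x' < x) by (pose proof (Rmin_l (x - 1) (ln (d / 2))); unfold x'; lra).
  assert (Hexp : exp x' < d).
  { apply Rle_lt_trans with (d / 2); [|lra].
    rewrite <- (exp_ln (d / 2)) by lra.
    destruct (Rmin_r (x - 1) (ln (d / 2))) as [L|L]; [left; apply exp_increasing; exact L|].
    fold x' in L. rewrite L. lra. }
  assert (B : Rabs (RInt (P x') 0 (2 * PI) - RInt (fun _ => Im (F z0)) 0 (2 * PI)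
    - 0 * (2 * PI - 0)) <= (2 * PI - 0) * (D / (4 * PI))).
  { apply RInt_diff_bound; [lra|apply Hex; lra|apply ex_RInt_const|].
    intros t _. specialize (K (z0 + cexp (x', t))%C I).
    replace (z0 + cexp (x', t) - z0)%C with (cexp (x', t)) in K by ring.
    rewrite Cmod_cexp in K. specialize (K Hexp).
    pose proof (im_le_Cmod (F (z0 + cexp (x', t))%C - F z0)) as L.
    unfold P. destruct (F (z0 + cexp (x', t))%C), (F z0). unfold Im in *; simpl in *.
    rewrite Rminus_0_r. unfold Rminus. lra. }
  rewrite RInt_const, Hconst in B by auto.
  unfold scal in B; simpl in B. unfold mult in B; simpl in B.
  replace ((2 * PI - 0) * (D / (4 * PI))) with (D / 2) in B by (field; lra).
  rewrite Rmult_0_l, !Rminus_0_r in B. fold D in B. lra.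
Qed.

Lemma RInt_pos_of_point (f : R -> R) (a b c : R) :
  a < c < b -> (forall x, a <= x <= b -> continuous f x) ->
  (forall x, a <= x <= b -> 0 <= f x) -> 0 < f c -> 0 < RInt f a b.
Proof.
  intros Hc Hf Hpos Hfc.
  assert (Hfc2 : 0 < f c / 2) by lra.
  destruct (Hf c ltac:(lra) _ (locally_ball _ (mkposreal _ Hfc2))) as [d0 K].
  assert (Hd0 := cond_pos d0).
  destruct (pos_min3 (d0 / 2) (c - a) (b - c)) as (d & Hd & Hd1 & Hd2 & Hd3); [lra..|].
  assert (Ex : forall u v, a <= u -> u <= v -> v <= b -> ex_RInt f u v).
  { intros u v Hu Huv Hv. apply (ex_RInt_continuous (V := R_CompleteNormedModule)).
    intros x Hx. rewrite Rmin_left, Rmax_right in Hx by lra. apply Hf; lra. }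
  rewrite <- (RInt_Chasles (V := R_CompleteNormedModule) f a (c - d) b) by (apply Ex; lra).
  rewrite <- (RInt_Chasles (V := R_CompleteNormedModule) f (c - d) (c + d) b) by (apply Ex; lra).
  unfold plus; simpl.
  assert (0 <= RInt f a (c - d))
    by (apply RInt_ge_0; [lra|apply Ex; lra|intros; apply Hpos; lra]).
  assert (0 <= RInt f (c + d) b)
    by (apply RInt_ge_0; [lra|apply Ex; lra|intros; apply Hpos; lra]).
  assert (0 < RInt f (c - d) (c + d)).
  { apply RInt_gt_0; [lra| |intros; apply Hf; lra].
    intros x Hx. specialize (K x).
    assert (Bx : ball c d0 x) by (rewrite ball_R; apply Rabs_def1; lra).
    specialize (K Bx). rewrite ball_R in K. apply Rabs_def2 in K. cbn [pos] in K. lra. }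
  lra.
Qed.

(** Without a maximum every point is beaten by some point [m] of the rectangle, and by upper
    semicontinuity so is a neighbourhood. [Good] asks for a single [m] beating a whole subrectangle;
    this survives gluing four pieces, and for the full rectangle it gives [u m < u m]. *)
Lemma attains_max_rectangle (u : C -> R) (a b A B : R) :
  0 < A -> 0 < B ->
  (forall z, a <= Re z <= a + A -> b <= Im z <= b + B ->
     forall e, 0 < e -> exists d, 0 < d /\ forall w, Cmod (w - z) < d -> u w < u z + e) ->
  exists z0, (a <= Re z0 <= a + A /\ b <= Im z0 <= b + B) /\
    forall z, a <= Re z <= a + A -> b <= Im z <= b + B -> u z <= u z0.
Proof.
  intros HA HB Hc. apply NNPP. intros N.
  set (K := fun z : C => a <= Re z <= a + A /\ b <= Im z <= b + B).
  assert (Hup : forall z, K z -> exists z', K z' /\ u z < u z').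
  { intros z Hz. apply NNPP. intros N'. apply N. exists z. split; [exact Hz|].
    intros z' H1 H2. apply Rnot_lt_le. intros L. apply N'. exists z'. split; [split|]; auto. }
  set (Good := fun x y (n : nat) => exists m, K m /\ forall z,
    x <= Re z <= x + A / 2 ^ n -> y <= Im z <= y + B / 2 ^ n -> u z < u m).
  assert (G : Good a b 0%nat).
  2: { destruct G as [m [Km Hm]]. simpl in Hm. rewrite !Rdiv_1_r in Hm.
       destruct Km as [K1 K2]. specialize (Hm m K1 K2). lra. }
  apply (quadrisection Good A B); auto.
  - intros x y n [m1 [K1 H1]] [m2 [K2 H2]] [m3 [K3 H3]] [m4 [K4 H4]].
    assert (Hmax : forall m m', K m -> K m' -> exists m'', K m'' /\ u m <= u m'' /\ u m' <= u m'').
    { intros m m' Km Km'. destruct (Rle_dec (u m) (u m')); [exists m'|exists m]; repeat split; try apply Km; try apply Km'; lra. }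
    destruct (Hmax m1 m2 K1 K2) as [p [Kp Hp]].
    destruct (Hmax m3 m4 K3 K4) as [q [Kq Hq]].
    destruct (Hmax p q Kp Kq) as [m [Km Hm]].
    exists m. split; auto. intros z Hx Hy.
    rewrite half_pow_split in Hx, Hy.
    destruct (Rle_dec (Re z) (x + A / 2 ^ S n)); destruct (Rle_dec (Im z) (y + B / 2 ^ S n)).
    + specialize (H1 z ltac:(lra) ltac:(lra)). lra.
    + specialize (H3 z ltac:(lra) ltac:(lra)). lra.
    + specialize (H2 z ltac:(lra) ltac:(lra)). lra.
    + specialize (H4 z ltac:(lra) ltac:(lra)). lra.
  - intros p q Hp Hq.
    assert (Kpq : K (p, q)) by (split; assumption).
    destruct (Hup _ Kpq) as [m [Km Hm]].
    destruct (Hc (p, q) Hp Hq (u m - u (p, q))) as [d [Hd Hd']]; [lra|].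
    destruct (half_pow_small A (d / 2) HA) as [N1 HN1]; [lra|].
    destruct (half_pow_small B (d / 2) HB) as [N2 HN2]; [lra|].
    exists (Nat.max N1 N2). intros n x y Hn Hx Hy. exists m. split; auto.
    specialize (HN1 n ltac:(lia)). specialize (HN2 n ltac:(lia)).
    intros z Hzx Hzy.
    assert (L : Cmod (z - (p, q)) < d).
    { eapply Rle_lt_trans; [apply Cmod_le_Re_Im|].
      destruct z as [z1 z2]. unfold Re, Im in *; simpl in *.
      assert (Rabs (z1 + - p) <= A / 2 ^ n) by (apply Rabs_le; lra).
      assert (Rabs (z2 + - q) <= B / 2 ^ n) by (apply Rabs_le; lra).
      lra. }
    specialize (Hd' z L). lra.
Qed.

(** The hypothesis confines large values to a rectangle, so a positive value would make [Im F]
    attain a positive maximum at some [z0]. The mean over a circle around [z0] that dips into the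
    strip [Im z < d] is then strictly below this maximum. *)
Lemma max_principle_H (F : C -> C) :
  holomorphic_H F ->
  (forall e, 0 < e -> exists d M, 0 < d /\ forall z, upper_half_plane z ->
     Im z < d \/ M < Cmod z -> Im (F z) < e) ->
  forall z, upper_half_plane z -> Im (F z) <= 0.
Proof.
  intros HF Hb z1 Hz1. apply Rnot_lt_le. intros N.
  destruct (Hb (Im (F z1) / 2)) as [d [M [Hd HM]]]; [lra|].
  set (R0 := Rmax M (Cmod z1) + d + 1).
  assert (HR1 : M < R0) by (unfold R0; generalize (Rmax_l M (Cmod z1)); lra).
  assert (HR2 : Cmod z1 < R0) by (unfold R0; generalize (Rmax_r M (Cmod z1)); lra).
  assert (HR3 : 0 <= Cmod z1) by apply Cmod_ge_0.
  assert (HR4 : d < R0).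
  { unfold R0. generalize (Rmax_r M (Cmod z1)). lra. }
  clearbody R0.
  destruct (attains_max_rectangle (fun z => Im (F z)) (- R0) d (2 * R0) (R0 - d))
    as [z0 [[H0x H0y] Hmax]]; [lra|lra| |].
  { intros z _ Hz e He. destruct (HF z) as [l Hl]; [unfold upper_half_plane; lra|].
    apply cderiv_in_continuous in Hl. destruct (Hl e He) as [d' [Hd' K]].
    exists d'. split; auto. intros w Hw. specialize (K w I Hw).
    pose proof (im_le_Cmod (F w - F z)) as L. apply Rabs_le_between in L.
    destruct (F w), (F z). unfold Im in *; simpl in *. lra. }
  assert (Hglob : forall z, upper_half_plane z -> Im (F z) <= Im (F z0)).
  { assert (H1 : Im (F z1) <= Im (F z0)).
    { assert (~ (Im z1 < d \/ M < Cmod z1)).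
      { intros K. specialize (HM z1 Hz1 K). lra. }
      pose proof (re_le_Cmod z1) as A. pose proof (im_le_Cmod z1) as B.
      apply Rabs_le_between in A. apply Rabs_le_between in B.
      apply Hmax; [lra|]. split; [|lra]. apply Rnot_lt_le. intros K. apply H. auto. }
    intros z Hz. destruct (classic (Im z < d \/ M < Cmod z)) as [K|K].
    - specialize (HM z Hz K). lra.
    - assert (Cmod z <= M) by (apply Rnot_lt_le; tauto).
      assert (d <= Im z) by (apply Rnot_lt_le; tauto).
      pose proof (re_le_Cmod z) as A. pose proof (im_le_Cmod z) as B.
      apply Rabs_le_between in A. apply Rabs_le_between in B.
      apply Hmax; lra. }
  assert (H01 : Im (F z1) <= Im (F z0)) by (apply Hglob; exact Hz1).
  (* With radius [Im z0 - d / 2] the circle stays in the half-plane, and its lowest point, at angle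
     3 pi / 2, has height [d / 2]. *)
  set (x := ln (Im z0 - d / 2)).
  assert (Hx : exp x = Im z0 - d / 2) by (unfold x; apply exp_ln; lra).
  assert (Hlt : exp x < Im z0) by lra.
  pose proof (mean_value_Im F z0 x HF Hlt) as MV.
  pose proof PI_RGT_0 as Hpi.
  assert (Hcont : forall y, continuous (fun y => Im (F (z0 + cexp (x, y))%C)) y).
  { intros y. apply (half_cauchy_riemann_continuous
      (fun x y => Im (F (z0 + cexp (x, y))%C)) (fun x y => - Re (F (z0 + cexp (x, y))%C))).
    apply circle_half_cauchy_riemann; auto. }
  assert (Hpos : 0 < RInt (fun y => Im (F z0) - Im (F (z0 + cexp (x, y))%C)) 0 (2 * PI)).
  { apply RInt_pos_of_point with (3 * (PI / 2)).
    - lra.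
    - intros y _. apply (continuous_minus (V := R_NormedModule)); [apply continuous_const|apply Hcont].
    - intros y _.
      assert (Im (F (z0 + cexp (x, y))%C) <= Im (F z0)); [|lra].
      apply Hglob. apply Im_circle_pos. exact Hlt.
    - assert (Im (F (z0 + cexp (x, (3 * (PI / 2))%R))%C) < Im (F z1) / 2); [|lra].
      apply HM; [apply Im_circle_pos; exact Hlt|]. left.
      replace (Im (z0 + cexp (x, (3 * (PI / 2))%R))) with (Im z0 + exp x * sin (3 * (PI / 2)))
        by reflexivity.
      rewrite sin_3PI2, Hx. lra. }
  assert (E : RInt (fun y => Im (F z0) - Im (F (z0 + cexp (x, y))%C)) 0 (2 * PI) =
    RInt (fun _ => Im (F z0)) 0 (2 * PI) -
    RInt (fun y => Im (F (z0 + cexp (x, y))%C)) 0 (2 * PI)).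
  { apply (RInt_minus (V := R_CompleteNormedModule) (fun _ => Im (F z0))
      (fun y => Im (F (z0 + cexp (x, y))%C))).
    - apply ex_RInt_const.
    - apply (ex_RInt_continuous (V := R_CompleteNormedModule)). intros; apply Hcont. }
  rewrite E, MV, RInt_const in Hpos.
  unfold scal in Hpos; simpl in Hpos. unfold mult in Hpos; simpl in Hpos. lra.
Qed.

(** * Rigidity of normalized self-maps of the upper half-plane *)

Definition normalized_at_infinity (F : C -> C) : Prop :=
  forall e, 0 < e -> exists M, forall z, upper_half_plane z -> M < Cmod z -> Cmod (F z - z) < e.

(** The maximum principle is applied to [z - F z]. Its imaginary part is below [Im z] because [F]
    stays in the half-plane, which controls it near the real axis; the normalization controls it at
    infinity. *)
Lemma Im_ge_of_self_map (F : C -> C) :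
  holomorphic_H F -> (forall z, upper_half_plane z -> upper_half_plane (F z)) ->
  normalized_at_infinity F ->
  forall z, upper_half_plane z -> Im z <= Im (F z).
Proof.
  intros HF Hself Hinf z Hz.
  cut (Im (z - F z) <= 0).
  { destruct z, (F _); unfold Im; simpl; lra. }
  apply (max_principle_H (fun z => (z - F z)%C)); auto.
  - intros w Hw. destruct (HF w Hw) as [l Hl]. exists (1 - l)%C.
    apply cderiv_in_minus; [apply cderiv_in_id|exact Hl].
  - intros e He. destruct (Hinf e He) as [M HM]. exists e, M. split; auto.
    intros w Hw [Hi|Hi].
    + specialize (Hself w Hw). unfold upper_half_plane in *.
      destruct w, (F _); unfold Im in *; simpl in *; lra.
    + specialize (HM w Hw Hi). pose proof (im_le_Cmod (w - F w)) as L.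
      rewrite Cmod_sub_sym in L. apply Rabs_le_between in L. lra.
Qed.

(** The real-valued function [F - id] has zero derivative along horizontal lines, so it is constant
    on each of them, and following the line to infinity identifies the constant as 0. *)
Lemma holomorphic_real_diff_const (F : C -> C) :
  holomorphic_H F -> (forall z, upper_half_plane z -> Im (F z) = Im z) ->
  normalized_at_infinity F -> forall z, upper_half_plane z -> F z = z.
Proof.
  intros HF HIm Hinf z0 Hz0.
  set (G := fun z => (F z - z)%C).
  assert (HG : forall z, upper_half_plane z -> Im (G z) = 0).
  { intros z Hz. specialize (HIm z Hz). unfold G. destruct (F z), z.
    unfold Im in *; simpl in *; lra. }
  assert (Hd : forall x : R, is_derive (fun s => Re (G (z0 + RtoC s)%C)) x 0).
  { intros x.
    assert (Hz : upper_half_plane (z0 + RtoC x)).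
    { unfold upper_half_plane in *. destruct z0; unfold Im in *; simpl in *; lra. }
    destruct (HF _ Hz) as [l' Hl'].
    assert (Hl : cderiv_in everywhere G (z0 + RtoC x)%C (l' - 1)%C)
      by (apply cderiv_in_minus; [exact Hl'|apply cderiv_in_id]).
    set (l := (l' - 1)%C) in *. clearbody l.
    (* Moving vertically multiplies the increment by Ci, and G stays real. *)
    assert (Rl : Re l = 0).
    { set (H := fun w : C => G (z0 + RtoC x + Ci * w)%C).
      assert (HH : cderiv_in (real_in (fun s => Im z0 + s > 0)) H (RtoC 0) (l * (0 + Ci * 1))%C).
      { apply (cderiv_in_comp _ everywhere G (fun w => z0 + RtoC x + Ci * w)%C).
        - intros; exact I.
        - replace (z0 + RtoC x + Ci * RtoC 0)%C with (z0 + RtoC x)%C by ring. exact Hl.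
        - apply cderiv_in_plus; [apply cderiv_in_const|].
          apply cderiv_in_scal, cderiv_in_id. }
      assert (Hloc : locally 0 (fun s => Im z0 + s > 0)).
      { exists (mkposreal _ Hz0). intros s Hs.
        rewrite ball_R in Hs. apply Rabs_def2 in Hs. cbn [pos] in Hs. lra. }
      destruct (is_derive_Re_Im H 0 _ _ Hloc HH) as [_ K].
      assert (K0 : is_derive (fun s => Im (H (RtoC s))) 0 0).
      { apply (is_derive_ext_loc (fun _ => 0)); [|exact (is_derive_const (K := R_AbsRing) (V := R_NormedModule) 0 0)].
        destruct Hloc as [d Hd]. exists d. intros s Hs. specialize (Hd s Hs).
        symmetry. apply HG. unfold upper_half_plane.
        destruct z0; unfold Im in *; simpl in *. lra. }
      pose proof (is_derive_unique _ _ _ K) as E1.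
      pose proof (is_derive_unique _ _ _ K0) as E2.
      rewrite E1 in E2. destruct l; unfold Re, Im in *; simpl in *. lra. }
    assert (HH : cderiv_in (real_in (fun _ => True)) (fun w => G (z0 + w)%C) (RtoC x) (l * (0 + 1))%C).
    { apply (cderiv_in_comp _ everywhere G (fun w => z0 + w)%C); auto.
      - intros; exact I.
      - apply cderiv_in_plus; [apply cderiv_in_const|apply cderiv_in_id]. }
    destruct (is_derive_Re_Im _ x _ _ (filter_forall _ (fun _ => I)) HH) as [K _].
    replace 0 with (Re (l * (0 + 1))); [exact K|].
    destruct l; unfold Re in *; simpl in *; lra. }
  assert (Hconst : forall x, Re (G (z0 + RtoC x)%C) = Re (G (z0 + RtoC 0)%C)).
  { intros x. destruct (MVT_gen (fun s => Re (G (z0 + RtoC s)%C)) 0 x (fun _ => 0)) as [c' [_ Hc']].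
    - intros; apply Hd.
    - intros t _. apply continuity_pt_filterlim.
      apply (ex_derive_continuous (V := R_NormedModule)). exists 0. apply Hd.
    - cbv beta in Hc'. rewrite Rmult_0_l in Hc'. lra. }
  assert (HG0 : Re (G z0) = 0).
  { apply NNPP. intros N. apply Rabs_pos_lt in N.
    destruct (Hinf _ N) as [M HM].
    set (x := Rabs M + Cmod z0 + 1).
    assert (Hz : upper_half_plane (z0 + RtoC x)).
    { unfold upper_half_plane in *. destruct z0; unfold Im in *; simpl in *; lra. }
    assert (HMx : M < Cmod (z0 + RtoC x)).
    { pose proof (Cmod_sub_ge (RtoC x) (- z0)) as K. rewrite Cmod_opp, Cmod_R in K.
      replace (RtoC x - - z0)%C with (z0 + RtoC x)%C in K by ring.
      rewrite (Rabs_right x) in K.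
      - unfold x in *. pose proof (Rle_abs M). lra.
      - unfold x. pose proof (Rabs_pos M). pose proof (Cmod_ge_0 z0). lra. }
    specialize (HM _ Hz HMx). fold (G (z0 + RtoC x)%C) in HM.
    pose proof (re_le_Cmod (G (z0 + RtoC x)%C)) as L.
    rewrite Hconst in L. replace (z0 + RtoC 0)%C with z0 in L by ring. lra. }
  replace (F z0) with (G z0 + z0)%C by (unfold G; ring).
  specialize (HG z0 Hz0). destruct (G z0) as [a b]. unfold Re, Im in *; simpl in *. subst.
  destruct z0; unfold Cplus; simpl; f_equal; ring.
Qed.

Lemma never_equal_same_side (f : R -> R) (a b m : R) :
  a <= b -> (forall x, a <= x <= b -> continuous f x) ->
  (forall x, a <= x <= b -> f x <> m) -> m < f b -> m < f a.
Proof.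
  intros Hab Hf Hne Hb. apply Rnot_le_lt. intros Ha.
  assert (f a <> m) by (apply Hne; lra).
  assert (a <> b) by (intros ->; lra).
  destruct (Ranalysis5.IVT_interv (fun x => f x - m) a b) as [x [Hx E]]; try lra.
  - intros x Hx. apply continuity_pt_minus; [|apply continuity_pt_const; intros ? ?; reflexivity].
    apply continuity_pt_filterlim. apply Hf. exact Hx.
  - apply (Hne x); [exact Hx|lra].
Qed.

Lemma continuous_Cmod_line (F : C -> C) (w v : C) (s : R) :
  holomorphic_H F -> upper_half_plane (w + RtoC s * v) ->
  continuous (fun s => Cmod (F (w + RtoC s * v)%C)) s.
Proof.
  intros HF Hs. destruct (HF _ Hs) as [l Hl].
  assert (K : cderiv_in everywhere (fun x => F (w + x * v)%C) (RtoC s) (l * (0 + (1 * v + RtoC s * 0)))%C).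
  { apply (cderiv_in_comp _ everywhere F (fun x => w + x * v)%C); auto.
    apply cderiv_in_plus; [apply cderiv_in_const|].
    apply (cderiv_in_mult _ (fun x => x) (fun _ => v));
      [apply cderiv_in_id|apply cderiv_in_const]. }
  apply cderiv_in_continuous in K.
  intros P [e HP]. destruct (K e (cond_pos e)) as [d [Hd Hd']].
  exists (mkposreal d Hd). intros s' Hs'. apply HP.
  rewrite ball_R in *. cbn [pos] in *.
  specialize (Hd' (RtoC s') I). rewrite <- RtoC_minus, Cmod_R in Hd'. specialize (Hd' Hs').
  set (A := F (w + RtoC s' * v)%C) in *. set (B := F (w + RtoC s * v)%C) in *.
  pose proof (Cmod_sub_ge A B). pose proof (Cmod_sub_ge B A) as L. rewrite Cmod_sub_sym in L.
  apply Rabs_def1; lra.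
Qed.

(* The inverse [psi] maps a neighbourhood of infinity to a neighbourhood of
   infinity: along a path staying outside a large disc, [Cmod (psi w)] cannot
   cross the value [R0]. *)
Lemma normalized_inverse (phi psi : C -> C) :
  holomorphic_H psi ->
  (forall w, upper_half_plane w -> upper_half_plane (psi w) /\ phi (psi w) = w) ->
  (forall z, upper_half_plane z -> upper_half_plane (phi z) /\ psi (phi z) = z) ->
  normalized_at_infinity phi -> normalized_at_infinity psi.
Proof.
  intros Hpsi Hw Hz Hinf e He.
  (* Closeness 1 sends the part of the circle [|z| = R0] in the half-plane into the disc of radius
     [R0 + 1], which excludes [|psi w| = R0] for [|w| > R0 + 2]. The bound [e] serves at the end. *)
  destruct (Hinf (Rmin e 1)) as [M HM]; [apply Rmin_glb_lt; lra|].
  set (R0 := Rmax M 0 + 1).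
  assert (HR0 : 0 < R0 /\ M < R0).
  { unfold R0. generalize (Rmax_l M 0) (Rmax_r M 0). lra. }
  clearbody R0. destruct HR0 as [HR0 HMR].
  pose proof (Rmin_l e 1) as Le. pose proof (Rmin_r e 1) as L1.
  assert (Hne : forall w, upper_half_plane w -> R0 + 2 < Cmod w -> Cmod (psi w) <> R0).
  { intros w Hw' Hlt E. destruct (Hw w Hw') as [Hp Ep].
    specialize (HM (psi w) Hp ltac:(lra)). rewrite Ep in HM.
    pose proof (Cmod_sub_ge w (psi w)). lra. }
  set (z1 := (0, R0 + 4) : C).
  assert (Hz1 : upper_half_plane z1) by (unfold upper_half_plane, Im; simpl; lra).
  assert (Mz1 : R0 + 4 <= Cmod z1).
  { pose proof (im_le_Cmod z1) as K. change (Im z1) with (R0 + 4) in K.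
    rewrite Rabs_right in K; lra. }
  destruct (Hz z1 Hz1) as [Hp1 Ep1].
  assert (Im1 : R0 + 2 < Im (phi z1)).
  { specialize (HM z1 Hz1 ltac:(lra)). pose proof (im_le_Cmod (phi z1 - z1)) as K.
    apply Rabs_le_between in K. destruct (phi z1). unfold z1, Im in *; simpl in *. lra. }
  (* The path has two pieces: vertically from [w] to a height above [R0 + 2], then straight to
     [phi z1], whose image under [psi] is [z1], of modulus at least [R0 + 4]. This is the second
     piece. *)
  assert (Hhigh : forall w, R0 + 2 < Im w -> R0 < Cmod (psi w)).
  { intros w Hlt.
    assert (Hs : forall s, 0 <= s <= 1 -> R0 + 2 < Im (w + RtoC s * (phi z1 - w))).
    { intros s Hs. destruct (phi z1) as [p1 p2], w as [w1 w2]. unfold Im in *; simpl in *.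
      replace (w2 + (s * (p2 + - w2) + 0 * (p1 + - w1))) with (w2 + s * (p2 - w2)) by ring.
      destruct (Rle_dec w2 p2); nra. }
    replace w with (w + RtoC 0 * (phi z1 - w))%C by ring.
    apply (never_equal_same_side (fun s => Cmod (psi (w + RtoC s * (phi z1 - w))%C)) 0 1).
    - lra.
    - intros s Hs'. apply continuous_Cmod_line; auto. unfold upper_half_plane.
      specialize (Hs s Hs'). lra.
    - intros s Hs'. specialize (Hs s Hs'). apply Hne; [unfold upper_half_plane; lra|].
      eapply Rlt_le_trans; [exact Hs|]. eapply Rle_trans; [apply Rle_abs|apply im_le_Cmod].
    - replace (w + RtoC 1 * (phi z1 - w))%C with (phi z1) by ring. rewrite Ep1. lra. }
  assert (Hout : forall w, upper_half_plane w -> R0 + 2 < Cmod w -> R0 < Cmod (psi w)).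
  { intros w Hw' Hlt. unfold upper_half_plane in Hw'.
    assert (Hs : forall s, Im (w + RtoC s * Ci) = Im w + s).
    { intros s. destruct w. unfold Im; simpl. ring. }
    replace w with (w + RtoC 0 * Ci)%C by ring.
    apply (never_equal_same_side (fun s => Cmod (psi (w + RtoC s * Ci)%C)) 0 (R0 + 3)).
    - lra.
    - intros s Hs'. apply continuous_Cmod_line; auto. unfold upper_half_plane.
      rewrite Hs. lra.
    - intros s Hs'. apply Hne; [unfold upper_half_plane; rewrite Hs; lra|].
      eapply Rlt_le_trans; [exact Hlt|]. unfold Cmod. apply sqrt_le_1_alt.
      destruct w as [a b]. unfold Im in *; simpl in *. nra.
    - apply Hhigh. rewrite Hs. lra. }
  exists (R0 + 2). intros w Hw' Hlt. destruct (Hw w Hw') as [Hp Ep].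
  specialize (Hout w Hw' Hlt). specialize (HM (psi w) Hp ltac:(lra)).
  rewrite Ep, Cmod_sub_sym in HM. lra.
Qed.

Lemma automorphism_identity (phi psi : C -> C) :
  holomorphic_H phi -> holomorphic_H psi ->
  (forall w, upper_half_plane w -> upper_half_plane (psi w) /\ phi (psi w) = w) ->
  (forall z, upper_half_plane z -> upper_half_plane (phi z) /\ psi (phi z) = z) ->
  normalized_at_infinity phi ->
  forall z, upper_half_plane z -> phi z = z.
Proof.
  intros Hphi Hpsi Hw Hz Hinf.
  pose proof (normalized_inverse phi psi Hpsi Hw Hz Hinf) as Hinf'.
  apply holomorphic_real_diff_const; auto.
  intros z Hz'. destruct (Hz z Hz') as [H1 H2].
  apply Rle_antisym.
  - rewrite <- H2 at 2. apply Im_ge_of_self_map; auto. intros w Hw'. apply Hw; auto.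
  - apply Im_ge_of_self_map; auto. intros w Hw'. apply Hz; auto.
Qed.

(** * The Schwarz-Christoffel map u + log u *)

(* The Schwarz-Christoffel map of the upper half-plane onto the upper half-plane
   slit along the horizontal half-line that ends at -1 + i pi. *)
Definition Omega (u : C) : C := (u + clog u)%C.

Definition slit_model (w : C) : Prop := 0 < Im w /\ ~ (Im w = PI /\ Re w <= -1).

Lemma phi_cos_lt_sin (p : R) : 0 < p < PI -> p * cos p < sin p.
Proof.
  intros H.
  destruct (MVT_cor2 (fun x => sin x - x * cos x) (fun x => x * sin x) 0 p) as [c [E Hc]].
  - lra.
  - intros x _. apply is_derive_Reals. auto_derive; [auto|ring].
  - cbv beta in E. rewrite sin_0, Rmult_0_l, !Rminus_0_r in E.
    assert (0 < sin c) by (apply sin_gt_0; lra).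
    assert (0 < c * sin c * p) by (repeat apply Rmult_lt_0_compat; lra). lra.
Qed.

Lemma Omega_polar (x th : R) :
  0 < th < PI -> Omega (cexp (x, th)) = (exp x * cos th + x, exp x * sin th + th).
Proof.
  intros H. unfold Omega. rewrite clog_cexp by auto. reflexivity.
Qed.

(** Only the line [Im = pi] is delicate. There, with [p = pi - arg u], one has
    [|u| = p / sin p > 1], hence [Re (Omega u) = ln |u| - |u| cos p > - p cos p / sin p > -1]. *)
Lemma Omega_in_slit_model (u : C) : upper_half_plane u -> slit_model (Omega u).
Proof.
  intros Hu. rewrite <- (cexp_clog u Hu).
  pose proof (Im_clog_bounds u) as Hth. destruct (clog u) as [x th].
  unfold Im in Hth; simpl in Hth. rewrite Omega_polar by auto.
  assert (Hs : 0 < sin th) by (apply sin_gt_0; lra).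
  pose proof (exp_pos x) as He.
  split; unfold Im, Re; simpl.
  - assert (0 < exp x * sin th) by (apply Rmult_lt_0_compat; lra). lra.
  - intros [E1 E2].
    set (p := PI - th). assert (Hp : 0 < p < PI) by (unfold p; lra).
    assert (Es : sin th = sin p) by (unfold p; rewrite sin_PI_x; reflexivity).
    assert (Ec : cos th = - cos p).
    { unfold p. rewrite cos_minus, cos_PI, sin_PI. ring. }
    rewrite Es in E1. rewrite Ec in E2. rewrite Es in Hs.
    assert (E1' : exp x * sin p = p) by (unfold p in *; lra).
    pose proof (phi_cos_lt_sin p Hp) as K1. pose proof (sin_lt_x p (proj1 Hp)) as K2.
    assert (1 < exp x) by nra.
    assert (0 < x).
    { apply Rnot_le_lt. intros Hx. destruct Hx as [Hx|Hx].
      - apply exp_increasing in Hx. rewrite exp_0 in Hx. lra.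
      - subst x. rewrite exp_0 in *. lra. }
    assert (exp x * cos p < 1); [|lra].
    apply Rmult_lt_reg_r with (sin p); [exact Hs|].
    replace (exp x * cos p * sin p) with (p * cos p) by (rewrite <- E1' at 1; ring). lra.
Qed.

Lemma cderiv_Omega (u : C) :
  upper_half_plane u -> cderiv_in upper_half_plane Omega u (1 + / u)%C.
Proof.
  intros Hu. apply cderiv_in_plus; [apply cderiv_in_id|apply cderiv_clog; exact Hu].
Qed.

Lemma Im_inv (u : C) : u <> 0 -> Im (/ u) = - Im u / (Cmod u * Cmod u).
Proof.
  intros Hu. apply Cmod_gt_0 in Hu.
  replace (Cmod u * Cmod u) with (Re u ^ 2 + Im u ^ 2) by (rewrite <- Cmod2_alt; ring).
  destruct u; reflexivity.
Qed.

Lemma Omega_deriv_ne_0 (u : C) : upper_half_plane u -> (1 + / u <> 0)%C.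
Proof.
  intros Hu E. pose proof (Cmod_pos_Im u Hu) as M.
  assert (Hu0 : u <> 0) by (apply Cmod_gt_0; exact M).
  assert (K : Im (1 + / u) = 0) by (rewrite E; reflexivity).
  replace (Im (1 + / u)) with (0 + Im (/ u)) in K by reflexivity.
  rewrite Im_inv in K by auto. unfold upper_half_plane in Hu.
  assert (0 < Im u / (Cmod u * Cmod u)) by (apply Rdiv_lt_0_compat; nra).
  unfold Rdiv in *. lra.
Qed.

(* Since Im Omega' < 0 on the convex domain H, the function
   s |-> Im (Omega (u0 + s D) * conj D) is strictly decreasing. *)
Lemma Omega_expanding (u0 : C) :
  upper_half_plane u0 -> exists m r, 0 < m /\ 0 < r /\ forall u, upper_half_plane u ->
    m * Rmin r (Cmod (u - u0)) <= Cmod (Omega u - Omega u0).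
Proof.
  intros Hu0. pose proof (Cmod_pos_Im u0 Hu0) as M0. unfold upper_half_plane in Hu0.
  (* On the disc of radius [r] about [u0] one has [Im u >= r] and [|u| <= 2 |u0|], so
     [- Im (Omega' u) = Im u / |u|^2 >= m]. *)
  set (r := Im u0 / 2). set (m := r / (4 * (Cmod u0 * Cmod u0))).
  assert (Hr : 0 < r) by (unfold r; lra).
  assert (Hm : 0 < m) by (unfold m; apply Rdiv_lt_0_compat; nra).
  exists m, r. split; [exact Hm|split; [exact Hr|]]. intros u Hu.
  destruct (classic (u = u0)) as [->|Hne].
  { replace (u0 - u0)%C with (RtoC 0) by ring. rewrite Cmod_0.
    rewrite Rmin_right by lra. rewrite Rmult_0_r. apply Cmod_ge_0. }
  pose proof (Cmod_sub_ne _ _ Hne) as PD. set (D := (u - u0)%C) in *.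
  set (d := Cmod D) in *.
  assert (Hpath : forall s, 0 <= s <= 1 -> upper_half_plane (u0 + RtoC s * D)).
  { intros s Hs. unfold upper_half_plane in *. unfold D.
    destruct u as [a b], u0 as [a0 b0]. unfold Im in *; simpl in *.
    replace (b0 + (s * (b + - b0) + 0 * (a + - a0))) with (b0 + s * (b - b0)) by ring.
    destruct (Rle_dec b0 b); nra. }
  set (f := fun s => Im (Omega (u0 + RtoC s * D) * Cconj D)).
  set (df := fun s => - (d * d) * (Im (u0 + RtoC s * D) /
     (Cmod (u0 + RtoC s * D) * Cmod (u0 + RtoC s * D)))).
  assert (Hloc : forall s, upper_half_plane (u0 + RtoC s * D) ->
    locally s (fun s' => upper_half_plane (u0 + RtoC s' * D))).
  { intros s Hs. unfold upper_half_plane in *.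
    assert (Es : forall s, Im (u0 + RtoC s * D) = Im u0 + s * Im D).
    { intros s'. destruct u0, D. unfold Im; simpl. ring. }
    apply filter_imp with (fun s' => 0 < Im u0 + s' * Im D).
    { intros s' H'. rewrite Es. exact H'. }
    rewrite Es in Hs.
    assert (Cn : continuous (fun s' => Im u0 + s' * Im D) s).
    { apply (ex_derive_continuous (V := R_NormedModule)). auto_derive. auto. }
    exact (Cn _ (open_gt 0 _ Hs)). }
  assert (Hder : forall s, 0 <= s <= 1 -> is_derive f s (df s)).
  { intros s Hs. pose proof (Hpath s Hs) as Hs'.
    assert (K : cderiv_in (real_in (fun s' => upper_half_plane (u0 + RtoC s' * D)))
      (fun w => Omega (u0 + w * D) * Cconj D)%C (RtoC s)
      (((1 + / (u0 + RtoC s * D)) * (0 + (1 * D + RtoC s * 0))) * Cconj D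
        + Omega (u0 + RtoC s * D) * 0)%C).
    { apply (cderiv_in_mult _ (fun w => Omega (u0 + w * D)%C) (fun _ => Cconj D));
        [|apply cderiv_in_const].
      apply (cderiv_in_comp _ upper_half_plane Omega (fun w => u0 + w * D)%C).
      - intros w [H1 H2]. replace w with (RtoC (Re w)); [exact H2|].
        destruct w; unfold Im in H1; simpl in H1; subst; reflexivity.
      - apply cderiv_Omega. exact Hs'.
      - apply cderiv_in_plus; [apply cderiv_in_const|].
        apply (cderiv_in_mult _ (fun w => w) (fun _ => D));
          [apply cderiv_in_id|apply cderiv_in_const]. }
    destruct (is_derive_Re_Im _ s _ _ (Hloc s Hs') K) as [_ K'].
    replace (df s) with (Im (((1 + / (u0 + RtoC s * D)) * (0 + (1 * D + RtoC s * 0))) * Cconj D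
        + Omega (u0 + RtoC s * D) * 0)); [exact K'|].
    replace (((1 + / (u0 + RtoC s * D)) * (0 + (1 * D + RtoC s * 0))) * Cconj D
        + Omega (u0 + RtoC s * D) * 0)%C
      with ((1 + / (u0 + RtoC s * D)) * (D * Cconj D))%C by ring.
    rewrite <- Cmod2_conj. fold d. unfold df.
    assert (Hn0 : (u0 + RtoC s * D <> 0)%C) by (apply Cmod_gt_0, Cmod_pos_Im; exact Hs').
    pose proof (Im_inv _ Hn0) as EI.
    set (v := (u0 + RtoC s * D)%C) in *.
    transitivity (Im (/ v) * (d * d)); [|rewrite EI; unfold Rdiv; ring].
    destruct (/ v)%C. unfold Im; simpl. ring. }
  assert (Hdf : forall s, 0 <= s <= 1 -> df s <= 0).
  { intros s Hs. unfold df. pose proof (Hpath s Hs) as Hs'.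
    pose proof (Cmod_pos_Im _ Hs'). unfold upper_half_plane in Hs'.
    assert (0 < Im (u0 + RtoC s * D) / (Cmod (u0 + RtoC s * D) * Cmod (u0 + RtoC s * D)))
      by (apply Rdiv_lt_0_compat; nra).
    nra. }
  (* [t] is the fraction of the segment within distance [r] of [u0]. There the slope is at most
     [- d^2 m]; beyond it monotonicity suffices. Hence the minimum in the conclusion. *)
  set (t := Rmin r d / d).
  assert (Hmin1 := Rmin_l r d). assert (Hmin2 := Rmin_r r d).
  assert (Hmin3 : 0 < Rmin r d) by (apply Rmin_glb_lt; auto).
  assert (Ht : 0 < t <= 1).
  { unfold t. split; [apply Rdiv_lt_0_compat; auto|].
    apply Rmult_le_reg_r with d; auto. unfold Rdiv. rewrite Rmult_assoc, Rinv_l; lra. }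
  assert (Etd : t * d = Rmin r d) by (unfold t; field; lra).
  assert (Hdf2 : forall s, 0 <= s <= t -> df s <= - (d * d) * m).
  { intros s Hs. unfold df.
    assert (Hclose : Cmod (RtoC s * D) <= r).
    { rewrite Cmod_mult, Cmod_R, Rabs_right by lra. fold d. nra. }
    assert (B1 : r <= Im (u0 + RtoC s * D)).
    { pose proof (im_le_Cmod (RtoC s * D)) as L. apply Rabs_le_between in L.
      replace (Im (u0 + RtoC s * D)) with (Im u0 + Im (RtoC s * D)) by reflexivity.
      unfold r in *. lra. }
    assert (B2 : Cmod (u0 + RtoC s * D) <= 2 * Cmod u0).
    { eapply Rle_trans; [apply Cmod_triangle|].
      pose proof (im_le_Cmod u0) as L. apply Rabs_le_between in L. unfold r in *. lra. }
    pose proof (Cmod_pos_Im (u0 + RtoC s * D) ltac:(lra)) as B3.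
    assert (m <= Im (u0 + RtoC s * D) / (Cmod (u0 + RtoC s * D) * Cmod (u0 + RtoC s * D))).
    { unfold m, Rdiv. apply Rmult_le_compat; [lra| |exact B1|].
      - apply Rlt_le, Rinv_0_lt_compat. nra.
      - apply Rinv_le_contravar; nra. }
    nra. }
  assert (D1 : f t - f 0 <= - (d * d) * m * t).
  { destruct (MVT_cor2 f df 0 t) as [c [E Hc]].
    - lra.
    - intros x Hx. apply is_derive_Reals, Hder. lra.
    - specialize (Hdf2 c ltac:(lra)). nra. }
  assert (D2 : f 1 - f t <= 0).
  { destruct (proj2 Ht) as [Ht1| ->]; [|lra].
    destruct (MVT_cor2 f df t 1) as [c [E Hc]].
    - lra.
    - intros x Hx. apply is_derive_Reals, Hder. lra.
    - specialize (Hdf c ltac:(lra)). nra. }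
  assert (Hf : f 0 - f 1 <= Cmod (Omega u - Omega u0) * d).
  { unfold f. replace (u0 + RtoC 0 * D)%C with u0 by ring.
    replace (u0 + RtoC 1 * D)%C with u by (unfold D; ring).
    pose proof (im_le_Cmod ((Omega u - Omega u0) * Cconj D)) as L.
    rewrite Cmod_mult, Cmod_conj in L. fold d in L. apply Rabs_le_between in L.
    replace (Im ((Omega u - Omega u0) * Cconj D))
      with (Im (Omega u * Cconj D) - Im (Omega u0 * Cconj D)) in L.
    - lra.
    - destruct (Omega u), (Omega u0), (Cconj D). unfold Im; simpl. ring. }
  apply Rmult_le_reg_r with d; auto. rewrite <- Etd. nra.
Qed.

Lemma Omega_inj (u v : C) :
  upper_half_plane u -> upper_half_plane v -> Omega u = Omega v -> u = v.
Proof.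
  intros Hu Hv E. destruct (Omega_expanding v Hv) as (m & r & Hm & Hr & H).
  specialize (H u Hu). apply NNPP. intros N. apply Cmod_sub_ne in N.
  rewrite E in H. replace (Omega v - Omega v)%C with (RtoC 0) in H by ring.
  rewrite Cmod_0 in H.
  assert (0 < Rmin r (Cmod (u - v))) by (apply Rmin_glb_lt; auto). nra.
Qed.

(** Modulus of the point [u] of argument [th] with [Im (Omega u) = b]; [polar_re] is [Re (Omega u)]
    there. Surjectivity becomes the intermediate value theorem along this level curve. *)
Definition polar_radius (b th : R) : R := (b - th) / sin th.

Definition polar_re (b th : R) : R :=
  polar_radius b th * cos th + ln (polar_radius b th).

Lemma polar_radius_pos (b th : R) : 0 < th < PI -> th < b -> 0 < polar_radius b th.
Proof. intros H Hb. apply Rdiv_lt_0_compat; [lra|apply sin_gt_0; lra]. Qed.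

Lemma polar_re_continuous (b th : R) :
  0 < th < PI -> th < b -> continuity_pt (polar_re b) th.
Proof.
  intros H Hb. pose proof (polar_radius_pos b th H Hb) as P.
  assert (0 < sin th) by (apply sin_gt_0; lra).
  apply derivable_continuous_pt. apply ex_derive_Reals_0.
  unfold polar_re, polar_radius in *. auto_derive. repeat split; auto; lra.
Qed.

Lemma ln_le_minus_1 (x : R) : 0 < x -> ln x <= x - 1.
Proof.
  intros H. destruct (Req_dec (ln x) 0) as [E|N].
  - assert (x = 1) by (rewrite <- (exp_ln x H), E; apply exp_0). subst. lra.
  - pose proof (exp_ineq1 (ln x) N) as K. rewrite exp_ln in K by auto. lra.
Qed.

Lemma polar_re_large (a b : R) : 0 < b ->
  exists th, 0 < th < PI /\ th < b /\ a < polar_re b th.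
Proof.
  intros Hb. pose proof PI_RGT_0 as Hpi.
  pose proof (Rabs_pos a) as Ha.
  (* [th <= pi / 3] gives [cos th >= 1 / 2], and the last bound makes the modulus at least
     [2 |a| + 2], so that half of it already exceeds [a]. *)
  destruct (pos_min3 (PI / 3) (b / 2) (b / 2 / (2 * Rabs a + 2)))
    as (th & H0 & H1 & H2 & H3); [lra|lra|apply Rdiv_lt_0_compat; lra|].
  exists th. split; [lra|split; [lra|]].
  pose proof (sin_lt_x th H0) as S1.
  assert (S0 : 0 < sin th) by (apply sin_gt_0; lra).
  assert (C1 : 1 / 2 <= cos th).
  { rewrite <- cos_PI3. apply cos_decr_1; lra. }
  assert (M : 2 * Rabs a + 2 <= polar_radius b th).
  { unfold polar_radius. apply Rmult_le_reg_r with (sin th); auto.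
    unfold Rdiv at 1. rewrite (Rmult_assoc (b - th)), Rinv_l, Rmult_1_r by lra.
    assert (th * (2 * Rabs a + 2) <= b / 2).
    { replace (b / 2) with (b / 2 / (2 * Rabs a + 2) * (2 * Rabs a + 2)) by (field; lra).
      apply Rmult_le_compat_r; lra. }
    nra. }
  unfold polar_re. set (mu := polar_radius b th) in *.
  assert (0 <= ln mu) by (rewrite <- ln_1; apply ln_le; lra).
  pose proof (Rle_abs a). nra.
Qed.

Lemma continuity_pt_eps (f : R -> R) (x e : R) :
  continuity_pt f x -> 0 < e ->
  exists d, 0 < d /\ forall y, Rabs (y - x) < d -> Rabs (f y - f x) < e.
Proof.
  intros H He. apply continuity_pt_filterlim in H.
  destruct (H _ (locally_ball _ (mkposreal e He))) as [d K].
  exists d. split; [apply cond_pos|]. intros y Hy. exact (K y Hy).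
Qed.

(** The level curve ends in three different ways. Below height pi it ends at [u = 0], where the
    logarithm tends to minus infinity. At height pi it runs to [u = -1], so the real part only tends
    to -1, the tip of the slit. Above pi it goes to infinity in the negative real direction. *)
Lemma polar_re_small (a b : R) : 0 < b -> ~ (b = PI /\ a <= -1) ->
  exists th, 0 < th < PI /\ th < b /\ polar_re b th < a.
Proof.
  intros Hb Hab. pose proof PI_RGT_0 as Hpi. pose proof (Rabs_pos a) as Ha.
  pose proof (Rle_abs (- a)) as Ha'. rewrite Rabs_Ropp in Ha'.
  destruct (Rtotal_order b PI) as [L|[L|L]].
  - assert (S0 : 0 < sin b) by (apply sin_gt_0; lra).
    assert (Hc : continuity_pt (polar_radius b) b).
    { apply derivable_continuous_pt. apply ex_derive_Reals_0.
      unfold polar_radius. auto_derive. lra. }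
    destruct (continuity_pt_eps _ _ (exp (- Rabs a - 2)) Hc (exp_pos _)) as [d [Hd K]].
    set (th := b - Rmin (b / 2) (d / 2)).
    assert (M1 := Rmin_l (b / 2) (d / 2)). assert (M2 := Rmin_r (b / 2) (d / 2)).
    assert (M3 : 0 < Rmin (b / 2) (d / 2)) by (apply Rmin_glb_lt; lra).
    assert (Hth : 0 < th < PI) by (unfold th; lra).
    assert (Hthb : th < b) by (unfold th; lra).
    exists th. split; [auto|split; [auto|]].
    pose proof (polar_radius_pos b th Hth Hthb) as P.
    assert (U : polar_radius b th < exp (- Rabs a - 2)).
    { specialize (K th). replace (polar_radius b b) with 0 in K
        by (unfold polar_radius, Rdiv; ring).
      rewrite Rminus_0_r, (Rabs_right (polar_radius b th)) in K by lra.
      apply K. apply Rabs_def1; unfold th; lra. }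
    unfold polar_re. set (mu := polar_radius b th) in *.
    assert (ln mu < - Rabs a - 2).
    { rewrite <- (ln_exp (- Rabs a - 2)). apply ln_increasing; auto. }
    assert (mu < 1).
    { eapply Rlt_trans; [exact U|]. rewrite <- exp_0. apply exp_increasing. lra. }
    pose proof (COS_bound th). nra.
  - assert (La : -1 < a) by (apply Rnot_le_lt; intros N; apply Hab; auto).
    (* The real part will be at most [- mu (1 - e) + mu - 1 = e mu - 1 <= 2 e - 1], which is below
       [a] once [4 e <= a + 1]. *)
    destruct (pos_min3 (1 / 2) ((a + 1) / 4) 1) as (e & E0 & E1 & E2 & _); [lra..|].
    assert (Ds : is_derive sin 0 1) by (auto_derive; [auto|rewrite cos_0; ring]).
    destruct (is_derive_eps sin 0 1 e Ds E0) as [d1 [P1 K1]].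
    destruct (continuity_pt_eps cos 0 e (continuity_cos 0) E0) as [d2 [P2 K2]].
    destruct (pos_min3 1 (d1 / 2) (d2 / 2)) as (p & p0 & p1 & p2 & p3); [lra..|].
    pose proof PI2_1 as HPI2.
    exists (PI - p). split; [lra|split; [lra|]].
    specialize (K1 p). rewrite Rminus_0_r, sin_0, Rminus_0_r, Rmult_1_l in K1.
    rewrite (Rabs_right p) in K1 by lra. specialize (K1 ltac:(lra)).
    apply Rabs_le_between in K1.
    specialize (K2 p). rewrite Rminus_0_r, cos_0 in K2.
    rewrite (Rabs_right p) in K2 by lra. specialize (K2 ltac:(lra)).
    apply Rabs_def2 in K2.
    pose proof (sin_lt_x p p0) as S1.
    assert (S0 : 0 < sin p) by (apply sin_gt_0; lra).
    unfold polar_re, polar_radius. rewrite L, sin_PI_x, cos_minus, cos_PI, sin_PI.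
    replace (PI - (PI - p)) with p by ring.
    set (mu := p / sin p).
    assert (Emu : mu * sin p = p) by (unfold mu; field; lra).
    assert (mu1 : 1 < mu) by nra.
    assert (mu2 : mu <= 1 + 2 * e) by nra.
    pose proof (ln_le_minus_1 mu ltac:(lra)). nra.
  - assert (Hs : continuity_pt sin PI) by apply continuity_sin.
    assert (Hcs : continuity_pt cos PI) by apply continuity_cos.
    destruct (continuity_pt_eps _ _ ((b - PI) / (4 * (Rabs a + 2))) Hs) as [d1 [P1 K1]].
    { apply Rdiv_lt_0_compat; lra. }
    destruct (continuity_pt_eps _ _ (1 / 2) Hcs) as [d2 [P2 K2]]; [lra|].
    destruct (pos_min3 1 (d1 / 2) (d2 / 2)) as (p & p0 & p1 & p2 & p3); [lra..|].
    pose proof PI2_1 as HPI2.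
    set (th := PI - p).
    assert (Hth : 0 < th < PI) by (unfold th; lra).
    exists th. split; [exact Hth|split; [lra|]].
    assert (Hthp : Rabs (th - PI) <= p) by (unfold th; apply Rabs_le; lra).
    specialize (K1 th ltac:(lra)). specialize (K2 th ltac:(lra)).
    rewrite sin_PI, Rminus_0_r in K1. rewrite cos_PI in K2. apply Rabs_def2 in K2.
    assert (S0 : 0 < sin th) by (apply sin_gt_0; lra).
    rewrite Rabs_right in K1 by lra.
    assert (M : 4 * (Rabs a + 2) <= polar_radius b th).
    { unfold polar_radius. apply Rmult_le_reg_r with (sin th); auto.
      unfold Rdiv. rewrite (Rmult_assoc (b - th)), Rinv_l, Rmult_1_r by lra.
      apply Rle_trans with (b - PI); [|lra].
      replace (b - PI) with (4 * (Rabs a + 2) * ((b - PI) / (4 * (Rabs a + 2))))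
        by (field; lra).
      apply Rmult_le_compat_l; lra. }
    unfold polar_re. set (mu := polar_radius b th) in *.
    (* As [cos th < -1 / 2], the real part is then at most [1 - mu / 4], which is below [a] because
       [mu >= 4 (|a| + 2)]. *)
    assert (Hln : ln mu <= mu / 4 + 1).
    { replace mu with (4 * (mu / 4)) at 1 by field.
      rewrite ln_mult by lra.
      pose proof (ln_le_minus_1 (mu / 4) ltac:(lra)).
      replace 4 with (2 * 2) at 1 by ring. rewrite ln_mult by lra.
      pose proof (ln_le_minus_1 2 ltac:(lra)). lra. }
    nra.
Qed.

Lemma Omega_surj (w : C) : slit_model w -> exists u, upper_half_plane u /\ Omega u = w.
Proof.
  intros [Hb Hab]. destruct w as [a b]. unfold Im, Re in *; simpl in *.
  assert (Hab' : ~ (b = PI /\ a <= -1)) by exact Hab.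
  destruct (polar_re_large a b Hb) as [t1 [T1 [B1 L1]]].
  destruct (polar_re_small a b Hb Hab') as [t2 [T2 [B2 L2]]].
  assert (Hth : exists th, 0 < th < PI /\ th < b /\ polar_re b th = a).
  { destruct (Rtotal_order t1 t2) as [O|[O|O]].
    - destruct (Ranalysis5.IVT_interv (fun t => a - polar_re b t) t1 t2) as [t [Ht E]]; try lra.
      + intros t Ht. apply continuity_pt_minus.
        * apply continuity_pt_const. intros ? ?; reflexivity.
        * apply polar_re_continuous; lra.
      + exists t. lra.
    - subst. lra.
    - destruct (Ranalysis5.IVT_interv (fun t => polar_re b t - a) t2 t1) as [t [Ht E]]; try lra.
      + intros t Ht. apply continuity_pt_minus.
        * apply polar_re_continuous; lra.
        * apply continuity_pt_const. intros ? ?; reflexivity.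
      + exists t. lra. }
  destruct Hth as [th [T [B E]]].
  pose proof (polar_radius_pos b th T B) as P.
  assert (S0 : 0 < sin th) by (apply sin_gt_0; lra).
  exists (cexp (ln (polar_radius b th), th)). split.
  - unfold upper_half_plane, cexp, Im; simpl. rewrite exp_ln by auto.
    apply Rmult_lt_0_compat; auto.
  - rewrite Omega_polar, exp_ln by auto. f_equal; [exact E|].
    unfold polar_radius. field. lra.
Qed.

(** [Psi] is a choice of preimages; the lower bound of [Omega_expanding] makes it continuous, after
    which the rule for inverse functions differentiates it. *)
Lemma Omega_inverse : exists Psi : C -> C,
  (forall w, slit_model w -> upper_half_plane (Psi w) /\ Omega (Psi w) = w /\
     exists l, cderiv_in slit_model Psi w l).
Proof.
  assert (H : forall w, exists u, slit_model w -> upper_half_plane u /\ Omega u = w).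
  { intros w. destruct (classic (slit_model w)) as [Hw|Hw].
    - destruct (Omega_surj w Hw) as [u Hu]. exists u. auto.
    - exists 0. contradiction. }
  set (Psi := fun w => proj1_sig (constructive_indefinite_description _ (H w))).
  assert (HPsi : forall w, slit_model w -> upper_half_plane (Psi w) /\ Omega (Psi w) = w).
  { intros w. exact (proj2_sig (constructive_indefinite_description _ (H w))). }
  clearbody Psi. exists Psi.
  intros w Hw. destruct (HPsi w Hw) as [K1 K2]. split; [exact K1|split; [exact K2|]].
  exists (/ (1 + / Psi w))%C.
  apply (cderiv_in_inverse _ upper_half_plane Omega); auto.
  - intros w' Hw'. apply HPsi; auto.
  - intros w' Hw'. apply HPsi; auto.
  - intros e He. destruct (Omega_expanding _ K1) as (m & r & Hm & Hr & HO).
    exists (m * Rmin r e). split.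
    { apply Rmult_lt_0_compat; [auto|apply Rmin_glb_lt; auto]. }
    intros w' Hw' Hlt. destruct (HPsi w' Hw') as [L1 L2].
    specialize (HO _ L1). rewrite L2, K2 in HO.
    apply Rnot_le_lt. intros N.
    assert (Rmin r e <= Rmin r (Cmod (Psi w' - Psi w)))
      by (apply Rle_min_compat_l; exact N).
    nra.
  - apply cderiv_Omega. exact K1.
  - apply Omega_deriv_ne_0. exact K1.
Qed.

(** * The explicit conformal map onto the half-plane minus an arc *)

Lemma Im_RtoC_mult (c : R) (z : C) : Im (RtoC c * z) = c * Im z.
Proof. destruct z; unfold Im; simpl; ring. Qed.

Lemma Re_RtoC_mult (c : R) (z : C) : Re (RtoC c * z) = c * Re z.
Proof. destruct z; unfold Re; simpl; ring. Qed.

Lemma Im_plus (z w : C) : Im (z + w) = Im z + Im w.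
Proof. reflexivity. Qed.

Lemma Re_plus (z w : C) : Re (z + w) = Re z + Re w.
Proof. reflexivity. Qed.

Lemma ne_0_of_Im (z : C) : Im z <> 0 -> z <> 0.
Proof. intros H ->. apply H. reflexivity. Qed.

Lemma upper_ne_0 (z : C) : upper_half_plane z -> z <> 0.
Proof. intros H. apply ne_0_of_Im. unfold upper_half_plane in H. lra. Qed.

Lemma upper_opp_inv (z : C) : upper_half_plane z -> upper_half_plane (- / z).
Proof.
  intros H. pose proof (upper_ne_0 z H) as N. pose proof (Cmod_pos_Im z H) as M.
  unfold upper_half_plane in *.
  replace (Im (- / z)) with (- Im (/ z)) by (destruct (/ z)%C; reflexivity).
  rewrite Im_inv by auto.
  assert (0 < Im z / (Cmod z * Cmod z)) by (apply Rdiv_lt_0_compat; nra).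
  unfold Rdiv in *. lra.
Qed.

Lemma upper_scal (c : R) (z : C) : 0 < c -> upper_half_plane z -> upper_half_plane (RtoC c * z).
Proof.
  unfold upper_half_plane. intros Hc Hz. rewrite Im_RtoC_mult.
  apply Rmult_lt_0_compat; auto.
Qed.

Lemma upper_shift (c : R) (z : C) : upper_half_plane z -> upper_half_plane (z + RtoC c).
Proof. unfold upper_half_plane. intros Hz. rewrite Im_plus. simpl. lra. Qed.

(* The upper half-plane slit along the image under z |-> - 1 / z of the ray with
   end point [xi] on the horizontal line at height [b pi], that is, along an arc
   of the circle of radius [1 / (2 pi b)] tangent to the real line at 0. *)
Definition slit_dom (b xi : R) (z : C) : Prop :=
  upper_half_plane z /\ ~ (Im (- / z) = b * PI /\ Re (- / z) <= xi).

(** In the variable [u = k (1 - v / eta)] of [Omega], this number [k] is the image of infinity. The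
    condition [b v (k + 1) = 1] gives the map derivative 1 at infinity. *)
Definition slit_height (b v : R) : R := (1 - b * v) / (b * v).

(** Real part of the image of the tip [-1 + i pi] under [w |-> b (w - k - ln k)], the affine map
    that sends [k + ln k], the value of [u + log u] at [k], to 0. *)
Definition slit_tip (b v : R) : R :=
  b * (-1 - slit_height b v - ln (slit_height b v)).

(** The shift [b v^2 / 2] cancels the constant term in the expansion of [slit_map] at infinity. *)
Definition slit_eta (b v : R) (z : C) : C := (z + RtoC (b * (v * v) / 2))%C.

(** [Omega] after the Moebius substitution and before the affine normalization, as [slit_W_Omega]
    shows; written out with [clog] because this form expands directly at infinity. *)
Definition slit_W (b v : R) (z : C) : C :=
  (RtoC b * clog (1 - RtoC v * / slit_eta b v z)
     - RtoC (1 - b * v) * / slit_eta b v z)%C.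

Definition slit_map (b v : R) (z : C) : C := (- / slit_W b v z)%C.

Lemma clog_scal (k : R) (z : C) : 0 < k -> upper_half_plane z ->
  clog (RtoC k * z) = (RtoC (ln k) + clog z)%C.
Proof.
  intros Hk Hz. pose proof (Cmod_pos_Im z Hz) as M. unfold upper_half_plane in Hz.
  unfold clog. rewrite Cmod_mult, Cmod_R, Rabs_right, ln_mult by lra.
  rewrite Im_RtoC_mult, Re_RtoC_mult. unfold Cplus; simpl. f_equal.
  replace (k * Re z / (k * Im z)) with (Re z / Im z) by (field; lra). ring.
Qed.

Section SlitMap.

Variables b v : R.
Hypothesis Hb : 0 < b.
Hypothesis Hv : 0 < v.
Hypothesis Hbv : b * v < 1.

Let k := slit_height b v.

Lemma slit_height_pos : 0 < k.
Proof. unfold k, slit_height. apply Rdiv_lt_0_compat; [lra|nra]. Qed.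

Lemma slit_mobius_upper (z : C) :
  upper_half_plane z -> upper_half_plane (1 - RtoC v * / slit_eta b v z).
Proof.
  intros Hz. assert (He : upper_half_plane (slit_eta b v z)) by (apply upper_shift; auto).
  apply upper_opp_inv in He. apply (upper_scal v) in He; auto.
  apply (upper_shift 1) in He.
  replace (1 - RtoC v * / slit_eta b v z)%C
    with (RtoC v * - / slit_eta b v z + 1)%C by ring.
  exact He.
Qed.

Lemma slit_W_Omega (z : C) : upper_half_plane z ->
  slit_W b v z = (RtoC b * (Omega (RtoC k * (1 - RtoC v * / slit_eta b v z))
                            - RtoC (k + ln k)))%C.
Proof.
  intros Hz. pose proof (slit_mobius_upper z Hz) as Hm.
  assert (He : slit_eta b v z <> 0) by (apply upper_ne_0, upper_shift; auto).
  unfold slit_W, Omega. rewrite (clog_scal k _ slit_height_pos Hm).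
  replace (1 - b * v) with (b * (k * v)) by (unfold k, slit_height; field; split; lra).
  rewrite RtoC_plus, !RtoC_mult. field. exact He.
Qed.

Lemma slit_W_in (z : C) : upper_half_plane z ->
  upper_half_plane (slit_W b v z) /\
  ~ (Im (slit_W b v z) = b * PI /\ Re (slit_W b v z) <= slit_tip b v).
Proof.
  intros Hz. pose proof (slit_mobius_upper z Hz) as Hm.
  apply (upper_scal k _ slit_height_pos) in Hm.
  apply Omega_in_slit_model in Hm. rewrite (slit_W_Omega z Hz).
  set (u := Omega (RtoC k * (1 - RtoC v * / slit_eta b v z))) in *. destruct Hm as [H1 H2].
  unfold upper_half_plane, Cminus. rewrite Im_RtoC_mult, Re_RtoC_mult, Im_plus, Re_plus.
  replace (Im (- RtoC (k + ln k))) with 0 by (unfold Im; simpl; ring).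
  replace (Re (- RtoC (k + ln k))) with (- (k + ln k)) by reflexivity.
  rewrite Rplus_0_r. split; [apply Rmult_lt_0_compat; auto|].
  intros [E L]. apply H2. unfold slit_tip in L. fold k in L. split; nra.
Qed.

Lemma slit_map_inv (z : C) : upper_half_plane z -> (- / slit_map b v z = slit_W b v z)%C.
Proof.
  intros Hz. destruct (slit_W_in z Hz) as [H _]. unfold slit_map. field.
  apply upper_ne_0. exact H.
Qed.

Lemma slit_map_in (z : C) : upper_half_plane z -> slit_dom b (slit_tip b v) (slit_map b v z).
Proof.
  intros Hz. destruct (slit_W_in z Hz) as [H1 H2]. split.
  - apply upper_opp_inv. exact H1.
  - rewrite slit_map_inv by auto. exact H2.
Qed.

Lemma cderiv_slit_map (z : C) : upper_half_plane z ->
  exists l, cderiv_in upper_half_plane (slit_map b v) z l.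
Proof.
  intros Hz.
  assert (He : forall w, upper_half_plane w -> slit_eta b v w <> 0)
    by (intros w Hw; apply upper_ne_0, upper_shift; auto).
  assert (De : cderiv_in upper_half_plane (slit_eta b v) z (1 + 0)%C)
    by (apply cderiv_in_plus; [apply cderiv_in_id|apply cderiv_in_const]).
  apply cderiv_in_inv in De; auto.
  eexists. apply cderiv_in_opp. apply cderiv_in_inv.
  - apply upper_ne_0. apply slit_W_in. exact Hz.
  - intros w Hw. apply upper_ne_0. apply slit_W_in. exact Hw.
  - unfold slit_W. apply cderiv_in_minus; [|apply cderiv_in_scal; exact De].
    apply cderiv_in_scal.
    apply (cderiv_in_comp _ upper_half_plane clog
             (fun w => 1 - RtoC v * / slit_eta b v w)%C).
    + intros w Hw. apply slit_mobius_upper. exact Hw.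
    + apply cderiv_clog. apply slit_mobius_upper. exact Hz.
    + apply cderiv_in_minus; [apply cderiv_in_const|apply cderiv_in_scal; exact De].
Qed.

Lemma slit_map_inverse : exists J : C -> C,
  (forall z, slit_dom b (slit_tip b v) z ->
     upper_half_plane (J z) /\ slit_map b v (J z) = z /\
     exists l, cderiv_in (slit_dom b (slit_tip b v)) J z l) /\
  (forall z, upper_half_plane z -> J (slit_map b v z) = z).
Proof.
  destruct Omega_inverse as [Psi HPsi]. set (D := slit_dom b (slit_tip b v)).
  pose proof slit_height_pos as Hk.
  (* Undoes the affine normalization, leading from [- 1 / z] back to the plane of [Omega]. *)
  set (om := fun z => (RtoC (/ b) * - / z + RtoC (k + ln k))%C).
  assert (Hom : forall z, D z -> slit_model (om z)).
  { intros z [Hz Hn]. unfold om. split.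
    - apply upper_shift, upper_scal; [apply Rinv_0_lt_compat; auto|].
      apply upper_opp_inv; auto.
    - rewrite Im_plus, Re_plus, Im_RtoC_mult, Re_RtoC_mult.
      change (Im (RtoC (k + ln k))) with 0. change (Re (RtoC (k + ln k))) with (k + ln k).
      rewrite Rplus_0_r. intros [E L].
      apply Hn. unfold slit_tip. fold k. split.
      + apply Rmult_eq_reg_l with (/ b); [|apply Rinv_neq_0_compat; lra].
        rewrite <- Rmult_assoc, Rinv_l, Rmult_1_l by lra. lra.
      + apply Rmult_le_reg_l with (/ b); [apply Rinv_0_lt_compat; auto|].
        rewrite <- (Rmult_assoc (/ b) b), Rinv_l, Rmult_1_l by lra. lra. }
  (* If [Psi (om z) = k (1 - v / eta)], this is [v / eta]; so [eta] is recovered as [v / den z]. *)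
  set (den := fun z => (1 - RtoC (/ k) * Psi (om z))%C).
  assert (Hden : forall z, D z -> upper_half_plane (- den z)).
  { intros z Hz. destruct (HPsi _ (Hom z Hz)) as [H1 _].
    replace (- den z)%C with (RtoC (/ k) * Psi (om z) + RtoC (-1))%C by (unfold den; ring).
    apply upper_shift, upper_scal; auto. apply Rinv_0_lt_compat; auto. }
  assert (Hden0 : forall z, D z -> den z <> 0).
  { intros z Hz E. apply (upper_ne_0 _ (Hden z Hz)). rewrite E. ring. }
  set (J := fun z => (RtoC v * / den z - RtoC (b * (v * v) / 2))%C).
  assert (HJup : forall z, D z -> upper_half_plane (J z)).
  { intros z Hz. pose proof (upper_opp_inv _ (Hden z Hz)) as H1.
    replace (J z) with (RtoC v * - / - den z + RtoC (- (b * (v * v) / 2)))%C.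
    - apply upper_shift, upper_scal; auto.
    - unfold J. rewrite RtoC_opp. field. apply Hden0; auto. }
  assert (HJ : forall z, D z -> slit_map b v (J z) = z).
  { intros z Hz. pose proof (HJup z Hz) as H1. unfold slit_map.
    rewrite slit_W_Omega by auto.
    assert (Ee : slit_eta b v (J z) = (RtoC v * / den z)%C)
      by (unfold slit_eta, J; ring).
    pose proof (Hden0 z Hz) as Hd. destruct (HPsi _ (Hom z Hz)) as [P1 [P2 _]].
    assert (Vn : RtoC v <> 0) by (apply RtoC_ne_0; lra).
    assert (Kn : RtoC k <> 0) by (apply RtoC_ne_0; lra).
    assert (Bn : RtoC b <> 0) by (apply RtoC_ne_0; lra).
    assert (Zn : z <> 0) by (apply upper_ne_0; apply Hz).
    replace (RtoC k * (1 - RtoC v * / slit_eta b v (J z)))%C with (Psi (om z)).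
    - rewrite P2. unfold om. rewrite RtoC_inv by lra.
      replace (RtoC b * (/ RtoC b * - / z + RtoC (k + ln k) - RtoC (k + ln k)))%C
        with (- / z)%C by (field; auto).
      field. auto.
    - rewrite Ee. replace (/ (RtoC v * / den z))%C with (den z * / RtoC v)%C by (field; auto).
      unfold den. rewrite RtoC_inv by lra. field. auto. }
  exists J. split.
  - intros z Hz. split; [auto|split; [auto|]].
    destruct (HPsi _ (Hom z Hz)) as [P1 [P2 [l Hl]]].
    eexists. apply cderiv_in_minus; [|apply cderiv_in_const].
    apply cderiv_in_scal. apply cderiv_in_inv; auto.
    apply cderiv_in_minus; [apply cderiv_in_const|]. apply cderiv_in_scal.
    apply (cderiv_in_comp _ slit_model Psi om); [auto|exact Hl|].
    apply cderiv_in_plus; [|apply cderiv_in_const]. apply cderiv_in_scal, cderiv_in_opp.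
    apply cderiv_in_inv; [|intros w Hw|apply cderiv_in_id]; apply upper_ne_0.
    + apply Hz.
    + apply Hw.
  - intros z Hz. pose proof (slit_map_in z Hz) as Hd.
    pose proof (HJ _ Hd) as E. pose proof (HJup _ Hd) as U.
    set (z' := J (slit_map b v z)) in *.
    assert (EW : slit_W b v z' = slit_W b v z).
    { rewrite <- (slit_map_inv z'), <- (slit_map_inv z), E by auto. reflexivity. }
    rewrite !slit_W_Omega in EW by auto.
    assert (Vn : RtoC v <> 0) by (apply RtoC_ne_0; lra).
    assert (Kn : RtoC k <> 0) by (apply RtoC_ne_0; lra).
    assert (Bn : RtoC b <> 0) by (apply RtoC_ne_0; lra).
    assert (EO : Omega (RtoC k * (1 - RtoC v * / slit_eta b v z')) =
                 Omega (RtoC k * (1 - RtoC v * / slit_eta b v z))).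
    { set (A := Omega (RtoC k * (1 - RtoC v * / slit_eta b v z'))) in *.
      set (B := Omega (RtoC k * (1 - RtoC v * / slit_eta b v z))) in *.
      replace A with (/ RtoC b * (RtoC b * (A - RtoC (k + ln k))) + RtoC (k + ln k))%C
        by (field; auto).
      rewrite EW. field. auto. }
    apply Omega_inj in EO; try (apply upper_scal; [exact Hk|apply slit_mobius_upper; auto]).
    assert (N1 : slit_eta b v z <> 0) by (apply upper_ne_0, upper_shift; auto).
    assert (N2 : slit_eta b v z' <> 0) by (apply upper_ne_0, upper_shift; auto).
    assert (Einv : (/ slit_eta b v z' = / slit_eta b v z)%C).
    { set (A := (/ slit_eta b v z')%C) in *. set (B := (/ slit_eta b v z)%C) in *.
      replace A with ((1 - / RtoC k * (RtoC k * (1 - RtoC v * A))) * / RtoC v)%C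
        by (field; auto).
      rewrite EO. field. auto. }
    assert (Ee : slit_eta b v z' = slit_eta b v z).
    { replace (slit_eta b v z') with (/ / slit_eta b v z')%C.
      - rewrite Einv. field. exact N1.
      - field. exact N2. }
    unfold slit_eta in Ee.
    replace z' with (z' + RtoC (b * (v * v) / 2) - RtoC (b * (v * v) / 2))%C by ring.
    rewrite Ee. ring.
Qed.

End SlitMap.

(** * Expansion at infinity *)

Definition bigO (n : nat) (F : C -> C) : Prop :=
  exists M K, forall z, upper_half_plane z -> M <= Cmod z ->
    Cmod (F z) <= K / Cmod z ^ n.

Lemma bigO_plus (n : nat) (F G : C -> C) :
  bigO n F -> bigO n G -> bigO n (fun z => (F z + G z)%C).
Proof.
  intros (M1 & K1 & H1) (M2 & K2 & H2).
  exists (Rmax M1 M2), (K1 + K2). intros z Hz HM. eapply Rle_trans; [apply Cmod_triangle|].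
  specialize (H1 z Hz (Rle_trans _ _ _ (Rmax_l _ _) HM)).
  specialize (H2 z Hz (Rle_trans _ _ _ (Rmax_r _ _) HM)).
  unfold Rdiv in *. rewrite Rmult_plus_distr_r. lra.
Qed.

Lemma bigO_mult (n m : nat) (F G : C -> C) :
  bigO n F -> bigO m G -> bigO (n + m) (fun z => (F z * G z)%C).
Proof.
  intros (M1 & K1 & H1) (M2 & K2 & H2).
  exists (Rmax M1 M2), (K1 * K2). intros z Hz HM. rewrite Cmod_mult.
  specialize (H1 z Hz (Rle_trans _ _ _ (Rmax_l _ _) HM)).
  specialize (H2 z Hz (Rle_trans _ _ _ (Rmax_r _ _) HM)).
  pose proof (Cmod_pos_Im z Hz) as P.
  replace (K1 * K2 / Cmod z ^ (n + m)) with (K1 / Cmod z ^ n * (K2 / Cmod z ^ m)).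
  - apply Rmult_le_compat; auto using Cmod_ge_0.
  - rewrite pow_add. field. split; apply pow_nonzero; lra.
Qed.

Lemma bigO_mult_id (n : nat) (F : C -> C) :
  bigO (S n) F -> bigO n (fun z => (F z * z)%C).
Proof.
  intros (M & K & H). exists M, K. intros z Hz HM.
  specialize (H z Hz HM). pose proof (Cmod_pos_Im z Hz) as Pz. rewrite Cmod_mult.
  replace (K / Cmod z ^ n) with (K / Cmod z ^ S n * Cmod z).
  - apply Rmult_le_compat_r; lra.
  - simpl. field. split; [apply pow_nonzero|]; lra.
Qed.

Lemma bigO_const (c : C) : bigO 0 (fun _ => c).
Proof.
  exists 1, (Cmod c). intros z _ _. simpl. unfold Rdiv. rewrite Rinv_1. lra.
Qed.

Lemma bigO_scal (c : C) (n : nat) (F : C -> C) :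
  bigO n F -> bigO n (fun z => (c * F z)%C).
Proof. intros H. exact (bigO_mult 0 n _ _ (bigO_const c) H). Qed.

Lemma bigO_inv_id : bigO 1 (fun z => (/ z)%C).
Proof.
  exists 1, 1. intros z Hz _.
  rewrite Cmod_inv by (apply upper_ne_0; auto). simpl. rewrite Rmult_1_r. unfold Rdiv. lra.
Qed.

Lemma bigO_ext (n : nat) (F G : C -> C) :
  (forall z, upper_half_plane z -> F z = G z) -> bigO n F -> bigO n G.
Proof.
  intros E (M & K & H). exists M, K. intros z Hz HM.
  rewrite <- E by auto. auto.
Qed.

Lemma bigO_weaken (n m : nat) (F : C -> C) : (m <= n)%nat -> bigO n F -> bigO m F.
Proof.
  intros Hnm (M & K & H). exists (Rmax M 1), (Rmax K 0). intros z Hz HM. specialize (H z Hz (Rle_trans _ _ _ (Rmax_l _ _) HM)).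
  assert (H1 : 1 <= Cmod z) by (eapply Rle_trans; [apply Rmax_r|exact HM]).
  eapply Rle_trans; [exact H|]. unfold Rdiv.
  assert (P1 : 0 < Cmod z ^ m) by (apply pow_lt; lra).
  assert (P2 : 0 < Cmod z ^ n) by (apply pow_lt; lra).
  apply Rle_trans with (Rmax K 0 * / Cmod z ^ n).
  - apply Rmult_le_compat_r; [apply Rlt_le, Rinv_0_lt_compat; auto|apply Rmax_l].
  - apply Rmult_le_compat_l; [apply Rmax_r|].
    apply Rinv_le_contravar; auto. apply Rle_pow; auto.
Qed.

Lemma bigO_opp (n : nat) (F : C -> C) : bigO n F -> bigO n (fun z => (- F z)%C).
Proof.
  intros (M & K & H). exists M, K. intros z Hz HM.
  rewrite Cmod_opp. auto.
Qed.

Lemma bigO_minus (n : nat) (F G : C -> C) :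
  bigO n F -> bigO n G -> bigO n (fun z => (F z - G z)%C).
Proof. intros HF HG. apply bigO_plus; auto. apply bigO_opp; auto. Qed.

Lemma bigO_small (n : nat) (F : C -> C) (e : R) : 0 < e -> bigO (S n) F ->
  exists M, forall z, upper_half_plane z -> M <= Cmod z -> Cmod (F z) < e.
Proof.
  intros He H. apply (bigO_weaken _ 1) in H; [|lia]. destruct H as (M & K & H).
  exists (Rmax M (Rabs K / e + 1)). intros z Hz HM. specialize (H z Hz (Rle_trans _ _ _ (Rmax_l _ _) HM)).
  assert (H1 : Rabs K / e + 1 <= Cmod z) by (eapply Rle_trans; [apply Rmax_r|exact HM]).
  pose proof (Cmod_pos_Im z Hz) as Pz. simpl in H. rewrite Rmult_1_r in H.
  eapply Rle_lt_trans; [exact H|]. apply Rmult_lt_reg_r with (Cmod z); auto.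
  unfold Rdiv. rewrite Rmult_assoc, Rinv_l, Rmult_1_r by lra.
  pose proof (Rle_abs K).
  assert (e * (Rabs K / e + 1) <= e * Cmod z) by (apply Rmult_le_compat_l; lra).
  replace (e * (Rabs K / e + 1)) with (Rabs K + e) in H2 by (field; lra). lra.
Qed.

Lemma bigO_eq_0 (c : C) : bigO 2 (fun z => (c * / z)%C) -> c = 0.
Proof.
  intros H. apply bigO_mult_id in H. apply NNPP. intros N.
  apply Cmod_gt_0 in N. destruct (bigO_small 0 _ _ N H) as [M K].
  set (y := Rmax M 1). generalize (Rmax_l M 1) (Rmax_r M 1). fold y. intros L1 L2.
  assert (Hz : upper_half_plane (0, y)) by (unfold upper_half_plane, Im; simpl; lra).
  specialize (K (0, y) Hz). pose proof (upper_ne_0 _ Hz) as Nz.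
  replace (c * / (0, y) * (0, y))%C with c in K by (field; auto).
  apply (Rlt_irrefl (Cmod c)), K.
  pose proof (im_le_Cmod (0, y)) as L. change (Im (0, y)) with y in L.
  rewrite Rabs_right in L; lra.
Qed.

Lemma bigO_inv_near_id (F : C -> C) :
  (exists M, forall z, upper_half_plane z -> M <= Cmod z ->
     Cmod (F z - z) <= Cmod z / 2) -> bigO 1 (fun z => (/ F z)%C).
Proof.
  intros [M H]. exists M, 2. intros z Hz HM. specialize (H z Hz HM).
  pose proof (Cmod_pos_Im z Hz) as Pz.
  assert (L : Cmod z / 2 <= Cmod (F z)).
  { pose proof (Cmod_sub_ge z (F z)) as K. rewrite Cmod_sub_sym in K. lra. }
  assert (N : F z <> 0) by (apply Cmod_gt_0; lra).
  rewrite Cmod_inv by auto. simpl. rewrite Rmult_1_r.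
  replace (2 / Cmod z) with (/ (Cmod z / 2)) by (field; lra).
  apply Rinv_le_contravar; lra.
Qed.

(** The segment from 1 to [1 + x] starts on the boundary of the half-plane, so the right half-plane
    branch is used. Along it the Taylor remainder has derivative [- x (s x)^3 / (1 + s x)], of
    modulus at most [2 |x|^4]; applying the mean value theorem to real and imaginary parts
    separately doubles this. *)
Lemma clog_one_plus (x : C) : upper_half_plane (1 + x) -> Cmod x <= 1 / 2 ->
  Cmod (clog (1 + x) - (x - x * x / 2 + x * x * x / 3)) <= 4 * Cmod x ^ 4.
Proof.
  intros Hx Hm.
  assert (Hre : forall s, Rabs s <= 3 / 2 -> 0 < Re (1 + RtoC s * x)).
  { intros s Hs. rewrite Re_plus, Re_RtoC_mult. simpl.
    pose proof (re_le_Cmod x) as L.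
    assert (Rabs (s * Re x) <= 3 / 2 * (1 / 2)).
    { rewrite Rabs_mult. apply Rmult_le_compat; try apply Rabs_pos; lra. }
    apply Rabs_le_between in H. lra. }
  assert (H1 : 0 < Re (1 + x)).
  { replace x with (RtoC 1 * x)%C by ring. apply Hre. rewrite Rabs_R1. lra. }
  rewrite clog_eq_clogr by auto.
  set (T := fun w => (clogr (1 + w * x) - (w * x - w * x * (w * x) * / 2
               + w * x * (w * x) * (w * x) * / 3))%C).
  set (dT := fun s : R => (- x * (RtoC s * x * (RtoC s * x) * (RtoC s * x))
                * / (1 + RtoC s * x))%C).
  (* A parameter range beyond [0, 1] makes the derivatives two-sided at the end points;
     [|s x| <= 3 / 4] keeps [1 + s x] in the right half-plane. *)
  set (D := fun s => Rabs s <= 3 / 2).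
  assert (Hd : forall s, 0 <= s <= 1 -> cderiv_in (real_in D) T (RtoC s) (dT s)).
  { intros s Hs.
    assert (Ds : D s) by (unfold D; rewrite Rabs_right; lra).
    assert (N0 : (1 + RtoC s * x <> 0)%C) by (apply Cmod_gt_0, Cmod_pos_Re, Hre; auto).
    assert (Dx : cderiv_in (real_in D) (fun w => w * x)%C (RtoC s) x).
    { eapply cderiv_in_eq; [apply (cderiv_in_mult _ (fun w => w) (fun _ => x));
        [apply cderiv_in_id|apply cderiv_in_const]|ring]. }
    pose proof (cderiv_in_mult _ _ _ _ _ _ Dx Dx) as Dx2.
    pose proof (cderiv_in_mult _ _ _ _ _ _ Dx2 Dx) as Dx3.
    eapply cderiv_in_eq.
    - apply cderiv_in_minus.
      + apply (cderiv_in_comp _ (fun w => 0 < Re w) clogr (fun w => 1 + w * x)%C).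
        * intros w [W1 W2]. replace w with (RtoC (Re w)); [apply Hre; exact W2|].
          destruct w; unfold Im in W1; simpl in W1; subst; reflexivity.
        * apply cderiv_clogr. apply Hre. exact Ds.
        * apply cderiv_in_plus; [apply cderiv_in_const|exact Dx].
      + apply cderiv_in_plus; [apply cderiv_in_minus; [exact Dx|]|].
        * apply (cderiv_in_mult _ _ (fun _ => / 2)%C); [exact Dx2|apply cderiv_in_const].
        * apply (cderiv_in_mult _ _ (fun _ => / 3)%C); [exact Dx3|apply cderiv_in_const].
    - unfold dT. field. repeat split; auto;
        (intros E; apply RtoC_inj in E; lra). }
  assert (HdT : forall s, 0 <= s <= 1 -> Cmod (dT s) <= 2 * Cmod x ^ 4).
  { intros s Hs. unfold dT.
    assert (Ds : D s) by (unfold D; rewrite Rabs_right; lra).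
    assert (N0 : (1 + RtoC s * x <> 0)%C) by (apply Cmod_gt_0, Cmod_pos_Re, Hre; auto).
    rewrite Cmod_mult, Cmod_inv by auto. rewrite !Cmod_mult, Cmod_opp, Cmod_R.
    rewrite (Rabs_right s) by lra. pose proof (Cmod_ge_0 x) as Px.
    set (m := Cmod x) in *.
    assert (Hlow : 1 / 2 <= Cmod (1 + RtoC s * x)).
    { pose proof (Cmod_sub_ge 1 (- (RtoC s * x))) as K.
      rewrite Cmod_opp, Cmod_1, Cmod_mult, Cmod_R, (Rabs_right s) in K by lra. fold m in K.
      replace (1 - - (RtoC s * x))%C with (1 + RtoC s * x)%C in K by ring. nra. }
    assert (Hi : / Cmod (1 + RtoC s * x) <= 2).
    { replace 2 with (/ (1 / 2)) by field. apply Rinv_le_contravar; lra. }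
    assert (0 < / Cmod (1 + RtoC s * x)) by (apply Rinv_0_lt_compat; lra).
    assert (Hs3 : s * m * (s * m) * (s * m) <= m * m * m).
    { assert (0 <= s * m <= m) by nra. assert (0 <= s * m * (s * m) <= m * m) by nra. nra. }
    assert (0 <= s * m * (s * m) * (s * m)).
    { assert (0 <= s * m) by nra. apply Rmult_le_pos; [apply Rmult_le_pos|]; assumption. }
    replace (2 * m ^ 4) with (m * (m * m * m) * 2) by ring.
    apply Rmult_le_compat; try lra.
    - apply Rmult_le_pos; assumption.
    - apply Rmult_le_compat_l; assumption. }
  assert (Hder : forall s, 0 <= s <= 1 ->
    is_derive (fun s => Re (T (RtoC s))) s (Re (dT s)) /\
    is_derive (fun s => Im (T (RtoC s))) s (Im (dT s))).
  { intros s Hs. apply (is_derive_Re_Im T s (dT s) D); [|apply Hd; auto].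
    exists (mkposreal (1 / 2) ltac:(lra)). intros y Hy.
    rewrite ball_R in Hy. apply Rabs_def2 in Hy. cbn [pos] in Hy. unfold D. apply Rabs_le. lra. }
  assert (T0 : T (RtoC 0) = 0).
  { unfold T. replace (1 + RtoC 0 * x)%C with (RtoC 1) by ring.
    replace (clogr 1) with (RtoC 0); [ring|].
    unfold clogr. rewrite Cmod_1, ln_1. unfold Re, Im; simpl.
    unfold Rdiv. rewrite Rmult_0_l, atan_0. reflexivity. }
  destruct (MVT_cor2 (fun s => Re (T (RtoC s))) (fun s => Re (dT s)) 0 1) as [c1 [E1 C1]].
  { lra. } { intros s Hs. apply is_derive_Reals, Hder; auto. }
  destruct (MVT_cor2 (fun s => Im (T (RtoC s))) (fun s => Im (dT s)) 0 1) as [c2 [E2 C2]].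
  { lra. } { intros s Hs. apply is_derive_Reals, Hder; auto. }
  cbv beta in E1, E2. rewrite T0 in E1, E2.
  change (Re (RtoC 0)) with 0 in E1. change (Im (RtoC 0)) with 0 in E2.
  replace (clogr (1 + x) - (x - x * x / 2 + x * x * x / 3))%C with (T (RtoC 1)).
  2: { unfold T. replace (RtoC 1 * x)%C with x by ring. reflexivity. }
  eapply Rle_trans; [apply Cmod_le_Re_Im|].
  replace (Re (T (RtoC 1))) with (Re (dT c1)) by lra.
  replace (Im (T (RtoC 1))) with (Im (dT c2)) by lra.
  pose proof (re_le_Cmod (dT c1)). pose proof (im_le_Cmod (dT c2)).
  pose proof (HdT c1 ltac:(lra)). pose proof (HdT c2 ltac:(lra)). lra.
Qed.

(* Half-plane capacity of the slit with parameter [v], halved: the coefficient of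
   1/z in the expansion of [slit_map] is [- 2 * slit_time b v]. *)
Definition slit_time (b v : R) : R := b * v ^ 3 * (4 - 3 * b * v) / 24.

Lemma bigO_inv_near_minus_1 (F : C -> C) :
  bigO 1 (fun z => (F z + 1)%C) -> bigO 0 (fun z => (/ F z)%C).
Proof.
  intros H. destruct (bigO_small 0 _ (1 / 2) ltac:(lra) H) as [M K].
  exists M, 2. intros z Hz HM. specialize (K z Hz HM).
  assert (L : 1 / 2 <= Cmod (F z)).
  { pose proof (Cmod_sub_ge 1 (- F z)) as L. rewrite Cmod_1, Cmod_opp in L.
    replace (1 - - F z)%C with (F z + 1)%C in L by ring. lra. }
  assert (N : F z <> 0) by (apply Cmod_gt_0; lra).
  rewrite Cmod_inv by auto. simpl. unfold Rdiv. rewrite Rinv_1, Rmult_1_r.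
  replace 2 with (/ (1 / 2)) by field. apply Rinv_le_contravar; lra.
Qed.

Section Expansion.

Variables b v : R.
Hypothesis Hb : 0 < b.
Hypothesis Hv : 0 < v.
Hypothesis Hbv : b * v < 1.

Let Y := fun z => (/ slit_eta b v z)%C.
(** Coefficients in [- W = Y + a Y^2 + b' Y^3 + O(Y^4)]. Inversion gives [- 1 / W = eta - a - (b' -
    a^2) / eta + ...], so the shift in [slit_eta] cancels [a], and [- c] is the coefficient of
    1/z. *)
Let a := b * (v * v) / 2.
Let b' := b * (v * v * v) / 3.
Let c := b' - a * a.
Let er := fun z => (clog (1 - RtoC v * Y z) -
  (RtoC (- v) * Y z - RtoC (- v) * Y z * (RtoC (- v) * Y z) / 2
   + RtoC (- v) * Y z * (RtoC (- v) * Y z) * (RtoC (- v) * Y z) / 3))%C.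

Lemma bigO_slit_eta_inv : bigO 1 Y.
Proof.
  apply bigO_inv_near_id. exists (2 * a + 1).
  assert (0 < a) by (unfold a; apply Rdiv_lt_0_compat; [repeat apply Rmult_lt_0_compat; auto|lra]).
  intros z Hz HM. unfold slit_eta. fold a.
  replace (z + RtoC a - z)%C with (RtoC a) by ring. rewrite Cmod_R, Rabs_right; lra.
Qed.

Lemma bigO_slit_log_error : bigO 4 er.
Proof.
  set (x := fun z => (RtoC (- v) * Y z)%C).
  assert (Hx : bigO 1 x) by (apply bigO_scal, bigO_slit_eta_inv).
  assert (Hx4 : bigO 4 (fun z => RtoC 4 * (x z * (x z * (x z * x z))))%C).
  { apply bigO_scal.
    exact (bigO_mult 1 3 _ _ Hx (bigO_mult 1 2 _ _ Hx (bigO_mult 1 1 _ _ Hx Hx))). }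
  destruct (bigO_small 0 _ (1 / 2) ltac:(lra) Hx) as [M1 K1].
  destruct Hx4 as (M2 & K & K2).
  exists (Rmax M1 M2), K. intros z Hz HM.
  specialize (K1 z Hz (Rle_trans _ _ _ (Rmax_l _ _) HM)).
  specialize (K2 z Hz (Rle_trans _ _ _ (Rmax_r _ _) HM)).
  eapply Rle_trans; [|exact K2].
  assert (E1 : (1 - RtoC v * Y z = 1 + x z)%C) by (unfold x; rewrite RtoC_opp; ring).
  assert (U : upper_half_plane (1 + x z)).
  { rewrite <- E1. apply slit_mobius_upper; auto. }
  unfold er. rewrite E1. fold (x z).
  eapply Rle_trans; [apply clog_one_plus; [exact U|lra]|].
  rewrite !Cmod_mult, Cmod_R, Rabs_right by lra. right. ring.
Qed.

Lemma slit_W_expansion (z : C) :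
  slit_W b v z = (- (Y z + RtoC a * (Y z * Y z) + RtoC b' * (Y z * (Y z * Y z)))
                  + RtoC b * er z)%C.
Proof.
  unfold slit_W, er. fold (Y z). unfold a, b'.
  rewrite !RtoC_div, !RtoC_mult, !RtoC_minus, !RtoC_mult, !RtoC_opp by lra.
  field.
Qed.

(** It suffices that [- 1 - W (z - c / z)] has order -3: dividing by [W], where [W z] tends to -1,
    loses one order. That estimate is an exact identity once the logarithm is written as its cubic
    Taylor polynomial plus [er]. *)
Lemma slit_map_expansion :
  bigO 2 (fun z => slit_map b v z - (z - RtoC (2 * slit_time b v) * / z))%C.
Proof.
  assert (Ec : 2 * slit_time b v = c) by (unfold slit_time, c, a, b'; field).
  rewrite Ec.
  pose proof bigO_slit_eta_inv as HY. pose proof bigO_slit_log_error as He.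
  assert (HX : bigO 1 (fun z => / z)%C) by apply bigO_inv_id.
  assert (HYY : bigO 2 (fun z => Y z * Y z)%C) by exact (bigO_mult 1 1 _ _ HY HY).
  assert (HYYY : bigO 3 (fun z => Y z * (Y z * Y z))%C) by exact (bigO_mult 1 2 _ _ HY HYY).
  assert (HXYY : bigO 3 (fun z => / z * (Y z * Y z))%C) by exact (bigO_mult 1 2 _ _ HX HYY).
  assert (HXYYY : bigO 3 (fun z => / z * (Y z * (Y z * Y z)))%C).
  { apply (bigO_weaken 4); [lia|]. exact (bigO_mult 1 3 _ _ HX HYYY). }
  assert (HeX : bigO 3 (fun z => / z * er z)%C).
  { apply (bigO_weaken 5); [lia|]. exact (bigO_mult 1 4 _ _ HX He). }
  assert (Hez : bigO 3 (fun z => er z * z)%C) by exact (bigO_mult_id 3 _ He).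
  assert (Hz0 : forall z, upper_half_plane z -> z <> 0) by apply upper_ne_0.
  assert (He0 : forall z, upper_half_plane z -> (z + RtoC a <> 0)%C)
    by (intros z Hz; apply upper_ne_0, upper_shift; auto).
  assert (HN : bigO 3 (fun z => - (1) - slit_W b v z * (z - RtoC c * / z))%C).
  { apply (bigO_ext _ (fun z =>
      RtoC (- 2 * c * a) * (/ z * (Y z * Y z)) - RtoC (a * b') * (Y z * (Y z * Y z))
      - RtoC (c * b') * (/ z * (Y z * (Y z * Y z)))
      - RtoC b * (er z * z) + RtoC (c * b) * (/ z * er z))%C).
    - intros z Hz. rewrite slit_W_expansion.
      unfold Y, slit_eta. fold a. unfold c.
      set (e := er z). clearbody e.
      rewrite !RtoC_mult, !RtoC_minus, !RtoC_mult.
      field. split; auto.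
    - repeat (apply bigO_minus || apply bigO_plus); apply bigO_scal; assumption. }
  assert (HWz : bigO 1 (fun z => slit_W b v z * z + 1)%C).
  { apply (bigO_ext _ (fun z =>
      RtoC (a * b') * (Y z * (Y z * Y z)) - RtoC c * (Y z * Y z) + RtoC b * (er z * z))%C).
    - intros z Hz. rewrite slit_W_expansion.
      unfold Y, slit_eta. fold a. unfold c.
      set (e := er z). clearbody e.
      rewrite !RtoC_mult, !RtoC_minus, !RtoC_mult.
      field. auto.
    - apply bigO_plus; [apply bigO_minus|]; apply bigO_scal.
      + apply (bigO_weaken 3); [lia|assumption].
      + apply (bigO_weaken 2); [lia|assumption].
      + apply (bigO_weaken 3); [lia|assumption]. }
  apply bigO_inv_near_minus_1 in HWz. apply bigO_mult_id in HN.
  refine (bigO_ext _ _ _ _ (bigO_mult 2 0 _ _ HN HWz)).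
  intros z Hz. cbv beta. unfold slit_map.
  assert (slit_W b v z <> 0) by (apply upper_ne_0, slit_W_in; auto).
  field. split; auto.
Qed.

End Expansion.

(** * Identification of the given conformal map *)

Lemma holomorphic_H_of_rel (F : C -> C) :
  (forall z, upper_half_plane z -> exists l, cderiv_in upper_half_plane F z l) ->
  holomorphic_H F.
Proof.
  intros H z Hz. destruct (H z Hz) as [l Hl]. exists l.
  apply (cderiv_in_loc upper_half_plane F z l (Im z)); auto.
  intros w Hw. unfold upper_half_plane in *.
  pose proof (im_le_Cmod (w - z)) as L. apply Rabs_le_between in L.
  destruct w, z. unfold Im in *; simpl in *. lra.
Qed.

(** With [E = slit_map b v], the map [z |-> f (E z)] is an automorphism of the half-plane, with
    inverse [w |-> J (k w)], asymptotic to the identity and hence equal to it. Comparing the 1/z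
    terms of the two expansions then determines the time. *)
Lemma slit_map_identified (b v t : R) (f k : C -> C) :
  0 < b -> 0 < v -> b * v < 1 ->
  (forall z, slit_dom b (slit_tip b v) z -> exists l, cderiv_in everywhere f z l) ->
  (forall w, upper_half_plane w -> exists l, cderiv_in everywhere k w l) ->
  (forall z, slit_dom b (slit_tip b v) z -> upper_half_plane (f z) /\ k (f z) = z) ->
  (forall w, upper_half_plane w -> slit_dom b (slit_tip b v) (k w) /\ f (k w) = w) ->
  hydrodynamic_at_infinity (slit_dom b (slit_tip b v)) t f ->
  t = slit_time b v /\
  forall z, slit_dom b (slit_tip b v) z -> slit_W b v (f z) = (- / z)%C.
Proof.
  intros Hb Hv Hbv Df Dk Hf Hk Hhyd.
  destruct (slit_map_inverse b v Hb Hv Hbv) as [J [HJ1 HJ2]].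
  set (E := slit_map b v). set (D := slit_dom b (slit_tip b v)) in *.
  assert (HE : forall z, upper_half_plane z -> D (E z))
    by (intros z Hz; apply slit_map_in; auto).
  pose proof (slit_map_expansion b v Hb Hv Hbv) as Hexp. fold E in Hexp.
  set (c := 2 * slit_time b v) in *.
  assert (HX : bigO 1 (fun z => / z)%C) by apply bigO_inv_id.
  assert (HEz : bigO 1 (fun z => E z - z)%C).
  { apply (bigO_ext _ (fun z => (E z - (z - RtoC c * / z)) - RtoC c * / z)%C).
    - intros; ring.
    - apply bigO_minus; [apply (bigO_weaken 2); [lia|exact Hexp]|apply bigO_scal; exact HX]. }
  destruct (bigO_small 0 _ 1 ltac:(lra) HEz) as [M1 K1].
  assert (HEbig : exists M, forall z, upper_half_plane z -> M <= Cmod z ->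
    Cmod (E z - z) <= Cmod z / 2).
  { exists (Rmax M1 2). intros z Hz HM. generalize (Rmax_l M1 2) (Rmax_r M1 2). intros.
    specialize (K1 z Hz ltac:(lra)). lra. }
  pose proof (bigO_inv_near_id E HEbig) as HXE.
  (* The expansion of [f] is evaluated at [E z], whose modulus is at least half that of [z], so the
     error keeps order -2. *)
  assert (HfE : bigO 2 (fun z => f (E z) - (E z + RtoC (2 * t) / E z))%C).
  { destruct Hhyd as (M & K & PM & HM).
    assert (HXE2 : bigO 2 (fun z => RtoC K * (/ E z * / E z))%C)
      by (apply bigO_scal; exact (bigO_mult 1 1 _ _ HXE HXE)).
    destruct HXE2 as (M2 & K2 & H2).
    exists (Rmax M2 (Rmax M1 (M + 1))), K2. intros z Hz Hge.
    generalize (Rmax_l M2 (Rmax M1 (M + 1))) (Rmax_r M2 (Rmax M1 (M + 1)))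
      (Rmax_l M1 (M + 1)) (Rmax_r M1 (M + 1)). intros.
    specialize (H2 z Hz ltac:(lra)).
    specialize (K1 z Hz ltac:(lra)).
    pose proof (Cmod_sub_ge z (E z)) as L. rewrite Cmod_sub_sym in L.
    assert (N : E z <> 0) by (apply Cmod_gt_0; lra).
    eapply Rle_trans; [apply HM; [apply HE; auto|lra]|].
    eapply Rle_trans; [|exact H2]. rewrite !Cmod_mult, Cmod_R, Cmod_inv by auto.
    apply Rle_trans with (Rabs K / Cmod (E z) ^ 2).
    - unfold Rdiv. apply Rmult_le_compat_r; [|apply Rle_abs].
      apply Rlt_le, Rinv_0_lt_compat, pow_lt. lra.
    - right. field. lra. }
  assert (HtE : bigO 1 (fun z => RtoC (2 * t) / E z)%C) by (apply bigO_scal; exact HXE).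
  assert (Hid : forall z, upper_half_plane z -> f (E z) = z).
  { apply (automorphism_identity (fun z => f (E z)) (fun w => J (k w))).
    - apply holomorphic_H_of_rel. intros z Hz.
      destruct (cderiv_slit_map b v Hb Hv Hbv z Hz) as [l Hl].
      destruct (Df _ (HE z Hz)) as [m Hm]. exists (m * l)%C.
      apply (cderiv_in_comp _ everywhere f E); auto. intros; exact I.
    - apply holomorphic_H_of_rel. intros w Hw.
      destruct (Hk w Hw) as [Kw _].
      destruct (HJ1 _ Kw) as [_ [_ [l Hl]]]. destruct (Dk w Hw) as [m Hm].
      exists (l * m)%C. apply (cderiv_in_comp _ D J k).
      + intros w' Hw'. apply Hk. exact Hw'.
      + exact Hl.
      + apply cderiv_in_sub with everywhere; [intros; exact I|exact Hm].
    - intros w Hw. destruct (Hk w Hw) as [Kw Ew]. destruct (HJ1 _ Kw) as [U [EJ _]].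
      split; [exact U|]. unfold E. rewrite EJ. exact Ew.
    - intros z Hz. destruct (Hf _ (HE z Hz)) as [U Ek]. split; [exact U|].
      rewrite Ek. apply HJ2. exact Hz.
    - assert (Hphi : bigO 1 (fun z => f (E z) - z)%C).
      { apply (bigO_ext _ (fun z => (f (E z) - (E z + RtoC (2 * t) / E z))
           + RtoC (2 * t) / E z + (E z - z))%C).
        - intros; ring.
        - apply bigO_plus; [apply bigO_plus|]; auto.
          apply (bigO_weaken 2); [lia|exact HfE]. }
      intros e He. destruct (bigO_small 0 _ e He Hphi) as [M H].
      exists M. intros z Hz HM. apply H; auto. lra. }
  split.
  (* Adding the expansions of [f] at [E z] and of [E] at [z], and replacing [2 t / E z] by [2 t / z]
     up to order -3, leaves [(c - 2 t) / z]. *)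
  - assert (H0 : bigO 2 (fun z => RtoC (c - 2 * t) * / z)%C).
    { assert (HXX : bigO 2 (fun z => RtoC (2 * t) * ((E z - z) * (/ z * / E z)))%C).
      { apply (bigO_weaken 3); [lia|]. apply bigO_scal.
        exact (bigO_mult 1 2 _ _ HEz (bigO_mult 1 1 _ _ HX HXE)). }
      refine (bigO_ext _ _ _ _ (bigO_minus 2 _ _ (bigO_plus 2 _ _ HfE Hexp) HXX)).
      intros z Hz. cbv beta. rewrite Hid by auto.
      assert (z <> 0) by (apply upper_ne_0; auto).
      assert (E z <> 0) by (apply upper_ne_0, HE; auto).
      rewrite !RtoC_minus. field. auto. }
    apply bigO_eq_0 in H0. apply RtoC_inj in H0. unfold c in H0. lra.
  - intros z Hz. destruct (HJ1 z Hz) as [U [EJ _]].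
    rewrite <- EJ at 1. fold E. rewrite Hid by auto.
    rewrite <- (slit_map_inv b v Hb Hv Hbv) by auto. rewrite EJ. reflexivity.
Qed.

(** * Inverting the capacity function *)

Lemma is_pseries_add (a b : nat -> R) (x la lb : R) :
  is_pseries a x la -> is_pseries b x lb -> is_pseries (fun n => a n + b n) x (la + lb).
Proof. exact (is_pseries_plus (K := R_AbsRing) (V := R_NormedModule) a b x la lb). Qed.

Lemma is_pseries_smul (c : R) (a : nat -> R) (x l : R) :
  is_pseries a x l -> is_pseries (fun n => c * a n) x (c * l).
Proof.
  apply (is_pseries_scal (K := R_AbsRing) (V := R_NormedModule) c a x l).
  unfold mult; simpl. ring.
Qed.

Definition monomial (m : nat) (c : R) (n : nat) : R := if Nat.eqb n m then c else 0.

Lemma sum_monomial (m N : nat) (c x : R) : (m <= N)%nat ->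
  sum_f_R0 (fun n => monomial m c n * x ^ n) N = c * x ^ m.
Proof.
  assert (Z : forall n, n <> m -> monomial m c n * x ^ n = 0).
  { intros n Hn. unfold monomial. destruct (Nat.eqb_spec n m); [contradiction|ring]. }
  assert (B : forall N, (N < m)%nat -> sum_f_R0 (fun n => monomial m c n * x ^ n) N = 0).
  { induction N0; intros H.
    - exact (Z 0%nat ltac:(lia)).
    - rewrite tech5, IHN0 by lia. rewrite (Z (S N0)) by lia. ring. }
  induction N; intros H.
  - assert (m = 0%nat) by lia. subst. reflexivity.
  - rewrite tech5. destruct (Nat.eq_dec m (S N)) as [E|E].
    + rewrite B by lia. unfold monomial. rewrite E, Nat.eqb_refl. ring.
    + rewrite IHN by lia. rewrite (Z (S N)) by lia. ring.
Qed.

Lemma is_pseries_monomial (m : nat) (c x : R) : is_pseries (monomial m c) x (c * x ^ m).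
Proof.
  apply is_pseries_R. apply (filterlim_ext_loc (fun _ => c * x ^ m)).
  - exists m. intros n Hn. symmetry. rewrite sum_n_Reals. apply sum_monomial. exact Hn.
  - apply filterlim_const.
Qed.

Definition abs_psum (r : R) (a : nat -> R) (N : nat) : R :=
  sum_f_R0 (fun k => Rabs (a k) * r ^ k) N.

(** The truncated Cauchy product collects only part of the products on the right-hand side, and the
    omitted ones are nonnegative. *)
Lemma abs_psum_mult (r : R) (a b : nat -> R) (N : nat) : 0 <= r ->
  abs_psum r (PS_mult a b) N <= abs_psum r a N * abs_psum r b N.
Proof.
  intros Hr. unfold abs_psum.
  set (A := fun k => Rabs (a k) * r ^ k). set (B := fun k => Rabs (b k) * r ^ k).
  assert (PA : forall k, 0 <= A k)
    by (intros; apply Rmult_le_pos; [apply Rabs_pos|apply pow_le; auto]).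
  assert (PB : forall k, 0 <= B k)
    by (intros; apply Rmult_le_pos; [apply Rabs_pos|apply pow_le; auto]).
  assert (H : sum_f_R0 (fun k => Rabs (PS_mult a b k) * r ^ k) N <=
    sum_f_R0 (fun k => sum_f_R0 (fun p => A p * B (k - p)%nat) k) N).
  { apply sum_Rle. intros n _. unfold PS_mult.
    eapply Rle_trans; [apply Rmult_le_compat_r; [apply pow_le; auto|apply Rsum_abs]|].
    rewrite Rmult_comm, scal_sum. apply sum_Rle. intros k Hk. unfold A, B.
    right. rewrite Rabs_mult.
    replace (r ^ n) with (r ^ k * r ^ (n - k)) by (rewrite <- pow_add; f_equal; lia). ring. }
  eapply Rle_trans; [exact H|].
  destruct N as [|N].
  - simpl. lra.
  - rewrite (cauchy_finite A B (S N)) by lia.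
    assert (0 <= sum_f_R0 (fun k => sum_f_R0 (fun l => A (S (l + k)) * B (S N - l)%nat)
      (Init.Nat.pred (S N - k))) (Init.Nat.pred (S N))); [|lra].
    apply cond_pos_sum. intros k. apply cond_pos_sum. intros l. apply Rmult_le_pos; auto.
Qed.

Lemma abs_psum_pos (r : R) (a : nat -> R) (N : nat) : 0 <= r -> 0 <= abs_psum r a N.
Proof.
  intros Hr. apply cond_pos_sum. intros k.
  apply Rmult_le_pos; [apply Rabs_pos|apply pow_le; auto].
Qed.

Lemma abs_psum_radius (r e x : R) (a : nat -> R) : 0 < r ->
  (forall N, abs_psum r a N <= e) -> Rabs x < r -> Rbar_lt (Rabs x) (CV_radius a).
Proof.
  intros Hr H Hx. apply Rbar_lt_le_trans with (Finite r); [exact Hx|].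
  apply (CV_radius_bounded a). exists e. intros n.
  eapply Rle_trans; [|exact (H n)].
  rewrite Rabs_mult, (Rabs_right (r ^ n)) by (apply Rle_ge, pow_le; lra).
  unfold abs_psum. destruct n as [|n]; [simpl; lra|]. rewrite tech5.
  assert (0 <= abs_psum r a n) by (apply abs_psum_pos; lra). unfold abs_psum in *. lra.
Qed.

Lemma abs_psum_value (r e x y : R) (a : nat -> R) : 0 < r ->
  (forall N, abs_psum r a N <= e) -> Rabs x < r -> is_pseries a x y -> Rabs y <= e.
Proof.
  intros Hr H Hx Hy. apply is_pseries_R in Hy.
  assert (Hb : forall N, Rabs (sum_n (fun n => a n * x ^ n) N) <= e).
  { intros N. eapply Rle_trans; [|exact (H N)]. rewrite sum_n_Reals.
    eapply Rle_trans; [apply Rsum_abs|]. apply sum_Rle. intros n _.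
    rewrite Rabs_mult, <- RPow_abs. apply Rmult_le_compat_l; [apply Rabs_pos|].
    apply pow_incr. split; [apply Rabs_pos|lra]. }
  assert (L : is_lim_seq (sum_n (fun n => a n * x ^ n)) y) by exact Hy.
  apply Rabs_le. split.
  - refine (is_lim_seq_le (fun _ => - e) _ (- e) y _ (is_lim_seq_const _) L).
    intros N. specialize (Hb N). apply Rabs_le_between in Hb. lra.
  - refine (is_lim_seq_le _ (fun _ => e) y e _ L (is_lim_seq_const _)).
    intros N. specialize (Hb N). apply Rabs_le_between in Hb. lra.
Qed.

Section QuarticBranch.

Variables c1 c2 c3 c4 : R.

(** Right-hand side of the fixed-point equation [y = c1 x + c2 y^2 + c3 y^3 + c4 y^4], read on
    coefficient sequences. *)
Definition quartic_step (a : nat -> R) (n : nat) : R :=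
  monomial 1 c1 n + (c2 * PS_mult a a n + (c3 * PS_mult a (PS_mult a a) n
    + c4 * PS_mult a (PS_mult a (PS_mult a a)) n)).

Fixpoint quartic_iter (j : nat) : nat -> R :=
  match j with
  | O => fun _ => 0
  | S j => quartic_step (quartic_iter j)
  end.

(** Diagonal of the iteration: the coefficient of index [n] no longer changes from iterate [n]
    on. *)
Definition quartic_coef (n : nat) : R := quartic_iter n n.

(** Vanishing constant terms gain one index: coefficient [n + 1] of the product involves only
    coefficients of index at most [n]. Hence each iteration settles one more coefficient. *)
Lemma PS_mult_agree (a a' b b' : nat -> R) (n : nat) :
  a 0%nat = 0 -> b 0%nat = 0 -> a' 0%nat = 0 -> b' 0%nat = 0 ->
  (forall k, (k <= n)%nat -> a k = a' k) -> (forall k, (k <= n)%nat -> b k = b' k) ->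
  forall k, (k <= S n)%nat -> PS_mult a b k = PS_mult a' b' k.
Proof.
  intros Ha Hb Ha' Hb' Ea Eb k Hk. unfold PS_mult. apply sum_eq. intros i Hi.
  destruct (Nat.eq_dec i 0) as [->|N0]; [rewrite Ha, Ha'; ring|].
  destruct (Nat.eq_dec i k) as [->|N1].
  { rewrite Nat.sub_diag, Hb, Hb'. ring. }
  rewrite Ea, Eb by lia. reflexivity.
Qed.

Lemma PS_mult_0 (a b : nat -> R) : a 0%nat = 0 -> PS_mult a b 0%nat = 0.
Proof. intros H. unfold PS_mult. simpl. rewrite H. ring. Qed.

Lemma quartic_step_agree (a a' : nat -> R) (n : nat) :
  a 0%nat = 0 -> a' 0%nat = 0 -> (forall k, (k <= n)%nat -> a k = a' k) ->
  forall k, (k <= S n)%nat -> quartic_step a k = quartic_step a' k.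
Proof.
  intros Ha Ha' E k Hk. unfold quartic_step.
  assert (E2 : forall k, (k <= S n)%nat -> PS_mult a a k = PS_mult a' a' k)
    by (apply PS_mult_agree; auto).
  assert (E3 : forall k, (k <= S n)%nat ->
    PS_mult a (PS_mult a a) k = PS_mult a' (PS_mult a' a') k)
    by (apply PS_mult_agree; auto using PS_mult_0).
  assert (E4 : forall k, (k <= S n)%nat -> PS_mult a (PS_mult a (PS_mult a a)) k
     = PS_mult a' (PS_mult a' (PS_mult a' a')) k)
    by (apply PS_mult_agree; auto using PS_mult_0).
  rewrite E2, E3, E4 by auto. reflexivity.
Qed.

Lemma quartic_iter_0 (j : nat) : quartic_iter j 0%nat = 0.
Proof.
  induction j; simpl; auto. unfold quartic_step. rewrite !PS_mult_0 by auto.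
  unfold monomial. simpl. ring.
Qed.

Lemma quartic_iter_stable (j k i : nat) : (k <= j)%nat ->
  quartic_iter (j + i) k = quartic_iter j k.
Proof.
  assert (H : forall j k, (k <= j)%nat -> quartic_iter (S j) k = quartic_iter j k).
  { clear j k. induction j; intros k Hk.
    - assert (k = 0%nat) by lia. subst. rewrite !quartic_iter_0. reflexivity.
    - change (quartic_iter (S (S j))) with (quartic_step (quartic_iter (S j))).
      change (quartic_iter (S j) k) with (quartic_step (quartic_iter j) k).
      apply (quartic_step_agree _ _ j); auto using quartic_iter_0. }
  intros Hk. induction i.
  - rewrite Nat.add_0_r. reflexivity.
  - rewrite Nat.add_succ_r, H by lia. exact IHi.
Qed.

Lemma quartic_coef_iter (j k : nat) : (k <= j)%nat -> quartic_coef k = quartic_iter j k.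
Proof.
  intros H. unfold quartic_coef. replace j with (k + (j - k))%nat by lia.
  symmetry. apply quartic_iter_stable. lia.
Qed.

Lemma quartic_coef_fixed (n : nat) : quartic_coef n = quartic_step quartic_coef n.
Proof.
  rewrite (quartic_step_agree quartic_coef (quartic_iter n) n); auto.
  - rewrite (quartic_coef_iter (S n)) by lia. reflexivity.
  - apply quartic_iter_0.
  - intros k Hk. apply quartic_coef_iter. exact Hk.
Qed.

(** The hypothesis makes the step map the ball of radius [e] of the l^1 norm with weights [r ^ k]
    into itself. *)
Lemma quartic_iter_bound (r e : R) : 0 <= r -> 0 <= e ->
  Rabs c1 * r + (Rabs c2 * (e * e) + (Rabs c3 * (e * (e * e))
     + Rabs c4 * (e * (e * (e * e))))) <= e ->
  forall j N, abs_psum r (quartic_iter j) N <= e.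
Proof.
  intros Hr He H. induction j; intros N.
  - unfold abs_psum. simpl. rewrite (sum_eq _ (fun _ => 0)).
    + rewrite sum_cte. lra.
    + intros i _. rewrite Rabs_R0. ring.
  - set (a := quartic_iter j) in *.
    assert (P : forall b, 0 <= abs_psum r b N) by (intros; apply abs_psum_pos; auto).
    assert (B2 : abs_psum r (PS_mult a a) N <= e * e).
    { eapply Rle_trans; [apply abs_psum_mult; auto|]. apply Rmult_le_compat; auto. }
    assert (B3 : abs_psum r (PS_mult a (PS_mult a a)) N <= e * (e * e)).
    { eapply Rle_trans; [apply abs_psum_mult; auto|]. apply Rmult_le_compat; auto. }
    assert (B4 : abs_psum r (PS_mult a (PS_mult a (PS_mult a a))) N <= e * (e * (e * e))).
    { eapply Rle_trans; [apply abs_psum_mult; auto|]. apply Rmult_le_compat; auto. }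
    assert (B1 : abs_psum r (monomial 1 c1) N <= Rabs c1 * r).
    { unfold abs_psum.
      rewrite (sum_eq _ (fun n => monomial 1 (Rabs c1) n * r ^ n)).
      - destruct N as [|N].
        + unfold monomial. simpl. rewrite Rmult_0_l. apply Rmult_le_pos; [apply Rabs_pos|auto].
        + rewrite sum_monomial by lia. lra.
      - intros i _. unfold monomial. destruct (Nat.eqb i 1); auto. rewrite Rabs_R0. auto. }
    assert (S : forall x y, abs_psum r (fun n => x n + y n) N <= abs_psum r x N + abs_psum r y N).
    { intros x y. unfold abs_psum. rewrite <- sum_plus. apply sum_Rle. intros n _.
      rewrite <- Rmult_plus_distr_r. apply Rmult_le_compat_r; [apply pow_le; auto|].
      apply Rabs_triang. }
    assert (Q : forall c x, abs_psum r (fun n => c * x n) N = Rabs c * abs_psum r x N).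
    { intros c x. unfold abs_psum. rewrite scal_sum. apply sum_eq. intros n _.
      rewrite Rabs_mult. ring. }
    simpl quartic_iter. fold a. unfold quartic_step.
    eapply Rle_trans; [|exact H].
    eapply Rle_trans; [apply (S (monomial 1 c1))|]. apply Rplus_le_compat; [exact B1|].
    eapply Rle_trans; [apply (S (fun n => c2 * PS_mult a a n))|].
    apply Rplus_le_compat; [rewrite Q; apply Rmult_le_compat_l; [apply Rabs_pos|auto]|].
    eapply Rle_trans; [apply (S (fun n => c3 * PS_mult a (PS_mult a a) n))|].
    apply Rplus_le_compat; rewrite Q; apply Rmult_le_compat_l; auto using Rabs_pos.
Qed.

(* The power series solving y = c1 x + c2 y^2 + c3 y^3 + c4 y^4 is the formal
   limit of the iteration started at 0; bounds on the l^1 norms of the iterates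
   with weights r^k pass to the limit. *)
Lemma quartic_branch (e : R) : 0 < e ->
  exists r, 0 < r /\ forall x, Rabs x < r -> exists y, Rabs y <= e /\
    y = c1 * x + (c2 * (y * y) + (c3 * (y * (y * y)) + c4 * (y * (y * (y * y))))) /\
    is_pseries quartic_coef x y /\
    is_pseries (PS_mult quartic_coef quartic_coef) x (y * y).
Proof.
  intros He.
  set (K := Rabs c2 + Rabs c3 + Rabs c4).
  pose proof (Rabs_pos c1) as Q1. pose proof (Rabs_pos c2) as Q2.
  pose proof (Rabs_pos c3) as Q3. pose proof (Rabs_pos c4) as Q4.
  assert (HK : 0 <= K) by (unfold K; lra).
  (* [K d <= 1 / 2] and [d <= 1] bound the nonlinear terms by [d / 2]; [r] is then chosen so that
     the linear term takes at most the other half. *)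
  destruct (pos_min3 e 1 (1 / (2 * K + 1))) as (d & d0 & d1 & d2 & d3);
    [lra|lra|apply Rdiv_lt_0_compat; lra|].
  assert (d4 : K * d <= 1 / 2).
  { assert (d * (2 * K + 1) <= 1).
    { apply Rle_trans with (1 / (2 * K + 1) * (2 * K + 1)).
      - apply Rmult_le_compat_r; lra.
      - right. field. lra. }
    nra. }
  set (r := d / (2 * (Rabs c1 + 1))).
  assert (Hr : 0 < r) by (unfold r; apply Rdiv_lt_0_compat; lra).
  assert (Hr1 : Rabs c1 * r <= d / 2).
  { replace (d / 2) with ((Rabs c1 + 1) * r) by (unfold r; field; lra).
    apply Rmult_le_compat_r; lra. }
  assert (Hfix : Rabs c1 * r + (Rabs c2 * (d * d) + (Rabs c3 * (d * (d * d))
     + Rabs c4 * (d * (d * (d * d))))) <= d).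
  { assert (d * (d * d) <= d * d) by nra.
    assert (d * (d * (d * d)) <= d * d) by nra.
    assert (Rabs c3 * (d * (d * d)) <= Rabs c3 * (d * d)) by (apply Rmult_le_compat_l; auto).
    assert (Rabs c4 * (d * (d * (d * d))) <= Rabs c4 * (d * d)) by (apply Rmult_le_compat_l; auto).
    assert (K * (d * d) <= d / 2) by nra. unfold K in *. lra. }
  set (a := quartic_coef).
  assert (Ba : forall N, abs_psum r a N <= d).
  { intros N. apply Rle_trans with (abs_psum r (quartic_iter N) N).
    - right. apply sum_eq. intros k Hk. unfold a.
      rewrite (quartic_coef_iter N) by auto. reflexivity.
    - apply (quartic_iter_bound r d); lra. }
  (* Uniform bounds for the products place [x] inside their radii of convergence, so that the series
     can be multiplied. *)
  assert (Bm : forall x y, (forall N, abs_psum r x N <= d) -> (forall N, abs_psum r y N <= 1) ->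
    forall N, abs_psum r (PS_mult x y) N <= 1).
  { intros x y Hx Hy N. eapply Rle_trans; [apply abs_psum_mult; lra|].
    replace 1 with (1 * 1) by ring. apply Rmult_le_compat; try apply abs_psum_pos; try lra; auto.
    eapply Rle_trans; [apply Hx|auto]. }
  assert (Ba1 : forall N, abs_psum r a N <= 1) by (intros N; eapply Rle_trans; [apply Ba|auto]).
  assert (B2 := Bm a a Ba Ba1). assert (B3 := Bm a _ Ba B2).
  exists r. split; [exact Hr|]. intros x Hx.
  pose proof (abs_psum_radius r d x a Hr Ba Hx) as R1.
  pose proof (abs_psum_radius r 1 x _ Hr B2 Hx) as R2.
  pose proof (abs_psum_radius r 1 x _ Hr B3 Hx) as R3.
  pose proof (PSeries_correct a x (CV_radius_inside a x R1)) as Hy.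
  set (y := PSeries a x) in *. exists y.
  assert (H2 := is_pseries_mult a a x y y Hy Hy R1 R1).
  assert (H3 := is_pseries_mult a _ x y _ Hy H2 R1 R2).
  assert (H4 := is_pseries_mult a _ x y _ Hy H3 R1 R3).
  split; [|split; [|split; auto]].
  - eapply Rle_trans; [apply (abs_psum_value r d x y a); auto|auto].
  - assert (Hs : is_pseries a x
      (c1 * x + (c2 * (y * y) + (c3 * (y * (y * y)) + c4 * (y * (y * (y * y))))))).
    { apply is_pseries_R.
      apply (is_series_ext (fun n => quartic_step a n * x ^ n)).
      - intros n. f_equal. symmetry. apply quartic_coef_fixed.
      - apply (is_pseries_R (quartic_step a) x). unfold quartic_step.
        apply (is_pseries_add (monomial 1 c1)).
        { rewrite <- (pow_1 x) at 2. apply is_pseries_monomial. }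
        apply (is_pseries_add (fun n => c2 * PS_mult a a n)); [apply is_pseries_smul; auto|].
        apply (is_pseries_add (fun n => c3 * PS_mult a (PS_mult a a) n));
          apply is_pseries_smul; auto. }
    unfold y at 1. exact (is_pseries_unique _ _ _ Hs).
Qed.

End QuarticBranch.

(** The derivative [b x^2 (1 - b x) / 2] of [slit_time] is at least [b (1 - b V) x^2 / 2] on [0, V];
    integration together with [x^3 - y^3 >= (x - y)^3] explains the constant. The proof is an
    algebraic version of this. *)
Lemma slit_time_gap (b V x y : R) :
  0 < b -> b * V < 1 -> 0 <= y -> y <= x -> x <= V ->
  b * (1 - b * V) / 6 * (x - y) ^ 3 <= slit_time b x - slit_time b y.
Proof.
  intros Hb HV Hy Hxy HxV. unfold slit_time.
  (* This polynomial is [4 x (x^3 - y^3) - 3 (x^4 - y^4)], what remains when [x] replaces [V] in the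
     comparison of the cubic and quartic terms. *)
  assert (P1 : 0 <= (x - y) ^ 2 * (x ^ 2 + 2 * x * y + 3 * y ^ 2)).
  { apply Rmult_le_pos; [apply pow2_ge_0|]. nra. }
  assert (P2 : 0 <= (V - x) * (x ^ 3 - y ^ 3)).
  { apply Rmult_le_pos; [lra|].
    replace (x ^ 3 - y ^ 3) with ((x - y) * (x ^ 2 + x * y + y ^ 2)) by ring.
    apply Rmult_le_pos; [lra|nra]. }
  assert (P3 : 0 <= (1 - b * V) * (x ^ 3 - y ^ 3 - (x - y) ^ 3)).
  { apply Rmult_le_pos; [lra|].
    replace (x ^ 3 - y ^ 3 - (x - y) ^ 3) with (3 * (x * y) * (x - y)) by ring.
    apply Rmult_le_pos; [apply Rmult_le_pos; [lra|apply Rmult_le_pos; lra]|lra]. }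
  assert (P4 : 0 <= b * (b * ((x - y) ^ 2 * (x ^ 2 + 2 * x * y + 3 * y ^ 2)
       + 4 * ((V - x) * (x ^ 3 - y ^ 3))))) by (repeat apply Rmult_le_pos; lra).
  assert (P5 : 0 <= b * ((1 - b * V) * (x ^ 3 - y ^ 3 - (x - y) ^ 3)))
    by (apply Rmult_le_pos; lra).
  apply Rminus_le_0.
  replace (b * x ^ 3 * (4 - 3 * b * x) / 24 - b * y ^ 3 * (4 - 3 * b * y) / 24 -
     b * (1 - b * V) / 6 * (x - y) ^ 3)
    with ((b * (b * ((x - y) ^ 2 * (x ^ 2 + 2 * x * y + 3 * y ^ 2)
       + 4 * ((V - x) * (x ^ 3 - y ^ 3))))
      + 4 * (b * ((1 - b * V) * (x ^ 3 - y ^ 3 - (x - y) ^ 3)))) / 24) by field.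
  lra.
Qed.

Lemma slit_time_lt (b x y : R) :
  0 < b -> b * x < 1 -> 0 <= y -> y < x -> slit_time b y < slit_time b x.
Proof.
  intros Hb Hx Hy Hxy.
  pose proof (slit_time_gap b x x y Hb Hx Hy ltac:(lra) ltac:(lra)) as G.
  assert (0 < b * (1 - b * x) / 6 * (x - y) ^ 3).
  { apply Rmult_lt_0_compat; [|apply pow_lt; lra].
    apply Rdiv_lt_0_compat; [apply Rmult_lt_0_compat; lra|lra]. }
  lra.
Qed.

Lemma cube_root_bound (d K x : R) :
  0 <= d -> 0 < x -> 0 < K -> d ^ 3 <= K * x -> d <= Rpower K (1 / 3) * Rpower x (1 / 3).
Proof.
  intros Hd Hx HK H. rewrite Rpower_mult_distr by auto.
  set (q := Rpower (K * x) (1 / 3)).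
  assert (Hq : 0 < q) by apply exp_pos.
  assert (Hq3 : q ^ 3 = K * x).
  { rewrite <- Rpower_pow by auto. unfold q. rewrite Rpower_mult.
    replace (1 / 3 * INR 3) with 1 by (simpl; field). apply Rpower_1.
    apply Rmult_lt_0_compat; auto. }
  apply Rnot_lt_le. intros L. rewrite <- Hq3 in H.
  assert (q ^ 3 < d ^ 3); [|lra]. simpl. rewrite !Rmult_1_r.
  assert (q * q < d * d) by nra. nra.
Qed.

Section InverseTime.

Variables b T : R.
Variable v : R -> R.
Hypothesis Hb : 0 < b.
Hypothesis HT : 0 < T.
Hypothesis Hv : forall t, 0 <= t <= T ->
  0 <= v t /\ b * v t < 1 /\ slit_time b (v t) = t.

Lemma inverse_time_mono (s t : R) : 0 <= s -> s <= t -> t <= T -> v s <= v t.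
Proof.
  intros Hs Hst Ht. apply Rnot_lt_le. intros L.
  destruct (Hv s ltac:(lra)) as [S1 [S2 S3]]. destruct (Hv t ltac:(lra)) as [T1 [T2 T3]].
  pose proof (slit_time_lt b (v s) (v t) Hb S2 T1 L). lra.
Qed.

(** The constant of [slit_time_gap] degenerates as [b * v] tends to 1, the limit of the full circle.
    Taking [V = v T], the largest value, keeps it positive since [b * v T < 1]. *)
Lemma inverse_time_cube : exists K, 0 < K /\ forall s t,
  0 <= s <= T -> 0 <= t <= T -> Rabs (v t - v s) ^ 3 <= K * Rabs (t - s).
Proof.
  destruct (Hv T ltac:(lra)) as [V1 [V2 _]].
  set (k := b * (1 - b * v T) / 6).
  assert (Hk : 0 < k) by (unfold k; apply Rdiv_lt_0_compat; [apply Rmult_lt_0_compat; lra|lra]).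
  exists (/ k). split; [apply Rinv_0_lt_compat; auto|].
  assert (W : forall s t, 0 <= s -> s <= t -> t <= T ->
    Rabs (v t - v s) ^ 3 <= / k * Rabs (t - s)).
  { intros s t Hs Hst Ht. pose proof (inverse_time_mono s t Hs Hst Ht) as M.
    pose proof (inverse_time_mono t T ltac:(lra) Ht ltac:(lra)) as M2.
    destruct (Hv s ltac:(lra)) as [S1 [S2 S3]]. destruct (Hv t ltac:(lra)) as [T1 [T2 T3]].
    pose proof (slit_time_gap b (v T) (v t) (v s) Hb V2 S1 M M2) as G. fold k in G.
    rewrite T3, S3 in G. rewrite !Rabs_right by lra.
    apply Rmult_le_reg_l with k; auto. rewrite <- Rmult_assoc, Rinv_r by lra. lra. }
  intros s t Hs Ht. destruct (Rle_dec s t) as [L|L].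
  - apply W; lra.
  - rewrite Rabs_minus_sym, (Rabs_minus_sym t s). apply W; lra.
Qed.

Lemma inverse_time_continuous (t e : R) : 0 <= t <= T -> 0 < e ->
  exists d, 0 < d /\ forall s, 0 <= s <= T -> Rabs (s - t) < d -> Rabs (v s - v t) < e.
Proof.
  intros Ht He. destruct inverse_time_cube as [K [HK H]].
  exists (e ^ 3 / K). split; [apply Rdiv_lt_0_compat; [apply pow_lt; auto|auto]|].
  intros s Hs Hd. specialize (H t s Ht Hs). apply Rnot_le_lt. intros N.
  assert (e ^ 3 <= Rabs (v s - v t) ^ 3) by (apply pow_incr; lra).
  assert (K * Rabs (s - t) < e ^ 3); [|lra].
  replace (e ^ 3) with (K * (e ^ 3 / K)) by (field; lra).
  apply Rmult_lt_compat_l; auto.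
Qed.

Lemma quadratic_inverse_time_bound (k0 k1 k2 : R) :
  exists L, 0 < L /\ forall s t, 0 <= s <= T -> 0 <= t <= T ->
    Rabs (k0 + k1 * v t + k2 * (v t * v t) - (k0 + k1 * v s + k2 * (v s * v s)))
      <= L * Rabs (v t - v s).
Proof.
  destruct (Hv T ltac:(lra)) as [V1 _]. pose proof (Rabs_pos k1). pose proof (Rabs_pos k2).
  exists (Rabs k1 + Rabs k2 * (2 * v T) + 1). split.
  { assert (0 <= Rabs k2 * (2 * v T)) by (apply Rmult_le_pos; lra). lra. }
  intros s t Hs Ht.
  pose proof (inverse_time_mono s T ltac:(lra) ltac:(lra) ltac:(lra)) as M1.
  pose proof (inverse_time_mono t T ltac:(lra) ltac:(lra) ltac:(lra)) as M2.
  destruct (Hv s Hs) as [S1 _]. destruct (Hv t Ht) as [T1 _].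
  replace (k0 + k1 * v t + k2 * (v t * v t) - (k0 + k1 * v s + k2 * (v s * v s)))
    with ((k1 + k2 * (v t + v s)) * (v t - v s)) by ring.
  rewrite Rabs_mult. apply Rmult_le_compat_r; [apply Rabs_pos|].
  eapply Rle_trans; [apply Rabs_triang|]. rewrite Rabs_mult, (Rabs_right (v t + v s)) by lra.
  assert (Rabs k2 * (v t + v s) <= Rabs k2 * (2 * v T)) by (apply Rmult_le_compat_l; lra).
  lra.
Qed.

Lemma quadratic_inverse_time_continuous (k0 k1 k2 t e : R) : 0 <= t <= T -> 0 < e ->
  exists d, 0 < d /\ forall s, 0 <= s <= T -> Rabs (s - t) < d ->
    Rabs (k0 + k1 * v s + k2 * (v s * v s) - (k0 + k1 * v t + k2 * (v t * v t))) < e.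
Proof.
  intros Ht He. destruct (quadratic_inverse_time_bound k0 k1 k2) as [L [HL B]].
  destruct (inverse_time_continuous t (e / L) Ht) as [d [Hd K]];
    [apply Rdiv_lt_0_compat; auto|].
  exists d. split; auto. intros s Hs Hsd. specialize (K s Hs Hsd).
  eapply Rle_lt_trans; [apply B; auto|].
  replace e with (L * (e / L)) by (field; lra). apply Rmult_lt_compat_l; auto.
Qed.

Lemma quadratic_inverse_time_Lip (k0 k1 k2 : R) :
  Lip (1 / 3) (segment 0 T) (fun t => k0 + k1 * v t + k2 * (v t * v t)).
Proof.
  destruct inverse_time_cube as [K [HK H]].
  destruct (quadratic_inverse_time_bound k0 k1 k2) as [L [HL B]].
  exists (L * Rpower K (1 / 3)). intros s t Hs Ht Hne.
  assert (Hx : 0 < Rabs (t - s)) by (apply Rabs_pos_lt; lra).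
  eapply Rle_trans; [apply B; auto|].
  rewrite Rmult_assoc. apply Rmult_le_compat_l; [lra|].
  apply (cube_root_bound _ K _ (Rabs_pos _) Hx HK). auto.
Qed.

(** With [v s = x + y], the equation [slit_time b (x + y) - t = s - t] is a quartic in [y] without
    constant term. Its linear coefficient [p1] is positive because [0 < x < 1 / b], and dividing by
    it gives the form solved in [quartic_branch]. *)
Lemma quadratic_inverse_time_analytic (t k0 k1 k2 : R) : 0 < t < T ->
  exists (a : nat -> R) r, 0 < r /\ forall s, Rabs (s - t) < r ->
    0 < s < T /\ is_pseries a (s - t) (k0 + k1 * v s + k2 * (v s * v s)).
Proof.
  intros Ht. destruct (Hv t ltac:(lra)) as [T1 [T2 T3]].
  set (x := v t) in *.
  assert (Hx : 0 < x).
  { destruct T1 as [L|E]; auto. rewrite <- E in T3. unfold slit_time in T3.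
    rewrite pow_ne_zero in T3 by lia. unfold Rdiv in T3.
    rewrite Rmult_0_r, !Rmult_0_l in T3. lra. }
  (* [p1] to [p4] are the Taylor coefficients of [slit_time b] at [x]. *)
  set (p1 := b * (x ^ 2 * (1 - b * x)) / 2).
  assert (Hp1 : 0 < p1).
  { unfold p1. apply Rdiv_lt_0_compat; [|lra]. apply Rmult_lt_0_compat; auto.
    apply Rmult_lt_0_compat; [apply pow_lt; auto|lra]. }
  set (p2 := b * (12 * x - 18 * b * x ^ 2) / 24).
  set (p3 := b * (4 - 12 * b * x) / 24).
  set (p4 := - (b * b) / 8).
  (* This [e] keeps [x + y] inside (0, 1 / b), where [slit_time b] is injective, so that the branch
     found coincides with [v s]. *)
  destruct (pos_min3 (x / 2) ((1 - b * x) / (2 * b)) 1) as (e & e0 & e1 & e2 & _);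
    [lra|apply Rdiv_lt_0_compat; lra|lra|].
  assert (e3 : b * e <= (1 - b * x) / 2).
  { replace ((1 - b * x) / 2) with (b * ((1 - b * x) / (2 * b))) by (field; lra).
    apply Rmult_le_compat_l; lra. }
  set (c1 := / p1). set (c2 := - p2 / p1). set (c3 := - p3 / p1). set (c4 := - p4 / p1).
  destruct (quartic_branch c1 c2 c3 c4 e e0) as [r0 [Hr0 Hbr]].
  set (a := quartic_coef c1 c2 c3 c4) in *.
  set (m0 := k0 + k1 * x + k2 * (x * x)). set (m1 := k1 + 2 * k2 * x).
  exists (fun n => monomial 0 m0 n + (m1 * a n + k2 * PS_mult a a n)).
  destruct (pos_min3 r0 t (T - t)) as (r & Hr & r1 & r2 & r3); [lra..|].
  exists r. split; [exact Hr|]. intros s Hs.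
  assert (s1 : Rabs (s - t) < r0) by lra.
  apply Rabs_def2 in Hs.
  split; [lra|].
  destruct (Hbr (s - t) s1) as [y [Y1 [Y2 [Y3 Y4]]]].
  apply Rabs_le_between in Y1.
  assert (Ey : p1 * y + p2 * y ^ 2 + p3 * y ^ 3 + p4 * y ^ 4 = s - t).
  { unfold c1, c2, c3, c4 in Y2.
    apply (f_equal (fun u => p1 * u)) in Y2.
    replace (p1 * (/ p1 * (s - t) + (- p2 / p1 * (y * y) + (- p3 / p1 * (y * (y * y))
      + - p4 / p1 * (y * (y * (y * y)))))))
      with ((s - t) - p2 * y ^ 2 - p3 * y ^ 3 - p4 * y ^ 4) in Y2 by (field; lra).
    lra. }
  assert (Etime : slit_time b (x + y) = s).
  { replace s with (t + (s - t)) by ring. rewrite <- Ey, <- T3.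
    unfold slit_time, p1, p2, p3, p4. field. }
  assert (Evs : v s = x + y).
  { destruct (Hv s ltac:(lra)) as [S1 [S2 S3]].
    assert (b * (x + y) < 1) by nra.
    destruct (Rtotal_order (v s) (x + y)) as [L|[L|L]]; auto.
    - pose proof (slit_time_lt b (x + y) (v s) Hb H S1 L). lra.
    - pose proof (slit_time_lt b (v s) (x + y) Hb S2 ltac:(lra) L). lra. }
  rewrite Evs.
  replace (k0 + k1 * (x + y) + k2 * ((x + y) * (x + y)))
    with (m0 * (s - t) ^ 0 + (m1 * y + k2 * (y * y))) by (unfold m0, m1; simpl; ring).
  apply (is_pseries_add (monomial 0 m0)); [apply is_pseries_monomial|].
  apply (is_pseries_add (fun n => m1 * a n)); apply is_pseries_smul; auto.
Qed.

End InverseTime.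

(** * The driving term *)

Lemma cderiv_in_const_eq_0 (D : R -> Prop) (f : C -> C) (c l : C) (t : R) :
  locally t D -> (forall w, real_in D w -> f w = c) ->
  cderiv_in (real_in D) f (RtoC t) l -> l = 0.
Proof.
  intros HD Hf Hl.
  assert (Ht : real_in D (RtoC t)) by (split; [reflexivity|exact (locally_singleton _ _ HD)]).
  assert (K : cderiv_in (real_in D) (fun _ => c) (RtoC t) l).
  { apply (cderiv_in_ext_loc _ f _ _ _ 1); auto. lra. }
  destruct (is_derive_Re_Im _ t l D HD K) as [K1 K2].
  apply is_derive_unique in K1. apply is_derive_unique in K2.
  rewrite Derive_const in K1, K2.
  destruct l; unfold Re, Im in *; simpl in *. subst. reflexivity.
Qed.

(** Inverse function rule, where [slit_time b] has derivative [b v^2 (1 - b v) / 2]; the continuity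
    of [v] comes from the cubic bound. *)
Lemma cderiv_inverse_time (b T : R) (v : R -> R) (t : R) :
  0 < b -> 0 < T ->
  (forall t, 0 <= t <= T -> 0 <= v t /\ b * v t < 1 /\ slit_time b (v t) = t) ->
  0 < t < T -> 0 < v t ->
  cderiv_in (real_in (fun s => 0 < s < T)) (fun w => RtoC (v (Re w))) (RtoC t)
    (/ RtoC (b * (v t * v t * (1 - b * v t)) / 2))%C.
Proof.
  intros Hb HT Hv Ht Hpos.
  apply (cderiv_in_inverse _ (real_in (fun _ => True))
           (fun w => RtoC (slit_time b (Re w)))).
  - intros [w w'] [W1 W2]. unfold Re, Im in *; simpl in *. subst.
    destruct (Hv w ltac:(lra)) as [_ [_ E]]. rewrite E. reflexivity.
  - intros w _. split; [reflexivity|exact I].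
  - split; [reflexivity|exact Ht].
  - intros e He.
    destruct (inverse_time_continuous b T v Hb HT Hv t e ltac:(lra) He) as [d [Hd K]].
    exists d. split; auto. intros w [W1 W2] Hw. change (Re (RtoC t)) with t.
    rewrite <- RtoC_minus, Cmod_R. apply K; [lra|].
    eapply Rle_lt_trans; [|exact Hw].
    replace (Re w - t) with (Re (w - RtoC t)); [apply re_le_Cmod|].
    destruct w; reflexivity.
  - change (Re (RtoC t)) with t. apply (cderiv_in_of_is_derive _ (slit_time b)).
    unfold slit_time. auto_derive; [auto|]. field.
  - intros E. apply RtoC_inj in E.
    destruct (Hv t ltac:(lra)) as [_ [L _]].
    assert (0 < b * (v t * v t * (1 - b * v t)) / 2); [|lra].
    apply Rdiv_lt_0_compat; [|lra].
    repeat apply Rmult_lt_0_compat; lra.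
Qed.

(** Along the trajectory [W] is constant, so [W_z z' + W_v v' = 0]. Here [W_z] vanishes exactly at
    [z = v - (3/2) b v^2], the preimage of the tip, and inserting the known [v'] turns the relation
    into Loewner's equation with this value as driving term. *)
Lemma driving_value (b T : R) (v : R -> R) (t mu : R) (zt : R -> C) (w0 : C) :
  0 < b -> 0 < T ->
  (forall t, 0 <= t <= T -> 0 <= v t /\ b * v t < 1 /\ slit_time b (v t) = t) ->
  (forall s, 0 < s < T -> 0 < v s /\ upper_half_plane (zt s) /\ slit_W b (v s) (zt s) = w0) ->
  0 < t < T ->
  cderiv_in (real_in (fun s => 0 < s < T)) (fun w => zt (Re w)) (RtoC t)
    (RtoC 2 / (zt t - RtoC mu))%C ->
  mu = v t - 3 * b / 2 * (v t * v t).
Proof.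
  intros Hb HT Hv Hz Ht Hd.
  destruct (Hz t Ht) as [Hvt [Hzt _]].
  pose proof (cderiv_inverse_time b T v t Hb HT Hv Ht Hvt) as DV.
  destruct (Hv t ltac:(lra)) as [_ [Hbv _]].
  set (S := real_in (fun s => 0 < s < T)) in *.
  set (V' := (/ RtoC (b * (v t * v t * (1 - b * v t)) / 2))%C) in *.
  set (Z' := (RtoC 2 / (zt t - RtoC mu))%C) in *.
  assert (HS : forall w, S w -> 0 < Re w < T) by (intros w [_ W]; exact W).
  assert (St : S (RtoC t)) by (split; [reflexivity|exact Ht]).
  set (eta := fun w => slit_eta b (v (Re w)) (zt (Re w))).
  set (V := fun w : C => RtoC (v (Re w))).
  assert (Deta : cderiv_in S eta (RtoC t) (Z' + RtoC (b / 2) * (V' * V (RtoC t) + V (RtoC t) * V'))%C).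
  { apply (cderiv_in_ext_loc _ (fun w => zt (Re w) + RtoC (b / 2) * (V w * V w))%C _ _ _ 1); try lra.
    - unfold eta, slit_eta, V. f_equal. rewrite <- !RtoC_mult. f_equal. field.
    - intros w _ _. unfold eta, slit_eta, V. f_equal. rewrite <- !RtoC_mult. f_equal. field.
    - apply cderiv_in_plus; [exact Hd|]. apply cderiv_in_scal.
      apply (cderiv_in_mult _ V V); exact DV. }
  set (eta' := (Z' + RtoC (b / 2) * (V' * V (RtoC t) + V (RtoC t) * V'))%C) in *.
  assert (Heta : forall w, S w -> eta w <> 0).
  { intros w Hw. apply upper_ne_0, upper_shift. apply Hz. apply HS. exact Hw. }
  assert (Hm : forall w, S w -> upper_half_plane (1 - V w * / eta w)).
  { intros w Hw. destruct (Hz (Re w) (HS w Hw)) as [H1 [H2 _]].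
    apply slit_mobius_upper; auto. }
  pose proof (cderiv_in_inv _ _ _ _ (Heta _ St) Heta Deta) as Dinv.
  pose proof (cderiv_in_mult _ V (fun w => / eta w)%C _ _ _ DV Dinv) as DVi.
  assert (DL : cderiv_in S (fun w => clog (1 - V w * / eta w)) (RtoC t)
    (/ (1 - V (RtoC t) * / eta (RtoC t)) * (0 - (V' * / eta (RtoC t)
       + V (RtoC t) * (- eta' / (eta (RtoC t) * eta (RtoC t))))))%C).
  { apply (cderiv_in_comp _ upper_half_plane clog (fun w => 1 - V w * / eta w)%C).
    - exact Hm.
    - apply cderiv_clog. apply Hm. exact St.
    - apply cderiv_in_minus; [apply cderiv_in_const|exact DVi]. }
  assert (DQ : cderiv_in S (fun w => (1 - RtoC b * V w) * / eta w)%C (RtoC t)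
    ((0 - RtoC b * V') * / eta (RtoC t) + (1 - RtoC b * V (RtoC t))
       * (- eta' / (eta (RtoC t) * eta (RtoC t))))%C).
  { apply (cderiv_in_mult _ (fun w => 1 - RtoC b * V w)%C (fun w => / eta w)%C); [|exact Dinv].
    apply cderiv_in_minus; [apply cderiv_in_const|apply cderiv_in_scal; exact DV]. }
  pose proof (cderiv_in_minus _ _ _ _ _ _ (cderiv_in_scal _ (RtoC b) _ _ _ DL) DQ) as DW.
  apply (cderiv_in_const_eq_0 _ _ w0) in DW.
  3: { intros w Hw. destruct (Hz (Re w) (HS w Hw)) as [_ [_ E]]. rewrite <- E.
       unfold slit_W, eta, V. rewrite RtoC_minus, RtoC_mult. reflexivity. }
  2: { apply (open_and (fun s => 0 < s) (fun s => s < T)); [apply open_gt|apply open_lt|exact Ht]. }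
  pose proof (Heta _ St) as N1. pose proof (upper_ne_0 _ (Hm _ St)) as N2.
  assert (Ee : eta (RtoC t) = (zt t + RtoC b * (RtoC (v t) * RtoC (v t)) / 2)%C).
  { unfold eta, slit_eta. change (Re (RtoC t)) with t. f_equal.
    rewrite RtoC_div, !RtoC_mult by lra. reflexivity. }
  change (V (RtoC t)) with (RtoC (v t)) in *.
  set (e := eta (RtoC t)) in *. set (x := RtoC (v t)) in *.
  assert (N3 : (e - x <> 0)%C).
  { intros E. apply N2. replace (1 - x * / e)%C with ((e - x) * / e)%C by (field; auto).
    rewrite E. ring. }
  assert (Nz : (zt t - RtoC mu <> 0)%C).
  { replace (zt t - RtoC mu)%C with (zt t + RtoC (- mu))%C by (rewrite RtoC_opp; ring).
    apply upper_ne_0, upper_shift. exact Hzt. }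
  assert (Nb : RtoC b <> 0) by (apply RtoC_ne_0; lra).
  assert (Nx : x <> 0) by (apply RtoC_ne_0; lra).
  assert (Nbx : (1 - RtoC b * x <> 0)%C).
  { unfold x. rewrite <- RtoC_mult, <- RtoC_minus. intros E. apply RtoC_inj in E. lra. }
  assert (EV : V' = (2 / (RtoC b * (x * x * (1 - RtoC b * x))))%C).
  { unfold V', x. rewrite RtoC_div, !RtoC_mult, RtoC_minus, RtoC_mult by lra.
    field. repeat split; auto. }
  (* The vanishing total derivative, multiplied by [e^2 (e - x)] to clear denominators; the factor
     of [eta'] is the one that vanishes at the critical point. *)
  assert (E1 : ((e - x + RtoC b * (x * x)) * eta' = RtoC b * x * e * V')%C).
  { assert (M : ((e - x + RtoC b * (x * x)) * eta' - RtoC b * x * e * V' =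
      (RtoC b * (/ (1 - x * / e) * (0 - (V' * / e + x * (- eta' / (e * e)))))
       - ((0 - RtoC b * V') * / e + (1 - RtoC b * x) * (- eta' / (e * e))))
      * (e * e * (e - x)))%C).
    { clearbody eta' V'. field. split; auto. }
    rewrite DW in M.
    replace (RtoC b * x * e * V')%C with
      (RtoC b * x * e * V' + ((e - x + RtoC b * (x * x)) * eta' - RtoC b * x * e * V'))%C
      by (rewrite M; ring).
    ring. }
  (* Substituting [eta' = Z' + b x V'] and [b x^2 (1 - b x) V' = 2] collapses the relation to the
     equality of two denominators. *)
  assert (E2 : (e - x + RtoC b * (x * x) = zt t - RtoC mu)%C).
  { assert (M : (e - x + RtoC b * (x * x) - (zt t - RtoC mu) =
      ((e - x + RtoC b * (x * x)) * eta' - RtoC b * x * e * V') * ((zt t - RtoC mu) / 2))%C).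
    { unfold eta'. rewrite RtoC_div by lra. rewrite EV. unfold Z'. field. repeat split; auto. }
    rewrite E1 in M.
    replace (e - x + RtoC b * (x * x))%C with
      ((zt t - RtoC mu) + (e - x + RtoC b * (x * x) - (zt t - RtoC mu)))%C by ring.
    rewrite M. ring. }
  rewrite Ee in E2. apply RtoC_inj.
  rewrite RtoC_minus, RtoC_mult, RtoC_div, !RtoC_mult by lra. fold x.
  replace (RtoC mu) with (zt t - (zt t - RtoC mu))%C by ring. rewrite <- E2. field.
Qed.

(** In terms of [k = slit_height b v] the tip is [b (-1 - k - ln k)], where [k + ln k] takes every
    real value, and [v = 1 / (b (k + 1))]. Thus every slit of the given height is covered, wherever
    it ends. *)
Lemma slit_tip_surj (b xi : R) : 0 < b -> exists v, 0 < v /\ b * v < 1 /\ slit_tip b v = xi.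
Proof.
  intros Hb. set (c := - 1 - xi / b).
  pose proof (Rabs_pos c) as Pc. pose proof (Rle_abs c) as L1.
  pose proof (Rle_abs (- c)) as L2. rewrite Rabs_Ropp in L2.
  (* [ln k1 = - |c| - 1] and [k1 < 1] put the value at [k1] below [c]; at [k2] the term [k2] alone
     exceeds [c], and its logarithm is nonnegative. *)
  set (k1 := exp (- Rabs c - 1)). set (k2 := Rabs c + 1).
  assert (H1 : 0 < k1) by apply exp_pos.
  assert (H1' : k1 < exp 0) by (apply exp_increasing; lra). rewrite exp_0 in H1'.
  assert (Hk : exists k, 0 < k /\ k + ln k = c).
  { assert (S1 : k1 + ln k1 - c < 0) by (unfold k1 at 2; rewrite ln_exp; lra).
    assert (S2 : 0 < k2 + ln k2 - c).
    { assert (0 <= ln k2) by (rewrite <- ln_1; apply ln_le; unfold k2; lra).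
      unfold k2 in *. lra. }
    destruct (Ranalysis5.IVT_interv (fun k => k + ln k - c) k1 k2) as [k [Hk E]].
    - intros k Hk. apply derivable_continuous_pt, ex_derive_Reals_0. auto_derive. lra.
    - unfold k2. lra.
    - exact S1.
    - exact S2.
    - exists k. lra. }
  destruct Hk as [k [Hk E]]. exists (/ (b * (k + 1))).
  assert (0 < b * (k + 1)) by (apply Rmult_lt_0_compat; lra).
  assert (Ebv : b * / (b * (k + 1)) = / (k + 1)) by (field; lra).
  split; [apply Rinv_0_lt_compat; auto|split].
  - rewrite Ebv, <- Rinv_1. apply Rinv_lt_contravar; lra.
  - unfold slit_tip. replace (slit_height b (/ (b * (k + 1)))) with k.
    + replace (-1 - k - ln k) with (- 1 - c) by lra. unfold c. field. lra.
    + unfold slit_height. rewrite Ebv. field. lra.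
Qed.

(** A parameter is chosen at each time without any link between times. [slit_map_identified] forces
    it to invert [slit_time b], which supplies the regularity in [t] that [driving_value]
    requires. *)
Lemma driving_term_of_slits (b T : R) (xi : R -> R) (f : C -> R -> C) (lam : R -> R) :
  0 < b -> 0 < T ->
  (forall t, 0 < t <= T -> exists k : C -> C,
     (forall z, slit_dom b (xi t) z -> exists l, cderiv_in everywhere (fun z => f z t) z l) /\
     (forall w, upper_half_plane w -> exists l, cderiv_in everywhere k w l) /\
     (forall z, slit_dom b (xi t) z -> upper_half_plane (f z t) /\ k (f z t) = z) /\
     (forall w, upper_half_plane w -> slit_dom b (xi t) (k w) /\ f (k w) t = w)) ->
  (forall t, 0 < t <= T ->
     hydrodynamic_at_infinity (slit_dom b (xi t)) t (fun z => f z t)) ->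
  (forall t z, 0 < t < T -> slit_dom b (xi t) z ->
     cderiv_in (real_in (segment 0 T)) (fun w => f z (Re w)) (RtoC t)
       (RtoC 2 / (f z t - RtoC (lam t)))%C) ->
  exists v : R -> R,
    (forall t, 0 <= t <= T -> 0 <= v t /\ b * v t < 1 /\ slit_time b (v t) = t) /\
    (forall t, 0 < t < T -> lam t = v t - 3 * b / 2 * (v t * v t)).
Proof.
  intros Hb HT Hconf Hhyd Hode.
  assert (Hex : forall t, exists x, (t = 0 -> x = 0) /\ (0 < t <= T -> 0 < x /\ b * x < 1 /\
    slit_time b x = t /\ forall z, slit_dom b (xi t) z -> slit_W b x (f z t) = (- / z)%C)).
  { intros t. destruct (classic (0 < t <= T)) as [Ht|Ht].
    2: { exists 0. tauto. }
    destruct (slit_tip_surj b (xi t) Hb) as [x [X1 [X2 X3]]].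
    exists x. split; [lra|]. intros _.
    destruct (Hconf t Ht) as [k [C1 [C2 [C3 C4]]]].
    specialize (Hhyd t Ht). rewrite <- X3 in *.
    destruct (slit_map_identified b x t (fun z => f z t) k Hb X1 X2 C1 C2 C3 C4 Hhyd) as [E1 E2].
    auto. }
  set (v := fun t => proj1_sig (constructive_indefinite_description _ (Hex t))).
  assert (Hv : forall t, (t = 0 -> v t = 0) /\ (0 < t <= T -> 0 < v t /\ b * v t < 1 /\
    slit_time b (v t) = t /\ forall z, slit_dom b (xi t) z -> slit_W b (v t) (f z t) = (- / z)%C)).
  { intros t. exact (proj2_sig (constructive_indefinite_description _ (Hex t))). }
  clearbody v. exists v.
  assert (Hinv : forall t, 0 <= t <= T -> 0 <= v t /\ b * v t < 1 /\ slit_time b (v t) = t).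
  { intros t Ht. destruct (Hv t) as [H0 H1]. destruct (Req_dec t 0) as [->|N].
    - rewrite H0 by auto. unfold slit_time.
      split; [lra|split; [lra|field]].
    - destruct H1 as [H1 [H2 [H3 _]]]; [lra|]. repeat split; auto. lra. }
  split; [exact Hinv|]. intros t Ht.
  pose proof PI_RGT_0 as Hpi.
  assert (Hbp : 0 < b * PI) by (apply Rmult_lt_0_compat; lra).
  (* A point at half the height of the slit line lies on none of the slits, so one trajectory serves
     all times. *)
  set (w0 := (0, b * PI / 2) : C).
  assert (Hw0 : upper_half_plane w0) by (unfold upper_half_plane, w0, Im; simpl; lra).
  pose proof (upper_ne_0 _ Hw0) as Nw0.
  set (z0 := (- / w0)%C).
  assert (Hz0 : upper_half_plane z0) by (apply upper_opp_inv; exact Hw0).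
  assert (Ez0 : (- / z0 = w0)%C) by (unfold z0; field; auto).
  assert (Dz0 : forall s, slit_dom b (xi s) z0).
  { intros s. split; [exact Hz0|]. rewrite Ez0. intros [E _]. unfold w0, Im in E; simpl in E. lra. }
  apply (driving_value b T v t (lam t) (fun s => f z0 s) w0); auto.
  - intros s Hs. destruct (Hv s) as [_ Hvs]. destruct Hvs as [H1 [_ [_ H2]]]; [lra|].
    split; [exact H1|]. rewrite <- Ez0. split; [|apply H2; auto].
    destruct (Hconf s ltac:(lra)) as [k [_ [_ [C3 _]]]]. apply C3. auto.
  - apply (cderiv_in_sub _ (real_in (segment 0 T))).
    + intros w [W1 W2]. split; auto. unfold segment. lra.
    + apply Hode; auto.
Qed.

(* [refl true] is the identity and [refl false] the reflection in the imaginary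
   axis, which exchanges the two orientations of the arc. *)
Definition refl (s : bool) (z : C) : C := if s then z else (- Cconj z)%C.

Definition sgn_of (s : bool) : R := if s then 1 else -1.

Lemma sgn_of_mult (s : bool) : sgn_of s * sgn_of s = 1.
Proof. destruct s; simpl; ring. Qed.

Lemma refl_refl (s : bool) (z : C) : refl s (refl s z) = z.
Proof.
  destruct s, z; simpl; auto. unfold Cconj, Copp; simpl. f_equal; ring.
Qed.

Lemma refl_plus (s : bool) (z w : C) : refl s (z + w) = (refl s z + refl s w)%C.
Proof.
  destruct s, z, w; simpl; auto. unfold Cconj, Copp, Cplus; simpl. f_equal; ring.
Qed.

Lemma refl_minus (s : bool) (z w : C) : refl s (z - w) = (refl s z - refl s w)%C.
Proof.
  destruct s, z, w; simpl; auto. unfold Cconj, Cminus, Copp, Cplus; simpl. f_equal; ring.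
Qed.

Lemma Cmod_refl (s : bool) (z : C) : Cmod (refl s z) = Cmod z.
Proof. destruct s; simpl; auto. rewrite Cmod_opp, Cmod_conj. reflexivity. Qed.

Lemma Im_refl (s : bool) (z : C) : Im (refl s z) = Im z.
Proof. destruct s, z; unfold Im; simpl; ring. Qed.

Lemma Re_refl (s : bool) (z : C) : Re (refl s z) = sgn_of s * Re z.
Proof. destruct s, z; unfold Re; simpl; ring. Qed.

Lemma refl_RtoC (s : bool) (x : R) : refl s (RtoC x) = RtoC (sgn_of s * x).
Proof.
  destruct s; simpl; unfold RtoC, Cconj, Copp; simpl; f_equal; ring.
Qed.

Lemma refl_RtoC_mult (s : bool) (x : R) (z : C) : refl s (RtoC x * z) = (RtoC x * refl s z)%C.
Proof.
  destruct s, z; simpl; auto. unfold RtoC, Cconj, Copp, Cmult; simpl. f_equal; ring.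
Qed.

Lemma refl_inv (s : bool) (z : C) : refl s (/ z)%C = (/ refl s z)%C.
Proof.
  destruct s, z as [x y]; simpl; auto. unfold Cconj, Copp, Cinv; simpl.
  replace (- x * (- x * 1) + - - y * (- - y * 1)) with (x * (x * 1) + y * (y * 1)) by ring.
  unfold Rdiv. f_equal; ring.
Qed.

Lemma refl_opp (s : bool) (z : C) : refl s (- z) = (- refl s z)%C.
Proof. destruct s, z; reflexivity. Qed.

(** Reflecting before and after makes two conjugations, so the result is again holomorphic, with
    conjugated slope; [kap] is this conjugation. *)
Lemma cderiv_refl (s : bool) (f : C -> C) (x0 : R) (z l : C) :
  cderiv_in everywhere f (refl s z + RtoC x0)%C l ->
  exists m, cderiv_in everywhere (fun z => refl s (f (refl s z + RtoC x0) - RtoC x0)%C) z m.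
Proof.
  intros [q [Hq [_ H]]].
  set (kap := fun z : C => if s then z else Cconj z).
  assert (Hk : forall a d, refl s (a * d) = (kap a * refl s d)%C).
  { intros [a1 a2] [d1 d2]. unfold kap. destruct s; simpl; auto.
    unfold Cconj, Copp, Cmult; simpl. f_equal; ring. }
  assert (Hkm : forall a c, Cmod (kap a - kap c) = Cmod (a - c)).
  { intros a c. unfold kap. destruct s; auto. rewrite <- Cmod_conj. f_equal.
    destruct a, c. unfold Cconj, Cminus, Cplus, Copp; simpl. f_equal; ring. }
  exists (kap (q (refl s z + RtoC x0)%C)).
  exists (fun w => kap (q (refl s w + RtoC x0)%C)). split; [|split; auto].
  - intros e He. destruct (Hq e He) as [d [Hd K]]. exists d. split; auto.
    intros w _ Hw. rewrite Hkm. apply K; [exact I|].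
    replace (refl s w + RtoC x0 - (refl s z + RtoC x0))%C with (refl s (w - z))
      by (rewrite refl_minus; ring).
    rewrite Cmod_refl. exact Hw.
  - intros w _. rewrite <- refl_minus.
    replace (f (refl s w + RtoC x0) - RtoC x0 - (f (refl s z + RtoC x0) - RtoC x0))%C
      with (f (refl s w + RtoC x0)%C - f (refl s z + RtoC x0)%C)%C by ring.
    rewrite H by exact I. rewrite Hk. f_equal.
    replace (refl s w + RtoC x0 - (refl s z + RtoC x0))%C with (refl s (w - z))
      by (rewrite refl_minus; ring).
    apply refl_refl.
Qed.

(** Time increments are real and the reflection commutes with real factors, so the velocity is
    reflected like the curve. *)
Lemma cderiv_refl_curve (D : R -> Prop) (s : bool) (f : C -> C) (x0 t : R) (l : C) :
  cderiv_in (real_in D) f (RtoC t) l ->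
  cderiv_in (real_in D) (fun w => refl s (f w - RtoC x0)) (RtoC t) (refl s l).
Proof.
  intros [q [Hq [<- H]]]. exists (fun w => refl s (q w)). split; [|split; auto].
  - intros e He. destruct (Hq e He) as [d [Hd K]]. exists d. split; auto.
    intros w Sw Hw. rewrite <- refl_minus, Cmod_refl. auto.
  - intros w Sw. rewrite <- refl_minus.
    replace (f w - RtoC x0 - (f (RtoC t) - RtoC x0))%C with (f w - f (RtoC t))%C by ring.
    rewrite H by auto. destruct Sw as [W1 _].
    replace w with (RtoC (Re w)) by (destruct w; unfold Im in W1; simpl in W1; subst; reflexivity).
    rewrite <- RtoC_minus, Cmult_comm, refl_RtoC_mult. ring.
Qed.

(** Moving the origin changes [2 t / z] by a term of order -2, and the constants cancel because the
    target is shifted back by the same amount. *)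
Lemma hydrodynamic_refl (D D' : C -> Prop) (s : bool) (x0 t : R) (f : C -> C) :
  (forall z, D' z -> z <> 0 /\ D (refl s z + RtoC x0)%C) ->
  hydrodynamic_at_infinity D t f ->
  hydrodynamic_at_infinity D' t (fun z => refl s (f (refl s z + RtoC x0) - RtoC x0)%C).
Proof.
  intros HD (M & K & HM & H).
  (* For [|z|] this large the shifted point [y] has [|y| >= |z| / 2] and [|y| >= M]. The factors 4
     and 2 come from [|y|^2 >= |z|^2 / 4] and [|z| |y| >= |z|^2 / 2]. *)
  exists (2 * M + 2 * Rabs x0 + 1), (4 * Rabs K + 2 * Rabs (2 * t * (sgn_of s * x0))).
  pose proof (Rabs_pos x0) as Px.
  split; [lra|]. intros z Hz Hge. destruct (HD z Hz) as [Nz Hy].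
  set (y := (refl s z + RtoC x0)%C) in *.
  set (y' := (z + RtoC (sgn_of s * x0))%C).
  assert (Ey : refl s y = y').
  { unfold y, y'. rewrite refl_plus, refl_refl, refl_RtoC. reflexivity. }
  assert (Ly : Cmod z / 2 <= Cmod y).
  { unfold y. pose proof (Cmod_sub_ge (refl s z) (- RtoC x0)) as L.
    rewrite Cmod_opp, Cmod_R, Cmod_refl in L.
    replace (refl s z - - RtoC x0)%C with (refl s z + RtoC x0)%C in L by ring. lra. }
  assert (Ly' : Cmod y' = Cmod y) by (rewrite <- Ey; apply Cmod_refl).
  assert (Ny : y <> 0) by (apply Cmod_gt_0; lra).
  assert (Ny' : y' <> 0) by (apply Cmod_gt_0; lra).
  specialize (H y Hy ltac:(lra)).
  assert (Pz : 0 < Cmod z) by (apply Cmod_gt_0; auto).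
  replace (refl s (f y - RtoC x0) - (z + RtoC (2 * t) / z))%C
    with (refl s (f y - (y + RtoC (2 * t) / y)) -
          RtoC (2 * t * (sgn_of s * x0)) / (z * y'))%C.
  - unfold Cminus at 1. eapply Rle_trans; [apply Cmod_triangle|].
    rewrite Cmod_refl, Cmod_opp, Cmod_div by (apply Cmult_neq_0; auto).
    rewrite Cmod_mult, Cmod_R, Ly'.
    replace ((4 * Rabs K + 2 * Rabs (2 * t * (sgn_of s * x0))) / Cmod z ^ 2)
      with (Rabs K / (Cmod z / 2) ^ 2 + Rabs (2 * t * (sgn_of s * x0)) / (Cmod z * (Cmod z / 2)))
      by (field; lra).
    apply Rplus_le_compat.
    + eapply Rle_trans; [exact H|].
      apply Rle_trans with (Rabs K / Cmod y ^ 2).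
      * apply Rmult_le_compat_r; [|apply Rle_abs].
        apply Rlt_le, Rinv_0_lt_compat, pow_lt. lra.
      * apply Rmult_le_compat_l; [apply Rabs_pos|].
        apply Rinv_le_contravar; [apply pow_lt; lra|]. apply pow_incr. lra.
    + apply Rmult_le_compat_l; [apply Rabs_pos|].
      apply Rinv_le_contravar; [apply Rmult_lt_0_compat; lra|].
      apply Rmult_le_compat_l; lra.
  - unfold Cdiv at 1. rewrite !refl_minus, refl_plus, refl_RtoC_mult, refl_inv, Ey, refl_RtoC.
    replace (RtoC (2 * t * (sgn_of s * x0))) with (RtoC (2 * t) * (y' - z))%C.
    + unfold y' at 1. replace (RtoC (sgn_of s * x0)) with (y' - z)%C by (unfold y'; ring).
      field. split; auto.
    + unfold y'. rewrite <- RtoC_mult || rewrite (RtoC_mult (2 * t)). ring.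
Qed.

(** * The arc under inversion *)

Lemma continuous_on_eps (D : R -> Prop) (g : R -> C) (s e : R) :
  continuous_on D g -> D s -> 0 < e ->
  exists d, 0 < d /\ forall s', D s' -> Rabs (s' - s) < d -> Cmod (g s' - g s) < e.
Proof.
  intros Hg Hs He. assert (He2 : 0 < e / 2) by lra.
  destruct (Hg s Hs _ (locally_ball (g s : C_UniformSpace) (mkposreal _ He2))) as [d K].
  exists d. split; [apply cond_pos|]. intros s' Hs' Hd.
  destruct (K s' Hd Hs') as [K1 K2].
  rewrite ball_R in K1, K2. cbn [pos] in K1, K2.
  eapply Rle_lt_trans; [apply Cmod_le_Re_Im|].
  destruct (g s'), (g s). unfold Re, Im; simpl in *. unfold Rminus in *. lra.
Qed.

Lemma continuous_on_R_eps (D : R -> Prop) (g : R -> R) (s e : R) :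
  continuous_on D g -> D s -> 0 < e ->
  exists d, 0 < d /\ forall s', D s' -> Rabs (s' - s) < d -> Rabs (g s' - g s) < e.
Proof.
  intros Hg Hs He.
  destruct (Hg s Hs _ (locally_ball (g s) (mkposreal _ He))) as [d K].
  exists d. split; [apply cond_pos|]. intros s' Hs' Hd. exact (K s' Hd Hs').
Qed.

(** The pairs [s < t] form a convex set on which [X t - X s] never vanishes; moving linearly from
    one pair to another shows that its sign is constant. *)
Lemma injective_continuous_monotone (X : R -> R) (T : R) :
  (forall s, 0 < s -> continuity_pt X s) ->
  (forall s t, 0 < s <= T -> 0 < t <= T -> X s = X t -> s = t) ->
  (forall s t, 0 < s -> s < t -> t <= T -> X s < X t) \/
  (forall s t, 0 < s -> s < t -> t <= T -> X t < X s).
Proof.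
  intros Hc Hinj.
  destruct (classic (exists s t, 0 < s /\ s < t /\ t <= T /\ X s < X t)) as [H|H].
  - left. destruct H as (s' & t' & H1 & H2 & H3 & H4). intros s t Hs Hst Ht.
    assert (P : forall th, 0 <= th <= 1 ->
      0 < s + th * (s' - s) /\ s + th * (s' - s) < t + th * (t' - t) /\
      t + th * (t' - t) <= T).
    { intros th Hth. assert (0 <= (1 - th) * (T - t)) by nra.
      assert (0 <= th * (T - t')) by nra.
      repeat split; [destruct (Rle_dec s s'); nra| |nra].
      destruct (Rle_dec (t - s) (t' - s')); nra. }
    enough (K : 0 < X (t + 0 * (t' - t)) - X (s + 0 * (s' - s))).
    { rewrite !Rmult_0_l, !Rplus_0_r in K. lra. }
    apply (never_equal_same_side
      (fun th => X (t + th * (t' - t)) - X (s + th * (s' - s))) 0 1).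
    + lra.
    + intros th Hth. destruct (P th Hth) as (P1 & P2 & P3).
      assert (A : forall p q, continuous (fun th => p + th * (q - p)) th).
      { intros p q. apply (ex_derive_continuous (V := R_NormedModule)). auto_derive. auto. }
      apply (continuous_minus (V := R_NormedModule) (fun th => X (t + th * (t' - t)))
        (fun th => X (s + th * (s' - s))));
        [apply (continuous_comp (fun th => t + th * (t' - t)) X)
        |apply (continuous_comp (fun th => s + th * (s' - s)) X)];
        try apply A; apply continuity_pt_filterlim, Hc; lra.
    + intros th Hth E. destruct (P th Hth) as (P1 & P2 & P3).
      assert (s + th * (s' - s) = t + th * (t' - t)); [apply Hinj; lra|lra].
    + replace (t + 1 * (t' - t)) with t' by ring. replace (s + 1 * (s' - s)) with s' by ring. lra.
  - right. intros s t Hs Hst Ht. destruct (Rtotal_order (X t) (X s)) as [L|[L|L]]; auto.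
    + assert (t = s) by (apply Hinj; lra). lra.
    + exfalso. apply H. exists s, t. auto.
Qed.

(** An increasing function that is unbounded near 0 tends to minus infinity there, so its values on
    (0, t] fill the half-line up to [X t]. *)
Lemma increasing_range (X : R -> R) (T : R) :
  (forall s, 0 < s -> continuity_pt X s) ->
  (forall s t, 0 < s -> s < t -> t <= T -> X s < X t) ->
  (forall M t, 0 < t -> exists s, 0 < s < t /\ M < Rabs (X s)) ->
  forall t x, 0 < t <= T -> (x <= X t <-> exists s, 0 < s <= t /\ X s = x).
Proof.
  intros Hc Hinc Hunb t x Ht. split.
  - intros Hx. destruct Hx as [Hx|Hx]; [|exists t; split; [lra|auto]].
    destruct (Hunb (Rabs x + Rabs (X t)) t (proj1 Ht)) as [s [Hs Hs']].
    assert (L : X s < X t) by (apply Hinc; lra).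
    assert (Lx : X s < x).
    { pose proof (Rle_abs (X t)) as L1. pose proof (Rle_abs (- x)) as L2.
      rewrite Rabs_Ropp in L2. pose proof (Rabs_pos x). pose proof (Rabs_pos (X t)).
      destruct (Rle_dec 0 (X s)) as [P|P].
      - rewrite (Rabs_right (X s)) in Hs' by lra. lra.
      - rewrite (Rabs_left (X s)) in Hs' by lra. lra. }
    destruct (Ranalysis5.IVT_interv (fun u => X u - x) s t) as [u [Hu E]]; try lra.
    + intros u Hu. apply continuity_pt_minus; [apply Hc; lra|].
      apply continuity_pt_const. intros ? ?; reflexivity.
    + exists u. split; lra.
  - intros [s [Hs <-]]. destruct (Req_dec s t) as [->|N]; [lra|].
    left. apply Hinc; lra.
Qed.

(** On the circle [|z|^2 = 2 r Im z], while [Im (- 1 / z) = Im z / |z|^2]. *)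
Lemma Im_inv_circle (z : C) (r : R) : 0 < r -> upper_half_plane z ->
  Cmod (z - Ci * RtoC r) = r -> Im (- / z) = / (2 * r).
Proof.
  intros Hr Hz H. pose proof (upper_ne_0 z Hz) as N. pose proof (Cmod_pos_Im z Hz) as M.
  unfold upper_half_plane in Hz.
  assert (E : Cmod z * Cmod z = 2 * r * Im z).
  { pose proof (Cmod2_alt (z - Ci * RtoC r)) as H2. rewrite H in H2.
    pose proof (Cmod2_alt z) as H1. destruct z as [x y].
    unfold Re, Im in *; simpl in *. nra. }
  replace (Im (- / z)) with (- Im (/ z)) by (destruct (/ z)%C; reflexivity).
  rewrite Im_inv, E by auto. field. split; lra.
Qed.

(* Under z |-> - 1 / (z - x0) the arc becomes a horizontal half-line, traversed
   from infinity; [s] records the side it comes from. *)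
Lemma slit_half_plane_arc (x0 r T : R) (g : R -> C) :
  0 < r -> 0 < T -> tangent_circular_arc x0 r T g ->
  exists (s : bool) (xi : R -> R), forall t z, 0 < t <= T ->
    (slit_half_plane g t (refl s z + RtoC x0)%C <-> slit_dom (/ (2 * PI * r)) (xi t) z).
Proof.
  intros Hr HT (G0 & Gc & Gi & Gu & Gr). pose proof PI_RGT_0 as Hpi.
  (* Clamping the parameter extends [g] continuously to all of R, so that continuity at [T] becomes
     two-sided. *)
  set (gb := fun s => g (Rmax 0 (Rmin s T))).
  assert (Egb : forall s, 0 <= s <= T -> gb s = g s).
  { intros s Hs. unfold gb. rewrite Rmin_left, Rmax_right by lra. reflexivity. }
  assert (Hcl : forall s, segment 0 T (Rmax 0 (Rmin s T))).
  { intros s. split; [apply Rmax_l|]. apply Rmax_lub; [lra|apply Rmin_r]. }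
  assert (Hup : forall s, 0 < s -> upper_half_plane (gb s - RtoC x0)).
  { intros s Hs. assert (K : upper_half_plane (gb s)).
    { apply Gu. split; [|apply Hcl]. rewrite Rmax_right.
      - apply Rmin_glb_lt; auto.
      - left. apply Rmin_glb_lt; auto. }
    replace (gb s - RtoC x0)%C with (gb s + RtoC (- x0))%C by (rewrite RtoC_opp; ring).
    apply upper_shift. exact K. }
  set (X := fun s => Re (- / (gb s - RtoC x0))).
  assert (Hgbc : forall s e, 0 < e -> exists d, 0 < d /\ forall s', Rabs (s' - s) < d ->
    Cmod (gb s' - gb s) < e).
  { intros s e He. destruct (continuous_on_eps _ _ _ e Gc (Hcl s) He) as [d [Hd K]].
    exists d. split; auto. intros s' Hs'. apply K; [apply Hcl|].
    eapply Rle_lt_trans; [|exact Hs'].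
    unfold Rmax, Rmin; repeat destruct Rle_dec; unfold Rabs; repeat destruct Rcase_abs; lra. }
  assert (Xc : forall s, 0 < s -> continuity_pt X s).
  { intros s Hs.
    assert (K : continuous_in (real_in (fun u => 0 < u)) (fun w => - / (gb (Re w) - RtoC x0))%C (RtoC s)).
    { apply (continuous_in_ext_loc _ (fun w => - (1) * / (gb (Re w) - RtoC x0))%C _ _ 1); try lra.
      - ring.
      - intros; ring.
      - apply continuous_in_mult; [apply continuous_in_const|].
        apply continuous_in_inv; [apply upper_ne_0, Hup; exact Hs|].
        intros e He. destruct (Hgbc s e He) as [d [Hd K]]. exists d. split; auto.
        intros w [W1 W2] Hw. change (Re (RtoC s)) with s.
        replace (gb (Re w) - RtoC x0 - (gb s - RtoC x0))%C with (gb (Re w) - gb s)%C by ring.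
        apply K. eapply Rle_lt_trans; [|exact Hw].
        replace (Re w - s) with (Re (w - RtoC s)); [apply re_le_Cmod|destruct w; reflexivity]. }
    apply continuity_pt_filterlim. intros P [e HP].
    destruct (K e (cond_pos e)) as [d [Hd Kd]].
    assert (Hm : 0 < Rmin d s) by (apply Rmin_glb_lt; auto).
    exists (mkposreal _ Hm). intros s' Hs'. apply HP.
    rewrite ball_R in *. cbn [pos] in *.
    assert (A1 : Rabs (s' - s) < d) by (eapply Rlt_le_trans; [exact Hs'|apply Rmin_l]).
    assert (A2 : Rabs (s' - s) < s) by (eapply Rlt_le_trans; [exact Hs'|apply Rmin_r]).
    apply Rabs_def2 in A2.
    specialize (Kd (RtoC s')). rewrite <- RtoC_minus, Cmod_R in Kd.
    specialize (Kd ltac:(split; [reflexivity|simpl; lra]) A1).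
    eapply Rle_lt_trans; [|exact Kd]. eapply Rle_trans; [|apply re_le_Cmod].
    right. f_equal. }
  assert (Him : forall s, 0 < s -> Im (- / (gb s - RtoC x0)) = / (2 * r)).
  { intros s Hs. apply Im_inv_circle; auto.
    specialize (Gr _ (Hcl s)). fold (gb s) in Gr.
    replace (gb s - RtoC x0 - Ci * RtoC r)%C with (gb s - (RtoC x0 + Ci * RtoC r))%C by ring.
    exact Gr. }
  assert (Hrec : forall z w : C, z <> 0 -> w <> 0 -> (- / z = - / w)%C -> z = w).
  { intros z w Nz Nw E. replace z with (- / - / z)%C by (field; auto). rewrite E. field. auto. }
  assert (Hext : forall z w : C, Re z = Re w -> Im z = Im w -> z = w).
  { intros [a b] [a' b'] H1 H2. unfold Re, Im in *; simpl in *. subst. reflexivity. }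
  assert (Xi : forall s t, 0 < s <= T -> 0 < t <= T -> X s = X t -> s = t).
  { intros s t Hs Ht E. apply Gi; [split; lra|split; lra|].
    rewrite <- (Egb s), <- (Egb t) by lra.
    assert (E' : (gb s - RtoC x0 = gb t - RtoC x0)%C).
    { apply Hrec; try (apply upper_ne_0, Hup; lra).
      apply Hext; [exact E|]. rewrite !Him by lra. reflexivity. }
    replace (gb s) with (gb s - RtoC x0 + RtoC x0)%C by ring. rewrite E'. ring. }
  (* Near time 0 the inverted arc is far from the origin while its imaginary part stays [1 / (2 r)];
     so its real part is unbounded. *)
  assert (Hunb : forall M t, 0 < t -> exists s, 0 < s < t /\ M < Rabs (X s)).
  { intros M t Ht. pose proof (Rabs_pos M) as PM.
    assert (Pi : 0 < / (2 * r)) by (apply Rinv_0_lt_compat; lra).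
    set (L := Rabs M + / (2 * r) + 1).
    assert (HL : 0 < / L) by (apply Rinv_0_lt_compat; unfold L; lra).
    destruct (Hgbc 0 (/ L) HL) as [d [Hd K]].
    set (s := Rmin (t / 2) (d / 2)).
    assert (S1 : s <= t / 2) by apply Rmin_l. assert (S2 : s <= d / 2) by apply Rmin_r.
    assert (S0 : 0 < s) by (apply Rmin_glb_lt; lra).
    exists s. split; [lra|].
    specialize (K s). rewrite Rminus_0_r, (Rabs_right s) in K by lra.
    specialize (K ltac:(lra)). rewrite (Egb 0), G0 in K by lra.
    pose proof (Cmod_pos_Im _ (Hup s S0)) as Pm.
    assert (B : L < Cmod (- / (gb s - RtoC x0))).
    { rewrite Cmod_opp, Cmod_inv by (apply upper_ne_0, Hup; auto).
      rewrite <- (Rinv_inv L). apply Rinv_lt_contravar; [|exact K].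
      apply Rmult_lt_0_compat; auto. }
    pose proof (Cmod_le_Re_Im (- / (gb s - RtoC x0))) as B2.
    rewrite Him, (Rabs_right (/ (2 * r))) in B2 by lra. fold (X s) in B2.
    pose proof (Rle_abs M). unfold L in B. lra. }
  (* The arc may leave [x0] towards either side; the sign makes the real part increasing in both
     cases. *)
  assert (Main : exists s : bool, forall t x, 0 < t <= T ->
    (x <= sgn_of s * X t <-> exists u, 0 < u <= t /\ sgn_of s * X u = x)).
  { destruct (injective_continuous_monotone X T Xc Xi) as [Hi|Hd].
    - exists true. apply (increasing_range (fun t => sgn_of true * X t) T).
      + intros s Hs. simpl. apply continuity_pt_mult; [|auto].
        apply continuity_pt_const. intros ? ?; reflexivity.
      + intros s t Hs Hst Ht. simpl. specialize (Hi s t Hs Hst Ht). lra.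
      + intros M t Ht. destruct (Hunb M t Ht) as [s [S1 S2]]. exists s. split; auto.
        simpl. rewrite Rmult_1_l. exact S2.
    - exists false. apply (increasing_range (fun t => sgn_of false * X t) T).
      + intros s Hs. simpl. apply continuity_pt_mult; [|auto].
        apply continuity_pt_const. intros ? ?; reflexivity.
      + intros s t Hs Hst Ht. simpl. specialize (Hd s t Hs Hst Ht). lra.
      + intros M t Ht. destruct (Hunb M t Ht) as [s [S1 S2]]. exists s. split; auto.
        simpl. replace (-1 * X s) with (- X s) by ring. rewrite Rabs_Ropp. exact S2. }
  destruct Main as [s Hs]. exists s, (fun t => sgn_of s * X t). intros t z Ht.
  assert (Hupz : upper_half_plane (refl s z + RtoC x0) <-> upper_half_plane z).
  { unfold upper_half_plane. rewrite Im_plus, Im_refl. simpl. rewrite Rplus_0_r. tauto. }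
  assert (Eh : / (2 * PI * r) * PI = / (2 * r)) by (field; lra).
  assert (Harc : upper_half_plane z ->
    (initial_arc g t (refl s z + RtoC x0)%C <->
     Im (- / z) = / (2 * PI * r) * PI /\ Re (- / z) <= sgn_of s * X t)).
  { intros Hz. rewrite Eh, (Hs t (Re (- / z)) Ht).
    assert (Hzz : forall u, 0 < u <= t -> g u = (refl s z + RtoC x0)%C ->
      (- / (gb u - RtoC x0) = refl s (- / z))%C).
    { intros u Hu E. rewrite (Egb u), E by lra. rewrite refl_opp, refl_inv.
      f_equal. f_equal. ring. }
    split.
    - intros [u [[U1 U2] E]].
      assert (0 < u).
      { destruct U1 as [U1|U1]; auto. rewrite <- U1, G0 in E.
        apply Hupz in Hz. rewrite <- E in Hz. unfold upper_half_plane in Hz. simpl in Hz. lra. }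
      assert (Hu : 0 < u <= t) by lra. specialize (Hzz u Hu E).
      split.
      + rewrite <- (Im_refl s), <- Hzz. apply Him. lra.
      + exists u. split; auto. unfold X. rewrite Hzz, Re_refl, <- Rmult_assoc, sgn_of_mult. ring.
    - intros [E1 [u [Hu E2]]]. exists u. split; [split; lra|].
      rewrite <- (Egb u) by lra.
      assert (E : (gb u - RtoC x0 = refl s z)%C).
      { apply Hrec.
        - apply upper_ne_0, Hup. lra.
        - apply upper_ne_0. unfold upper_half_plane in *. rewrite Im_refl. exact Hz.
        - rewrite <- refl_inv, <- refl_opp. apply Hext.
          + rewrite Re_refl, <- E2, <- Rmult_assoc, sgn_of_mult, Rmult_1_l. reflexivity.
          + rewrite Im_refl, E1. apply Him. lra. }
      rewrite <- E. ring. }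
  unfold slit_half_plane, slit_dom. rewrite Hupz. split.
  - intros [H1 H2]. split; auto. intros K. apply H2. apply Harc; auto.
  - intros [H1 H2]. split; auto. intros K. apply H2. apply Harc; auto.
Qed.

(** * Passage to the closed interval and conclusion *)

Lemma continuous_on_segment_ext (T : R) (p q : R -> R) : 0 < T ->
  (forall t e, 0 <= t <= T -> 0 < e -> exists d, 0 < d /\ forall s, 0 <= s <= T ->
     Rabs (s - t) < d -> Rabs (p s - p t) < e) ->
  (forall t e, 0 <= t <= T -> 0 < e -> exists d, 0 < d /\ forall s, 0 <= s <= T ->
     Rabs (s - t) < d -> Rabs (q s - q t) < e) ->
  (forall t, 0 < t < T -> p t = q t) -> forall t, 0 <= t <= T -> p t = q t.
Proof.
  intros HT Hp Hq E t Ht. apply NNPP. intros N.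
  assert (P : 0 < Rabs (p t - q t)) by (apply Rabs_pos_lt; lra).
  destruct (Hp t (Rabs (p t - q t) / 2) Ht ltac:(lra)) as [d1 [D1 K1]].
  destruct (Hq t (Rabs (p t - q t) / 2) Ht ltac:(lra)) as [d2 [D2 K2]].
  destruct (pos_min3 (T / 2) (d1 / 2) (d2 / 2)) as (d & M0 & M1 & M2 & M3); [lra..|].
  assert (Hs : exists s, 0 < s < T /\ Rabs (s - t) <= d).
  { destruct (Rle_dec t (T / 2)).
    - exists (t + d / 2). split; [lra|]. apply Rabs_le. lra.
    - exists (t - d / 2). split; [lra|]. apply Rabs_le. lra. }
  destruct Hs as [s [Hs Hd]].
  specialize (K1 s ltac:(lra) ltac:(lra)). specialize (K2 s ltac:(lra) ltac:(lra)).
  rewrite (E s Hs) in K1. rewrite Rabs_minus_sym in K1.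
  pose proof (Rabs_triang (p t - q s) (q s - q t)) as L.
  replace (p t - q s + (q s - q t)) with (p t - q t) in L by ring. lra.
Qed.

Theorem mainTheorem1 (x0 r T : R) (g : R -> C) (h : C -> R -> C) (lambda : R -> R)
  (hr : 0 < r) (hT : 0 < T)
  (hg : tangent_circular_arc x0 r T g)
  (hconf : forall t, segment 0 T t ->
     conformal_onto (slit_half_plane g t) upper_half_plane (fun z => h z t))
  (hnorm : forall t, segment 0 T t ->
     hydrodynamic_at_infinity (slit_half_plane g t) t (fun z => h z t))
  (hcont : continuous_on (segment 0 T) lambda)
  (hloewner : forall t z, segment 0 T t -> slit_half_plane g t z ->
     is_derive_within (segment 0 T) (fun s => h z s) t
       (RtoC 2 / (h z t - RtoC (lambda t)))%C)
  (hinit : forall z, upper_half_plane z -> h z 0 = z) :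
  Lip (1 / 3) (segment 0 T) lambda /\
  (exists delta, 0 < delta <= T /\ Lip (1 / 3) (segment 0 delta) lambda) /\
  (forall t, 0 < t < T -> analytic_at lambda t).
Proof.
  destruct (slit_half_plane_arc x0 r T g hr hT hg) as [s [xi Harc]].
  set (b := / (2 * PI * r)) in *.
  assert (Hb : 0 < b).
  { pose proof PI_RGT_0. apply Rinv_0_lt_compat, Rmult_lt_0_compat; lra. }
  (* The given maps, conjugated by the translation that moves [x0] to 0 and, for one orientation of
     the arc, by the reflection. *)
  set (f := fun z t => refl s (h (refl s z + RtoC x0)%C t - RtoC x0)).
  assert (Hupr : forall w, upper_half_plane w -> upper_half_plane (refl s w + RtoC x0)).
  { intros w Hw. apply upper_shift. unfold upper_half_plane. rewrite Im_refl. exact Hw. }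
  assert (Hupr' : forall w, upper_half_plane w -> upper_half_plane (refl s (w - RtoC x0))).
  { intros w Hw. unfold upper_half_plane. rewrite Im_refl.
    replace (w - RtoC x0)%C with (w + RtoC (- x0))%C by (rewrite RtoC_opp; ring).
    apply upper_shift. exact Hw. }
  assert (Hback : forall w, (refl s (refl s (w - RtoC x0)) + RtoC x0 = w)%C)
    by (intros w; rewrite refl_refl; ring).
  assert (Hforth : forall w, (refl s (refl s w + RtoC x0 - RtoC x0) = w)%C).
  { intros w. replace (refl s w + RtoC x0 - RtoC x0)%C with (refl s w) by ring. apply refl_refl. }
  destruct (driving_term_of_slits b T xi f (fun t => sgn_of s * (lambda t - x0)) Hb hT)
    as [v [Hv Hlam]].
  - intros t Ht. destruct (hconf t) as [Hhol [k [Khol [K1 K2]]]]; [split; lra|].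
    exists (fun w => refl s (k (refl s w + RtoC x0)%C - RtoC x0)). repeat split.
    + intros z Hz. apply (Harc t z Ht) in Hz. specialize (Hhol _ Hz).
      apply ex_derive_cderiv in Hhol. destruct Hhol as [l Hl].
      exact (cderiv_refl s (fun z => h z t) x0 z l Hl).
    + intros w Hw. specialize (Khol _ (Hupr w Hw)).
      apply ex_derive_cderiv in Khol. destruct Khol as [l Hl].
      exact (cderiv_refl s k x0 w l Hl).
    + apply (Harc t z Ht) in H. destruct (K1 _ H) as [U _]. apply Hupr'. exact U.
    + apply (Harc t z Ht) in H. destruct (K1 _ H) as [_ E]. unfold f. rewrite Hback, E.
      apply Hforth.
    + destruct (K2 _ (Hupr w H)) as [U _].
      apply (Harc t _ Ht). rewrite Hback. exact U.
    + destruct (K2 _ (Hupr w H)) as [U _].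
      apply (Harc t _ Ht). rewrite Hback. exact U.
    + destruct (K2 _ (Hupr w H)) as [_ E]. unfold f. rewrite Hback, E. apply Hforth.
  - intros t Ht. apply (hydrodynamic_refl (slit_half_plane g t) _ s x0 t (fun z => h z t)).
    + intros z Hz. split; [apply upper_ne_0; apply Hz|]. apply (Harc t z Ht). exact Hz.
    + apply hnorm. split; lra.
  - intros t z Ht Hz. apply (Harc t z ltac:(lra)) in Hz.
    assert (St : segment 0 T t) by (split; lra).
    pose proof (is_derive_within_cderiv _ _ _ _ St (hloewner t _ St Hz)) as K.
    apply (cderiv_refl_curve _ s _ x0) in K.
    eapply cderiv_in_eq; [exact K|].
    unfold Cdiv. rewrite refl_RtoC_mult, refl_inv. unfold f. f_equal. f_equal.
    rewrite <- refl_RtoC, <- refl_minus, RtoC_minus. f_equal. ring.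
  (* Undoes the conjugation: since the sign squares to 1, [lambda] is [x0] plus the sign times
     [v - (3/2) b v^2]. *)
  - set (k1 := sgn_of s). set (k2 := - (sgn_of s * (3 * b / 2))).
    set (q := fun t => x0 + k1 * v t + k2 * (v t * v t)).
    pose proof (quadratic_inverse_time_Lip b T v Hb hT Hv x0 k1 k2) as HLip. fold q in HLip.
    assert (Eopen : forall t, 0 < t < T -> lambda t = q t).
    { intros t Ht. specialize (Hlam t Ht). unfold q, k1, k2.
      pose proof (sgn_of_mult s) as S2.
      apply (f_equal (fun u => sgn_of s * u)) in Hlam.
      rewrite <- Rmult_assoc, S2 in Hlam. lra. }
    (* The formula is so far known on the open interval, and both sides are continuous on the closed
       one. *)
    assert (E : forall t, 0 <= t <= T -> lambda t = q t).
    { apply continuous_on_segment_ext; auto.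
      - intros t e Ht He. exact (continuous_on_R_eps _ _ t e hcont Ht He).
      - intros t e Ht He.
        exact (quadratic_inverse_time_continuous b T v Hb hT Hv x0 k1 k2 t e Ht He). }
    assert (HL : Lip (1 / 3) (segment 0 T) lambda).
    { destruct HLip as [K HK]. exists K. intros u t Hu Ht Hne.
      rewrite (E u Hu), (E t Ht). apply HK; auto. }
    split; [exact HL|split].
    + exists T. split; [lra|exact HL].
    + intros t Ht.
      destruct (quadratic_inverse_time_analytic b T v Hb Hv t x0 k1 k2 Ht) as (a & rho & Hrho & Ha).
      exists a, rho. split; auto. intros u Hu. destruct (Ha u Hu) as [Hu' Hs].
      rewrite (Eopen u Hu'). exact Hs.
Qed.
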